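(* Let $\mu\in\mathbb{R}$, $\sigma>0$, let $(W_s)_{s\ge 0}$ be a standard Brownian motion, and for $t\ge 0$ let $I_t=\int_0^t e^{-(\mu s+\sigma W_s)}\,ds$. Let $F(t,y)=P(I_t\le y)$ be the cumulative distribution function of $I_t$, let $\bar F(t,y)=1-F(t,y)$ for $t>0$, $y\ge 0$, and for $\lambda>0$ let $$P(y,\lambda)=\int_0^\infty e^{-\lambda t}\,\bar F(t,y)\,dt .$$ Set $b=\mu+\frac{\sigma^2}{2}$. Then for every $\lambda>0$, the function $y\mapsto P(y,\lambda)$ satisfies the differential equation $$\frac{1}{2}\sigma^2 y^2 P''_{yy}+(by-1)P'_y-\lambda P=0$$ with boundary conditions $$P(0,\lambda)=\frac{1}{\lambda},\qquad \lim_{y\to+\infty}P(y,\lambda)=0,$$ and explicitly, for $y>0$, $$P(y,\lambda)=\frac{1}{\lambda}\left(\frac{2}{y\sigma^2}\right)^{k}\frac{\Gamma\!\left(1-\frac{2\mu}{\sigma^2}+k\right)}{\Gamma\!\left(1-\frac{2\mu}{\sigma^2}+2k\right)}\,M\!\left(k,\,1-\frac{2\mu}{\sigma^2}+2k,\,-\frac{2}{y\sigma^2}\right),$$ where $k=\frac{\mu+\sqrt{\mu^2+2\lambda\sigma^2}}{\sigma^2}$.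
   Context: $M$ denotes Kummer's confluent hypergeometric function of the first kind, $M(a,b,z)=\sum_{n=0}^\infty\frac{(a)_n z^n}{(b)_n\, n!}$, where $(a)_0=1$ and $(a)_n=a(a+1)\cdots(a+n-1)$ is the Pochhammer symbol (similarly for $(b)_n$). $\Gamma$ is the Gamma function. Primes denote derivatives with respect to $y$. *)

(* Defs.v *)
From HB Require Import structures.
From mathcomp Require Import all_boot all_order all_algebra.
From mathcomp Require Import all_classical all_reals all_analysis.
Set Implicit Arguments. Unset Strict Implicit. Unset Printing Implicit Defensive.
Import Order.TTheory GRing.Theory Num.Theory.
Import numFieldNormedType.Exports.
Local Open Scope classical_set_scope.
Local Open Scope ring_scope.

Definition mutually_independent_RV d (T : measurableType d) (R : realType)
    (P : probability T R) (n : nat) (X : 'I_n -> T -> R) : Prop :=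
  forall B : 'I_n -> set R, (forall i, measurable (B i)) ->
    P (\bigcap_(i in [set: 'I_n]) [set w | B i (X i w)])
    = (\prod_(i < n) P [set w | B i (X i w)])%E.

(* Standard (one-dimensional) Brownian motion (W_t)_{t >= 0} on the
   probability space (T, P): W_0 = 0, continuous paths on [0, +oo),
   each W_t measurable, W_t - W_s ~ N(0, t - s) for 0 <= s < t, and
   increments over successive times 0 <= t_0 <= t_1 <= ... <= t_n are
   mutually independent.  (Values W t for t < 0 are irrelevant.) *)
Definition standard_brownian_motion d (T : measurableType d) (R : realType)
    (P : probability T R) (W : R -> T -> R) : Prop :=
  [/\ (forall w, W 0 w = 0),
      (forall w, {within `[0, +oo[, continuous (fun t => W t w)}),
      (forall t, 0 <= t -> measurable_fun [set: T] (W t)),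
      (forall s t, 0 <= s -> s < t -> forall A : set R, measurable A ->
          P [set w | A (W t w - W s w)] = normal_prob 0 (Num.sqrt (t - s)) A)
    & (forall (n : nat) (tt : nat -> R), 0 <= tt 0%N ->
          (forall i, (i < n)%N -> tt i <= tt i.+1) ->
          mutually_independent_RV P
            (fun i : 'I_n => fun w => W (tt i.+1) w - W (tt i) w))].

Definition expo_functional d (T : measurableType d) (R : realType)
    (W : R -> T -> R) (mu sigma t : R) (w : T) : R :=
  fine (\int[lebesgue_measure]_(s in `[0%R, t])
          (expR (- (mu * s + sigma * W s w)))%:E)%E.

Definition cdf_I d (T : measurableType d) (R : realType) (P : probability T R)
    (W : R -> T -> R) (mu sigma t y : R) : R :=
  fine (P [set w | expo_functional W mu sigma t w <= y]).

Definition tail_I d (T : measurableType d) (R : realType) (P : probability T R)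
    (W : R -> T -> R) (mu sigma t y : R) : R :=
  1 - cdf_I P W mu sigma t y.

Definition laplace_tail d (T : measurableType d) (R : realType)
    (P : probability T R) (W : R -> T -> R) (mu sigma lambda y : R) : R :=
  fine (\int[lebesgue_measure]_(t in `]0%R, +oo[)
          (expR (- (lambda * t)) * tail_I P W mu sigma t y)%:E)%E.

Definition Gamma (R : realType) (x : R) : R :=
  fine (\int[lebesgue_measure]_(t in `]0%R, +oo[)
          (powR t (x - 1) * expR (- t))%:E)%E.

Definition pochhammer (R : realType) (a : R) (n : nat) : R :=
  \prod_(i < n) (a + i%:R).

Definition kummerM (R : realType) (a b z : R) : R :=
  limn (series (fun n : nat =>
    pochhammer a n * z ^+ n / (pochhammer b n * (n`!)%:R))).

(* Main.v *)
Require Import Defs.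
From HB Require Import structures.
From mathcomp Require Import all_boot all_order all_algebra.
From mathcomp Require Import ring lra.
From mathcomp Require Import all_classical all_reals all_analysis.
From mathcomp Require Import measurable_realfun.
Set Implicit Arguments. Unset Strict Implicit. Unset Printing Implicit Defensive.
Import Order.TTheory GRing.Theory Num.Theory.
Import numFieldNormedType.Exports.
Local Open Scope classical_set_scope.
Local Open Scope ring_scope.

(** Write [X_t = mu t + sigma W_t] and [q = e^{-lambda h}].  For a mesh [h], the left
    Riemann sum [R_j] of [e^{-X}] on [0, j h] satisfies
    [R_{j+1} > y  <=>  R'_j > e^{X_h} (y - h)], with [R'_j] a copy of [R_j] independent of [X_h];
    hence [G_j(y) = P(R_j > y)] is the [j]-th iterate of a lognormal transition kernel [S]
    applied to the indicator of the negative half-line, and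
    [U_n = sum_(j < n) (1 - q) q^j G_j + q^n] solves [U_{n+1} = (1 - q) G_0 + q S U_n].
    The Kummer function [f] of the statement (times [lambda]) solves the differential
    equation, so a Taylor expansion and the explicit exponential moments of Gaussian variables
    give [q S f = f + o(h)] uniformly on [y0, +oo[.  Near [0] both [f] and [U_n] are close
    to [1]: for [f] this is the representation
    [f(y) = Gamma(k)^-1 int_0^oo e^-v v^(k-1) (1 - v / z)_+^(c+k-1) dv] with
    [z = 2 / (y sigma^2)], which comes from the Beta-Gamma identity.  As [q < 1], the two
    functions are uniformly close, and letting [h] tend to [0] identifies
    [lambda] times the Laplace transform of the tail with [f]. *)

(** * Gamma and Beta integrals *)

(** The map y -> e^{X_h} (y - h) has generator (sigma^2 / 2) y^2 d^2 + (b y - 1) d, so the equation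
    of the statement says that [f] is invariant, to first order in h, under one discounted step;
    only the Gaussian law of an increment and independence enter. The obstacle is y near 0: the
    relative drift - h / y is unbounded there, so consistency is uniform only on [y0, +oo[, and
    below y0 both functions must be pinned to 1 beforehand. This is why the limit of [f] at 0 has to
    be known, and not merely its equation. The comparison is then a discrete maximum principle; it
    takes the place of a uniqueness theorem for the boundary value problem, and the regularity of P
    is inherited from [f]. A last obstacle is that the law of I_t is not known to be free of atoms:
    the tails of the Riemann sums are controlled from below at y and from above only at every y' >
    y, and continuity of [f] closes the gap. *)

Section lebesgue_affine.
Variable R : realType.
Local Notation mu := (@lebesgue_measure R).
Local Open Scope ereal_scope.

(** [a] times the pushforward of Lebesgue measure by x -> a x + b agrees with Lebesgue measure on
    half-open intervals, hence everywhere. *)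
Lemma ge0_integral_affine (f : R -> \bar R) (a b : R) : (0 < a)%R ->
  measurable_fun [set: R] f -> (forall x, 0 <= f x) ->
  \int[mu]_x f x = a%:E * \int[mu]_x f (a * x + b)%R.
Proof.
move=> a0 mf f0.
pose phi : measurableTypeR R -> measurableTypeR R := fun x => (a * x + b)%R.
have mphi : measurable_fun setT phi.
  by apply: measurable_funD => //; exact: measurable_funM.
pose na := NngNum (ltW a0).
have /= := @ge0_integral_pushforward _ _ _ _ R phi mphi mu setT f measurableT mf (fun y _ => f0 y).
rewrite preimage_setT; move=> mE.
pose m : {measure set (measurableTypeR R) -> \bar R} :=
  measure_function_pushforward__canonical__measure_function_Measure mu mphi.
have E A : measurable A -> mu A = mscale na m A.
  apply: lebesgue_measure_unique => _ [[u v] _ <-] /=.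
  have Ephi : phi @^-1` [set` `]u, v]] = [set` `](u - b) / a, (v - b) / a]%R].
    apply/seteqP; split => x /=; rewrite !in_itv /= ltr_pdivrMr// ler_pdivlMr//;
    by rewrite /phi ltrBlDr lerBrDr mulrC.
  transitivity (a%:E * mu (phi @^-1` [set` `]u, v]])); last by [].
  rewrite Ephi !lebesgue_measure_itv /= !lte_fin.
  rewrite ltr_pM2r ?invr_gt0// ltrD2r.
  case: ifPn => _; last by rewrite mule0.
  rewrite -!EFinB -EFinM; congr EFin; field; exact: lt0r_neq0.
transitivity (\int[mscale na m]_x f x).
  by apply: eq_measure_integral => A mA _; exact: E.
by rewrite ge0_integral_mscale//= mE.
Qed.

End lebesgue_affine.

Section gamma_beta.
Variable R : realType.
Local Notation mu := (@lebesgue_measure R).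

(** Extension by zero makes the convolution below an integral over the whole line, where
    translations and scalings act freely. *)
Definition gamma_dens (x : R) : R -> R :=
  (fun t => t `^ (x - 1) * expR (- t)) \_ `]0, +oo[.

Definition beta_dens (x y : R) : R -> R :=
  (fun u => u `^ (x - 1) * (1 - u) `^ (y - 1)) \_ `]0, 1[.

Lemma gamma_densE x t : 0 < t -> gamma_dens x t = t `^ (x - 1) * expR (- t).
Proof. by move=> t0; rewrite /gamma_dens patchE ifT// inE/= in_itv/= t0. Qed.

Lemma gamma_dens0 x t : t <= 0 -> gamma_dens x t = 0.
Proof.
move=> t0; rewrite /gamma_dens patchE ifF//; apply/negbTE/negP.
by rewrite inE/= in_itv/= andbT ltNge t0.
Qed.

Lemma beta_densE x y u : 0 < u < 1 ->
  beta_dens x y u = u `^ (x - 1) * (1 - u) `^ (y - 1).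
Proof. by move=> t0; rewrite /beta_dens patchE ifT// inE/= in_itv/= t0. Qed.

Lemma beta_dens0 x y u : ~~ (0 < u < 1) -> beta_dens x y u = 0.
Proof.
by move=> t0; rewrite /beta_dens patchE ifF//; apply/negbTE/negP; rewrite inE/= in_itv/=; exact/negP.
Qed.

Lemma gamma_dens_ge0 x t : 0 <= gamma_dens x t.
Proof. by apply: restrict_ge0 => s _; rewrite mulr_ge0 ?powR_ge0 ?expR_ge0. Qed.

Lemma beta_dens_ge0 x y t : 0 <= beta_dens x y t.
Proof. by apply: restrict_ge0 => s _; rewrite mulr_ge0 ?powR_ge0. Qed.

Lemma measurable_gamma_dens x : measurable_fun setT (gamma_dens x).
Proof.
apply/measurable_restrict => //; apply: measurable_funTS.
apply: measurable_funM; first exact: measurable_powR.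
by apply: measurableT_comp.
Qed.

Lemma measurable_beta_dens x y : measurable_fun setT (beta_dens x y).
Proof.
apply/measurable_restrict => //; apply: measurable_funTS.
apply: measurable_funM; first exact: measurable_powR.
by apply: (measurableT_comp (measurable_powR _)); exact: measurable_funB.
Qed.

(** With s = w u, the product of the densities at s and w - s separates into a function of [w] and a
    Beta density in [u]. The factor 1 / w is cancelled later by the Jacobian of s = w u. *)
Lemma gamma_dens_convol (x y w u : R) : 0 < w ->
  gamma_dens x (w * u) * gamma_dens y (w - w * u) =
  w `^ (x + y - 1) * expR (- w) / w * beta_dens x y u.
Proof.
move=> w0; have [u01|u01] := boolP (0 < u < 1); last first.
  rewrite beta_dens0// mulr0; move: u01; rewrite negb_and -!leNgt => /orP[u0|u1].
    by rewrite gamma_dens0 ?mul0r// mulr_ge0_le0// ltW.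
  by rewrite mulrC gamma_dens0 ?mul0r// subr_le0 ler_peMr// ltW.
have /andP[u0 u1] := u01.
rewrite beta_densE// !gamma_densE; last 2 first.
- by rewrite subr_gt0 gtr_pMr.
- by rewrite mulr_gt0.
have -> : w - w * u = w * (1 - u) by ring.
rewrite !powRM ?subr_ge0 ?ltW//.
have -> : expR (- w) = expR (- (w * u)) * expR (- (w * (1 - u))).
  by rewrite -expRD; congr expR; ring.
have -> : w `^ (x + y - 1) = w `^ (x - 1) * w `^ (y - 1) * w.
  rewrite -[X in _ * _ * X](powRr1 (ltW w0)) -!powRD ?(gt_eqF w0) ?implybT//.
  by congr (_ `^ _); ring.
by field; exact: lt0r_neq0.
Qed.

(** Half of the exponential decay absorbs the power; what remains is integrable at infinity. *)
Lemma gamma_dens_bound (y : R) : 1 <= y -> exists2 C : R, 0 <= C &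
  forall t, 0 < t -> t `^ (y - 1) * expR (- t) <= C * expR (- (2^-1 * t)).
Proof.
(* [n] exceeds y, and n! 2^n comes from the term (t / 2)^n / n! of the series of e^(t / 2); the
   summand 1 covers t <= 1. *)
move=> y1; pose n := (Num.truncn y).+1; pose C : R := 1 + n`!%:R * 2 ^+ n.
have C0 : 0 <= C by rewrite addr_ge0// mulr_ge0// exprn_ge0.
exists C => // t t0.
have -> : expR (- t) = expR (- (2^-1 * t)) * expR (- (2^-1 * t)).
  by rewrite -expRD; congr expR; field.
rewrite mulrA; apply: ler_wpM2r; first exact: expR_ge0.
rewrite expRN ler_pdivrMr ?expR_gt0//.
have [t1|t1] := leP t 1.
  apply: (@le_trans _ _ 1).
    have e1 : (1 : R) `^ (y - 1) = 1 by rewrite powR1.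
    rewrite -[leRHS]e1; apply: ge0_ler_powR; rewrite ?nnegrE ?subr_ge0//; exact: ltW.
  rewrite mulr_ege1// ?lerDl ?mulr_ge0// ?exprn_ge0//.
  by rewrite -expR0 ler_expR mulr_ge0// ltW.
apply: (@le_trans _ _ (t ^+ n)).
  rewrite -powR_mulrn; last exact: ltW.
  apply: ler_powR; first exact: ltW.
  by rewrite lerBlDr (le_trans (ltW (truncnS_gt _)))// lerDl.
apply: (@le_trans _ _ (n`!%:R * 2 ^+ n * expR (2^-1 * t))); last first.
  by rewrite ler_wpM2r ?expR_ge0// lerDr.
have t2 : 0 <= 2^-1 * t by rewrite mulr_ge0// ltW.
have := expR_ge1Dxn (Num.truncn y) t2; rewrite -/n => H2.
have H3 : (2^-1 * t) ^+ n / n`!%:R <= expR (2^-1 * t) by rewrite (le_trans _ H2)// lerDr.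
have -> : t ^+ n = n`!%:R * 2 ^+ n * ((2^-1 * t) ^+ n / n`!%:R).
  rewrite exprMn exprVn; field; rewrite pnatr_eq0 -lt0n fact_gt0 /=.
  by rewrite expf_neq0.
by rewrite ler_wpM2l// mulr_ge0// exprn_ge0.
Qed.

Local Open Scope ereal_scope.

Definition gamma_int (x : R) := \int[mu]_t (gamma_dens x t)%:E.
Definition beta_int (x y : R) := \int[mu]_t (beta_dens x y t)%:E.

Lemma GammaE x : Gamma x = fine (gamma_int x).
Proof.
rewrite /Gamma integral_mkcond /gamma_int; congr fine.
by apply: eq_integral => t _; rewrite /gamma_dens restrict_EFin.
Qed.

Lemma gamma_int_ge0 x : 0 <= gamma_int x.
Proof. by apply: integral_ge0 => t _; rewrite lee_fin gamma_dens_ge0. Qed.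

Lemma beta_int_ge0 x y : 0 <= beta_int x y.
Proof. by apply: integral_ge0 => t _; rewrite lee_fin beta_dens_ge0. Qed.

(** Tonelli for the product of the densities at s and w - s: integrating in w first gives the
    left-hand side, in s first the right-hand side. The identity lives in [0, +oo], so that
    finiteness can be deduced from it. *)
Lemma gamma_beta x y : gamma_int x * gamma_int y = beta_int x y * gamma_int (x + y).
Proof.
have mg z : measurable_fun setT (EFin \o gamma_dens z).
  by apply/measurable_EFinP; exact: measurable_gamma_dens.
pose F (p : R * R) := (gamma_dens x p.1 * gamma_dens y (p.2 - p.1))%:E.
have mF : measurable_fun setT F.
  apply/measurable_EFinP; apply: measurable_funM.
    exact: (measurableT_comp (measurable_gamma_dens x)).
  apply: (measurableT_comp (measurable_gamma_dens y)).
  exact: measurable_funB.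
have F0 p : 0 <= F p by rewrite lee_fin mulr_ge0 ?gamma_dens_ge0.
transitivity (\int[mu]_s \int[mu]_w F (s, w)).
  rewrite /gamma_int -ge0_integralZr//; [|exact: mg|
    by move=> t _; rewrite lee_fin gamma_dens_ge0|exact: gamma_int_ge0].
  apply: eq_integral => s _; rewrite /F /=.
  under [RHS]eq_integral do rewrite EFinM.
  rewrite ge0_integralZl//=; last 3 first.
  - apply/measurable_EFinP; apply: (measurableT_comp (measurable_gamma_dens y)).
    exact: measurable_funB.
  - by move=> t _; rewrite lee_fin gamma_dens_ge0.
  - by rewrite lee_fin gamma_dens_ge0.
  congr (_ * _).
  rewrite (@ge0_integral_affine R (EFin \o gamma_dens y) 1 (- s)%R)//=; last first.
    by move=> t; rewrite lee_fin gamma_dens_ge0.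
  by rewrite mul1e; apply: eq_integral => t _; rewrite mul1r.
rewrite (@fubini_tonelli _ _ _ _ _ mu mu F mF F0) /gamma_int -ge0_integralZl//; last 3 first.
- exact: mg.
- by move=> t _; rewrite lee_fin gamma_dens_ge0.
- exact: beta_int_ge0.
apply: eq_integral => w _; rewrite /F /=.
have [w0|w0] := leP w 0%R.
  rewrite gamma_dens0// mule0 integral0_eq// => s _.
  have [s0|s0] := leP s 0%R; first by rewrite gamma_dens0// mul0r.
  by rewrite (@gamma_dens0 y) ?mulr0// subr_le0 (le_trans w0)// ltW.
rewrite (@ge0_integral_affine R
  (fun s => (gamma_dens x s * gamma_dens y (w - s))%:E) w 0%R)//=; last 2 first.
- apply/measurable_EFinP; apply: measurable_funM; first exact: measurable_gamma_dens.
  apply: (measurableT_comp (measurable_gamma_dens y)).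
  exact: measurable_funB.
- by move=> s; rewrite lee_fin mulr_ge0 ?gamma_dens_ge0.
rewrite muleC /beta_int.
transitivity (\int[mu]_u ((w `^ (x + y - 1) * expR (- w) / w)%R%:E * (beta_dens x y u)%:E)
   * w%:E).
  congr (_ * _); apply: eq_integral => u _; rewrite addr0 -EFinM; congr EFin.
  exact: gamma_dens_convol.
rewrite ge0_integralZl//; last 3 first.
- by apply/measurable_EFinP; exact: measurable_beta_dens.
- by move=> t _; rewrite lee_fin beta_dens_ge0.
- by rewrite lee_fin mulr_ge0 ?invr_ge0 ?ltW// mulr_gt0 ?powR_gt0 ?expR_gt0.
rewrite gamma_densE// -muleA muleCA; congr (_ * _).
by rewrite -EFinM; congr EFin; field; exact: lt0r_neq0.
Qed.

Lemma integral_expRN (l : R) : (0 < l)%R ->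
  \int[mu]_(t in `]0%R, +oo[) (expR (- (l * t)))%:E = (l^-1)%:E.
Proof.
move=> l0; have mexp : measurable_fun setT (fun t : R => expR (- (l * t))).
  by apply: measurableT_comp => //; apply: measurableT_comp => //; exact: measurable_funM.
have H : l%:E * \int[mu]_(t in `]0%R, +oo[) (expR (- (l * t)))%:E = 1.
  rewrite -(@integral_exponential_pdf R l l0).
  rewrite (@integral_itv_obnd_cbnd _ 0%R _ (EFin \o (fun t : R => expR (- (l * t))))); last first.
    by apply: measurable_funTS; apply/measurable_EFinP.
  rewrite -ge0_integralZl_EFin//; last 3 first.
  - by move=> t _; rewrite lee_fin expR_ge0.
  - by apply: measurable_funTS; apply/measurable_EFinP.
  - exact: ltW.
  rewrite integral_mkcond; apply: eq_integral => t _.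
  rewrite /exponential_pdf !patchE; case: ifPn => // _.
  by rewrite /= -EFinM mulNr.
have : (l^-1)%:E * (l%:E * \int[mu]_(t in `]0%R, +oo[) (expR (- (l * t)))%:E) = (l^-1)%:E.
  by rewrite H mule1.
by rewrite muleA -EFinM mulVf ?mul1e// gt_eqF.
Qed.

Lemma gamma_int1 : gamma_int 1 = 1.
Proof.
have := @integral_expRN 1 ltr01; rewrite invr1 => <-.
rewrite integral_mkcond; apply: eq_integral => t _.
rewrite /gamma_dens !patchE; case: ifPn => // _.
by rewrite subrr powRr0 !mul1r.
Qed.

(** For x < 1 the integrand is unbounded at 0: the fundamental theorem of calculus is applied on
    [1 / (n + 1), 1], followed by monotone convergence. *)
Lemma beta_int1 (x : R) : (0 < x)%R -> beta_int x 1 = (x^-1)%:E.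
Proof.
move=> x0.
pose F (n : nat) : set R := [set` `[(n.+1%:R^-1)%R, 1%R] ].
pose g (u : R) := (u `^ (x - 1))%R%:E.
have FU : \bigcup_n F n = [set` `]0%R, 1%R] ].
  apply/seteqP; split => u /=.
    move=> [n _]; rewrite /F /= !in_itv /= => /andP[h1 ->]; rewrite andbT.
    by apply: lt_le_trans h1; rewrite invr_gt0.
  rewrite in_itv /= => /andP[u0 u1]; exists (Num.truncn u^-1) => //.
  rewrite /F /= in_itv /= u1 andbT -[leRHS]invrK lef_pV2 ?posrE ?invr_gt0//.
  exact/ltW/truncnS_gt.
have mg : measurable_fun setT g by apply/measurable_EFinP; exact: measurable_powR.
have g0 u : 0 <= g u by rewrite lee_fin powR_ge0.
have cg : \int[mu]_(u in F n) g u @[n --> \oo] --> \int[mu]_(u in \bigcup_n F n) g u.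
  apply: ge0_nondecreasing_set_cvg_integral => //.
  - move=> m n mn; apply/subsetPset; rewrite /F => u /=.
    rewrite !in_itv /= => /andP[h ->]; rewrite andbT (le_trans _ h)//.
    by rewrite lef_pV2 ?posrE// ler_nat.
  - by move=> i; exact: measurable_itv.
  - by move=> i; exact: measurable_funTS.
(* The shifted index drops [F 0], which is the single point 1: the fundamental theorem asks for
   distinct bounds. *)
have Fint n : \int[mu]_(u in F n.+1) g u = (x^-1 - (n.+2%:R^-1) `^ x / x)%R%:E.
  have n0 : (0 < n.+2%:R^-1 :> R)%R by rewrite invr_gt0.
  have n1 : (n.+2%:R^-1 < 1 :> R)%R by rewrite invf_lt1// ltr1n.
  rewrite /F /g (@continuous_FTC2 _ _ (fun u => (u `^ x / x)%R))//.
  - by rewrite powR1 /= -EFinB mul1r.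
  - apply: continuous_in_subspaceT => u; rewrite inE /= in_itv /= => /andP[u0 _].
    have hu : u \in `]0%R, +oo[ by rewrite in_itv/= andbT (lt_le_trans n0).
    by have /derivable1_diffP/differentiable_continuous :=
      @derivable_powR R 1%R (x - 1)%R u hu.
  - have D u : (0 < u)%R -> derivable (fun u => (u `^ x / x)%R) u 1%R.
      move=> u0; apply: derivableM => //.
      by apply: derivable_powR; rewrite in_itv/= andbT.
    have C u : (0 < u)%R -> {for u, continuous (fun u : R => (u `^ x / x)%R)}.
      by move=> u0; have /derivable1_diffP/differentiable_continuous := D u u0.
    split.
    + by move=> u; rewrite in_itv /= => /andP[u0 _]; apply: D; exact: lt_trans u0.
    + by apply: cvg_at_right_filter; exact: C.
    + by apply: cvg_at_left_filter; exact: C.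
  - move=> u; rewrite in_itv /= => /andP[u0 _].
    have u0' : (0 < u)%R by exact: lt_trans u0.
    have du := @is_derive1_powR R x u u0'.
    rewrite derive1E.
    have -> : (fun u => (u `^ x / x)%R) = (x^-1 \*: (fun u : R => u `^ x))%R.
      by apply/funext => v /=; rewrite mulrC.
    rewrite deriveZ//= derive_val.
    by rewrite /GRing.scale /= mulrA mulVf ?mul1r// gt_eqF.
have lim2 : \int[mu]_(u in F n) g u @[n --> \oo] --> (x^-1)%:E.
  rewrite -(cvg_shiftS _); under eq_fun do rewrite Fint.
  apply: cvg_EFin; first exact: nearW.
  rewrite /= -[X in _ --> X]subr0; apply: cvgB; first exact: cvg_cst.
  rewrite -[X in _ --> X](mul0r (x^-1)%R); apply: cvgMr_tmp.
  have /cvg_at_rightP := powR_cvg0 x0; apply; split => //.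
  rewrite (cvg_shiftS (@harmonic R)); exact: cvg_harmonic.
transitivity (\int[mu]_(u in \bigcup_n F n) g u); last first.
  exact: (cvg_unique _ cg lim2).
rewrite FU /beta_int -integral_itv_bndo_bndc; last by exact: measurable_funTS.
rewrite [RHS]integral_mkcond; apply: eq_integral => u _.
rewrite /beta_dens !patchE; case: ifPn => // _.
by rewrite subrr powRr0 mulr1.
Qed.

(** The Beta-Gamma identity with second parameter 1 plays the part of the integration by parts. *)
Lemma gamma_intS (x : R) : (0 < x)%R -> gamma_int (x + 1) = x%:E * gamma_int x.
Proof.
move=> x0; have := gamma_beta x 1; rewrite gamma_int1 mule1 beta_int1// => ->.
by rewrite muleA -EFinM divff ?mul1e// gt_eqF.
Qed.

Lemma gamma_int_gt0 (x : R) : 0 < gamma_int x.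
Proof.
rewrite lt0e gamma_int_ge0 andbT; apply/eqP => H.
have : \int[mu]_(t in `]1%R, 2%R[) (gamma_dens x t)%:E <= gamma_int x.
  apply: ge0_subset_integral => //.
  - by apply/measurable_EFinP; exact: measurable_gamma_dens.
  - by move=> t _; rewrite lee_fin gamma_dens_ge0.
rewrite H => H1.
(* On ]1, 2[ the power is at least 1 if x >= 1 and at least 2^(x - 1) otherwise. *)
pose m := (Num.min 1 (2 `^ (x - 1)) * expR (- 2))%R.
have m0 : (0 < m)%R by rewrite mulr_gt0 ?expR_gt0// lt_min ltr01 powR_gt0.
have : \int[mu]_(t in `]1%R, 2%R[) m%:E <= \int[mu]_(t in `]1%R, 2%R[) (gamma_dens x t)%:E.
  apply: ge0_le_integral => //.
  - by move=> t _; rewrite lee_fin ltW.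
  - by apply: measurable_funTS; apply/measurable_EFinP; exact: measurable_gamma_dens.
  - move=> t /=; rewrite in_itv /= => /andP[t1 t2].
    rewrite lee_fin gamma_densE ?(lt_trans _ t1)//.
    apply: ler_pM; rewrite ?expR_ge0 ?le_min ?ler01 ?powR_ge0//; last first.
      by rewrite ler_expR lerN2 ltW.
    rewrite ge_min; have [h|h] := leP 0%R (x - 1)%R.
      by rewrite -[X in (X <= _)%R || _](powRr0 t) ler_powR ?(ltW t1).
    apply/orP; right; rewrite -[(x - 1)%R]opprK !(powRN _ (- (x - 1))%R).
    rewrite lef_pV2 ?posrE ?powR_gt0 ?(lt_trans _ t1)//.
    by apply: ge0_ler_powR; rewrite ?nnegrE ?oppr_ge0 ?ltW// (lt_trans _ t1).
move=> /le_trans /(_ H1).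
rewrite integral_cst//= lebesgue_measure_itv /= lte_fin ltr1n /= -EFinB -EFinM lee_fin.
by rewrite leNgt mulr_gt0// subr_gt0 ltr1n.
Qed.

(** Domination settles x >= 1. For x < 1 the integrand is unbounded at 0, and the functional
    equation, valid in [0, +oo], transfers finiteness from x + 1 to x. *)
Lemma gamma_int_lty (x : R) : (0 < x)%R -> gamma_int x < +oo.
Proof.
suff H y : (1 <= y)%R -> gamma_int y < +oo.
  move=> x0; have := H (x + 1)%R; rewrite gamma_intS// => /(_ _)/wrap[].
    by rewrite lerDr ltW.
  rewrite !ltey; apply: contra => /eqP ->; rewrite gt0_muley//.
move=> /gamma_dens_bound[C C0 Cle].
pose G t := (C * expR (- (2^-1 * t)))%:E.
have mG : measurable_fun [set: R] G.
  apply/measurable_EFinP; apply: measurable_funM => //.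
  by apply: measurableT_comp => //; apply: measurableT_comp => //; exact: measurable_funM.
apply: (@le_lt_trans _ _ (\int[mu]_(t in `]0%R, +oo[) G t)).
  rewrite [leRHS]integral_mkcond; apply: ge0_le_integral => //.
  - by move=> t _; rewrite lee_fin gamma_dens_ge0.
  - by apply/measurable_EFinP; exact: measurable_gamma_dens.
  - by apply/measurable_restrict => //; exact: measurable_funTS.
  move=> t _; rewrite [leRHS]patchE /gamma_dens patchE; case: ifPn => // .
  rewrite inE /= in_itv /= andbT => t0; rewrite /G lee_fin.
  exact: Cle.
rewrite /G; under eq_integral do rewrite EFinM.
have mexp : measurable_fun [set: R] (fun t : R => (expR (- (2^-1 * t)))%:E).
  apply/measurable_EFinP.
  by apply: measurableT_comp => //; apply: measurableT_comp => //; exact: measurable_funM.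
rewrite ge0_integralZl_EFin//; try exact: measurable_funTS;
  try by (move=> t _; rewrite lee_fin expR_ge0).
by rewrite integral_expRN// -EFinM ltry.
Qed.

Lemma gamma_int_fin (x : R) : (0 < x)%R -> gamma_int x = (Gamma x)%:E.
Proof. by move=> x0; rewrite GammaE fineK// ge0_fin_numE ?gamma_int_ge0// gamma_int_lty. Qed.

Lemma Gamma_gt0 (x : R) : (0 < x)%R -> (0 < Gamma x)%R.
Proof. by move=> x0; have := gamma_int_gt0 x; rewrite gamma_int_fin. Qed.

Lemma GammaS (x : R) : (0 < x)%R -> Gamma (x + 1) = (x * Gamma x)%R.
Proof.
move=> x0; apply: EFin_inj; rewrite EFinM -!gamma_int_fin//; last by rewrite addr_gt0.
exact: gamma_intS.
Qed.

Lemma Gamma_pochhammer (x : R) n : (0 < x)%R ->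
  Gamma (x + n%:R) = (pochhammer x n * Gamma x)%R.
Proof.
move=> x0; elim: n => [|n IH]; first by rewrite addr0 /pochhammer big_ord0 mul1r.
rewrite -natr1 addrA GammaS; last by rewrite ltr_wpDr.
by rewrite IH /pochhammer big_ord_recr /=; ring.
Qed.

Lemma beta_int_fin (x y : R) : (0 < x)%R -> (0 < y)%R ->
  beta_int x y = (Gamma x * Gamma y / Gamma (x + y))%:E.
Proof.
move=> x0 y0; have xy0 : (0 < x + y)%R by rewrite addr_gt0.
have := gamma_beta x y; rewrite !gamma_int_fin// -EFinM => E.
rewrite EFinM E -muleA -EFinM divff ?mule1// gt_eqF//; exact: Gamma_gt0.
Qed.

End gamma_beta.

(** * Kummer's series *)

Section entire_series.
Variable R : realType.
Implicit Types (c : R^nat) (x : R).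

(** Domination by the exponential series: convergence on the whole line, with the explicit bound
    e^|x|. *)
Definition fact_dominated c := forall n, `|c n| <= (n`!%:R)^-1.

Lemma is_cvg_fact_dominated_norm c x : fact_dominated c ->
  cvgn [normed pseries c x].
Proof.
move=> cle; apply: (series_le_cvg _ _ _ (is_cvg_series_exp_coeff `|x|)).
- by move=> n /=.
- by move=> n; exact: exp_coeff_ge0.
- move=> n /=; rewrite /exp_coeff /= normrM normrX mulrC.
  by rewrite ler_wpM2l ?exprn_ge0.
Qed.

Lemma is_cvg_fact_dominated c x : fact_dominated c -> cvgn (pseries c x).
Proof. by move=> cle; exact/normed_cvg/is_cvg_fact_dominated_norm. Qed.

Lemma pseries_fact_dominated_le c x : fact_dominated c ->
  `|limn (pseries c x)| <= expR `|x|.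
Proof.
move=> cle; have cn := @is_cvg_fact_dominated_norm c x cle.
apply: (le_trans (lim_series_norm cn)); rewrite /expR /=.
apply: lim_series_le => //; first exact: is_cvg_series_exp_coeff.
move=> n /=; rewrite /exp_coeff /= normrM normrX mulrC.
by rewrite ler_wpM2l ?exprn_ge0.
Qed.

Lemma is_derive_pseries_fact_dominated c x :
  fact_dominated c -> fact_dominated (pseries_diffs c) ->
  fact_dominated (pseries_diffs (pseries_diffs c)) ->
  is_derive x (1 : R) (fun x => limn (pseries c x))
    (limn (pseries (pseries_diffs c) x)).
Proof.
move=> c0 c1 c2; apply: (@pseries_snd_diffs _ _ (`|x| + 1)).
- exact: is_cvg_fact_dominated.
- exact: is_cvg_fact_dominated.
- exact: is_cvg_fact_dominated.
- by rewrite [ltRHS]ger0_norm ?addr_ge0// ltrDl.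
Qed.

End entire_series.

Section kummer_series.
Variables (R : realType) (a b : R).
Hypotheses (a_gt0 : 0 < a) (ab : a <= b).

(** Taylor coefficients of the [j]-th derivative of M(a, b, .). Keeping [j] as a shift of the
    Pochhammer index avoids the prefactor (a)_j / (b)_j of M(a + j, b + j, .). *)
Definition kummer_coef (j n : nat) : R :=
  pochhammer a (j + n) / (pochhammer b (j + n) * (n`!)%:R).

Definition kummer_diff (j : nat) (x : R) : R := limn (pseries (kummer_coef j) x).

Lemma pochhammer_gt0 (u : R) n : 0 < u -> 0 < pochhammer u n.
Proof. by move=> u0; apply: prodr_gt0 => i _; rewrite ltr_wpDr. Qed.

Lemma pochhammerS (u : R) n : pochhammer u n.+1 = pochhammer u n * (u + n%:R).
Proof. by rewrite /pochhammer big_ord_recr. Qed.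

Let b_gt0 : 0 < b. Proof. exact: lt_le_trans ab. Qed.

Lemma kummer_coef_ge0 j n : 0 <= kummer_coef j n.
Proof.
by rewrite divr_ge0// ?mulr_ge0// ltW// pochhammer_gt0.
Qed.

(** As 0 < a <= b, each factor of (a)_n is at most the corresponding factor of (b)_n. *)
Lemma kummer_coef_dominated j : fact_dominated (kummer_coef j).
Proof.
move=> n; rewrite ger0_norm ?kummer_coef_ge0// /kummer_coef invfM mulrA.
rewrite ler_piMl ?invr_ge0// ler_pdivrMr ?pochhammer_gt0// mul1r.
by apply: ler_prod => i _; rewrite lerD2r ab andbT addr_ge0// ltW.
Qed.

Lemma kummer_coef_diffs j : pseries_diffs (kummer_coef j) = kummer_coef j.+1.
Proof.
apply/funext => n; rewrite /pseries_diffs /kummer_coef addSnnS factS natrM.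
have := gt_eqF (pochhammer_gt0 (j + n.+1) b_gt0).
have : n.+1%:R != 0 :> R by rewrite pnatr_eq0.
have : n`!%:R != 0 :> R by rewrite pnatr_eq0 -lt0n fact_gt0.
by move=> h1 h2 /negbT h3; field; rewrite h1 h3 /= addrC natr1.
Qed.

Lemma kummerME x : kummerM a b x = kummer_diff 0 x.
Proof.
rewrite /kummerM /kummer_diff; congr (limn (series _)); apply/funext => n.
by rewrite /kummer_coef /= mulrAC.
Qed.

Lemma is_derive_kummer_diff j x :
  is_derive x (1 : R) (kummer_diff j) (kummer_diff j.+1 x).
Proof.
rewrite /kummer_diff -kummer_coef_diffs.
apply: is_derive_pseries_fact_dominated; rewrite ?kummer_coef_diffs;
  exact: kummer_coef_dominated.
Qed.

Lemma kummer_diff_le j x : `|kummer_diff j x| <= expR `|x|.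
Proof. exact/pseries_fact_dominated_le/kummer_coef_dominated. Qed.

(** The coefficient of x^i is (b + i) c_1(i) - (a + i) c_0(i), where c_j is [kummer_coef j]; it
    vanishes because c_1(i) = c_0(i) (a + i) / (b + i). *)
Lemma kummer_ode x :
  x * kummer_diff 2 x + (b - x) * kummer_diff 1 x - a * kummer_diff 0 x = 0.
Proof.
have cv j : pseries (kummer_coef j) x @ \oo --> kummer_diff j x.
  exact/is_cvg_fact_dominated/kummer_coef_dominated.
(* The derivative series keep the form i c(i) x^(i - 1) without reindexing: after multiplication by
   x all four partial sums of length n involve the same powers, and their combination is exactly
   0. *)
have cw j : series (fun i => i%:R * kummer_coef j i * x ^+ i.-1) @ \oo -->
    kummer_diff j.+1 x.
  rewrite /kummer_diff -kummer_coef_diffs; apply: pseries_diffs_equiv.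
  by rewrite kummer_coef_diffs; exact/is_cvg_fact_dominated/kummer_coef_dominated.
pose S := fun n => x * series (fun i => i%:R * kummer_coef 1 i * x ^+ i.-1) n
  + b * pseries (kummer_coef 1) x n
  - x * series (fun i => i%:R * kummer_coef 0 i * x ^+ i.-1) n
  - a * pseries (kummer_coef 0) x n.
have S0 : S = cst 0.
  apply/funext => n; rewrite /S /pseries /series /= !mulr_sumr -!sumrN.
  rewrite -!big_split /= big1// => i _.
  rewrite /kummer_coef /= add0n add1n !pochhammerS.
  have hb : pochhammer b i != 0 by rewrite gt_eqF// pochhammer_gt0.
  have hf : i`!%:R != 0 :> R by rewrite pnatr_eq0 -lt0n fact_gt0.
  have hbi : b + i%:R != 0 by rewrite gt_eqF// ltr_wpDr.
  have xi c : x * (i%:R * c * x ^+ i.-1) = i%:R * c * x ^+ i.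
    by case: (i) => [|m]; rewrite ?mul0r ?mulr0// exprS mulrCA.
  rewrite !xi; field; rewrite hb hbi hf //.
have : S @ \oo --> x * kummer_diff 2 x + b * kummer_diff 1 x
    - x * kummer_diff 1 x - a * kummer_diff 0 x.
  by apply: cvgB; [apply: cvgB; [apply: cvgD|]|]; apply: cvgMl_tmp.
rewrite S0 => /(cvg_lim (@Rhausdorff R)); rewrite lim_cst// => E.
by rewrite [RHS]E; ring.
Qed.

End kummer_series.

(** * The explicit solution *)

Section pointwise_derive.
Variables (R : realType) (x : R) (f g : R -> R) (df dg : R).
Hypotheses (fD : is_derive x (1 : R) f df) (gD : is_derive x (1 : R) g dg).

Lemma is_derive1D : is_derive x (1 : R) (fun t => f t + g t) (df + dg).
Proof. exact: is_deriveD. Qed.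

Lemma is_derive1B : is_derive x (1 : R) (fun t => f t - g t) (df - dg).
Proof. exact: is_deriveB. Qed.

Lemma is_derive1M : is_derive x (1 : R) (fun t => f t * g t) (f x * dg + g x * df).
Proof. exact: is_deriveM. Qed.

Lemma is_derive1Z c : is_derive x (1 : R) (fun t => c * f t) (c * df).
Proof. exact: (is_deriveZ c fD). Qed.

Lemma is_derive1_idE : is_derive x (1 : R) (fun t : R => t) 1.
Proof. exact: is_derive_id. Qed.

Lemma is_derive1_cstE (c : R) : is_derive x (1 : R) (fun _ : R => c) 0.
Proof. exact: is_derive_cst. Qed.

End pointwise_derive.

(** * Taylor estimates by the mean value theorem *)

Section taylor.
Variable R : realType.

(** One integration by the mean value theorem. The gain 1 / (n + 1) is given up, so that [K] stays
    the same when the lemma is iterated. *)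
Lemma mvt_bound (f df : R -> R) (K c : R) n : 0 <= K -> 0 < c ->
  (forall r, `|r| <= c -> is_derive r (1 : R) f (df r)) ->
  (forall r, `|r| <= c -> `|df r| <= K * `|r| ^+ n) ->
  forall r, `|r| <= c -> `|f r - f 0| <= K * `|r| ^+ n.+1.
Proof.
move=> K0 c0 fD dfK r rc.
have aux a b : - c <= a -> b <= c -> a < b -> (forall x, x \in `]a, b[ -> `|x| <= `|r|) ->
    `|f b - f a| <= K * `|r| ^+ n * (b - a).
  move=> ca bc ab xr.
  have inb x : x \in `[a, b] -> `|x| <= c by rewrite in_itv /= ler_norml => /andP[? ?]; lra.
  have [x xab ->] := @MVT R f df a b ab
    (fun x (xab : x \in `]a, b[) => fD x (inb x (subset_itv_oo_cc xab)))
    (@derivable_within_continuous _ _ _ _ (fun x xab => @ex_derive _ _ _ _ _ _ _ (fD x (inb x xab)))).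
  rewrite normrM [`|b - a|]gtr0_norm ?subr_gt0// ler_wpM2r ?subr_ge0 ?(ltW ab)//.
  apply: le_trans (dfK x _) _; first exact/inb/subset_itv_oo_cc.
  by rewrite ler_wpM2l// lerXn2r ?nnegrE//; exact: xr.
move: rc; rewrite ler_norml => /andP[r1 r2].
have [r0|r0|r0] := ltgtP 0 r.
- apply: le_trans (aux 0 r _ r2 r0 _) _; first by rewrite oppr_le0 ltW.
    by move=> x; rewrite in_itv /= => /andP[x0 xr]; rewrite !gtr0_norm// ltW.
  by rewrite subr0 exprSr mulrA [in X in _ <= _ * X]gtr0_norm.
- rewrite distrC; apply: le_trans (aux r 0 r1 _ r0 _) _; first exact: ltW.
    by move=> x; rewrite in_itv /= => /andP[xr x0]; rewrite !ltr0_norm// lerN2 ltW.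
  by rewrite sub0r exprSr mulrA [in X in _ <= _ * X]ltr0_norm.
- by rewrite -r0 subrr !normr0 mulr_ge0// exprn_ge0.
Qed.

Lemma taylor2_bound (f f1 f2 f3 : R -> R) (K c : R) : 0 <= K -> 0 < c ->
  (forall r, `|r| <= c -> is_derive r (1 : R) f (f1 r)) ->
  (forall r, `|r| <= c -> is_derive r (1 : R) f1 (f2 r)) ->
  (forall r, `|r| <= c -> is_derive r (1 : R) f2 (f3 r)) ->
  (forall r, `|r| <= c -> `|f3 r| <= K) ->
  forall r, `|r| <= c -> `|f r - f 0 - f1 0 * r - f2 0 / 2 * r ^+ 2| <= K * `|r| ^+ 3.
Proof.
move=> K0 c0 d0 d1 d2 b3.
have s2 r : `|r| <= c -> `|f2 r - f2 0| <= K * `|r| ^+ 1.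
  by apply: (@mvt_bound f2 f3 K c 0) => // s sc; rewrite expr0 mulr1; exact: b3.
have s1 r : `|r| <= c -> `|f1 r - f1 0 - f2 0 * r| <= K * `|r| ^+ 2.
  move=> rc.
  have := @mvt_bound (fun r => f1 r - f2 0 * r) (fun r => f2 r - f2 0) K c 1 K0 c0 _ s2 r rc.
  rewrite mulr0 subr0 => /(_ _)/wrap[].
    move=> s sc; have := d1 s sc => ds.
    by have := is_derive1B ds (is_derive1Z (is_derive1_idE s) (f2 0)); rewrite mulr1.
  by congr (`| _ | <= _); ring.
move=> r rc.
have := @mvt_bound (fun r => f r - f1 0 * r - f2 0 / 2 * r ^+ 2)
  (fun r => f1 r - f1 0 - f2 0 * r) K c 2 K0 c0 _ s1 r rc.
rewrite mulr0 expr0n /= mulr0 !subr0 => /(_ _)/wrap[].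
  move=> s sc; have := d0 s sc => ds.
  have e : f1 s - f1 0 - f2 0 * s = f1 s - f1 0 * 1 - f2 0 / 2 * (s * 1 + s * 1) by field.
  rewrite e; have ids := is_derive1_idE s.
  exact: (is_derive1B (is_derive1B ds (is_derive1Z ids (f1 0)))
    (is_derive1Z (is_derive1M ids ids) (f2 0 / 2))).
by congr (`| _ | <= _); ring.
Qed.

End taylor.

(** * The Kummer solution and its scaled derivatives *)

Section kummer_solution.
Variables (R : realType) (mu sigma lambda : R).
Hypotheses (sigma_gt0 : 0 < sigma) (lambda_gt0 : 0 < lambda).

(** Exponent of decay at infinity: y^(-k) solves the equation stripped of its term - P' exactly when
    sigma^2 k^2 / 2 - mu k - lambda = 0, and [kexp] is the positive root. *)
Definition kexp : R := (mu + Num.sqrt (mu ^+ 2 + 2 * lambda * sigma ^+ 2)) / sigma ^+ 2.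
Definition cpar : R := 1 - 2 * mu / sigma ^+ 2.
Local Notation k := kexp.
Local Notation c := cpar.
Local Notation B := (cpar + 2 * kexp).

Let s2_gt0 : 0 < sigma ^+ 2. Proof. exact: exprn_gt0. Qed.

Let sigma_neq0 : sigma != 0. Proof. exact: lt0r_neq0. Qed.

Let root : R := Num.sqrt (mu ^+ 2 + 2 * lambda * sigma ^+ 2).

Let rootE : root ^+ 2 = mu ^+ 2 + 2 * lambda * sigma ^+ 2.
Proof. by rewrite sqr_sqrtr// addr_ge0 ?sqr_ge0// mulr_ge0 ?sqr_ge0// mulr_ge0// ltW. Qed.

Let root_gt : `|mu| < root.
Proof.
rewrite -sqrtr_sqr ltr_sqrt ?ltrDl ?mulr_gt0//.
by rewrite ltr_wpDl ?sqr_ge0// !mulr_gt0.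
Qed.

Lemma kexp_gt0 : 0 < k.
Proof. by rewrite divr_gt0//; have := ler_norm (- mu); rewrite normrN -/root; have := root_gt; lra. Qed.

(** c + k - 1 = (sqrt(mu^2 + 2 lambda sigma^2) - mu) / sigma^2. Its positivity makes it an
    admissible Beta parameter and yields k <= c + 2 k, on which the series bounds rest. *)
Lemma cpar_kexp_gt1 : 1 < c + k.
Proof.
have -> : c + k = 1 + (root - mu) / sigma ^+ 2 by rewrite /cpar /kexp -/root; field; exact: lt0r_neq0.
by rewrite ltrDl divr_gt0//; have := ler_norm mu; have := root_gt; lra.
Qed.

Lemma kexp_root : sigma ^+ 2 / 2 * k ^+ 2 - mu * k - lambda = 0.
Proof.
have -> : sigma ^+ 2 / 2 * k ^+ 2 - mu * k - lambda =
   (root ^+ 2 - mu ^+ 2 - 2 * lambda * sigma ^+ 2) / (2 * sigma ^+ 2).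
  by rewrite /kexp -/root; field; exact: lt0r_neq0.
by rewrite rootE (_ : _ - _ - _ = 0) ?mul0r//; ring.
Qed.

Lemma kexp_leB : k <= B.
Proof. by have := cpar_kexp_gt1; have := kexp_gt0; lra. Qed.

Definition zarg (y : R) : R := 2 / (y * sigma ^+ 2).

Lemma zarg_gt0 (y : R) : 0 < y -> 0 < zarg y.
Proof. by move=> y0; rewrite divr_gt0// mulr_gt0. Qed.

(** z^(k + j) times the [j]-th derivative of M at - z. Since y dz/dy = - z, these functions span a
    space stable under y d/dy, which contains all scaled derivatives of the solution. *)
Definition kterm (j : nat) (y : R) : R :=
  zarg y `^ (k + j%:R) * kummer_diff k B j (- zarg y).

Lemma is_derive1V (x : R) : x != 0 -> is_derive x (1 : R) (fun t : R => t^-1) (- x ^- 2).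
Proof.
move=> x0; apply: DeriveDef; first exact: derivableV.
by rewrite deriveV//= derive_id /GRing.scale /= mulr1.
Qed.

Lemma is_derive_zarg (y : R) : 0 < y -> is_derive y (1 : R) zarg (- (zarg y / y)).
Proof.
move=> y0; have yn0 := lt0r_neq0 y0; have sn0 := sigma_neq0.
have -> : zarg = (fun t => 2 / sigma ^+ 2 * t^-1).
  by apply/funext => t; rewrite /zarg invfM; ring.
have -> : - (2 / sigma ^+ 2 * y^-1 / y) = 2 / sigma ^+ 2 * (- y ^- 2) by field; rewrite yn0 sn0.
exact: is_derive1Z (is_derive1V yn0) _.
Qed.

Lemma is_derive_kterm j (y : R) : 0 < y ->
  is_derive y (1 : R) (kterm j) ((kterm j.+1 y - (k + j%:R) * kterm j y) / y).
Proof.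
move=> y0; have yn0 := lt0r_neq0 y0; have z0 := zarg_gt0 y0.
have dz := is_derive_zarg y0.
have d1 : is_derive y (1 : R) ((fun z => z `^ (k + j%:R)) \o zarg)
    ((k + j%:R) * zarg y `^ (k + j%:R - 1) * - (zarg y / y)).
  by apply: is_derive1_comp; exact: is_derive1_powR.
have dnz : is_derive y (1 : R) (fun t => - zarg t) (zarg y / y).
  by have := is_deriveN dz; rewrite opprK.
have d2 : is_derive y (1 : R) (kummer_diff k B j \o (fun t => - zarg t))
    (kummer_diff k B j.+1 (- zarg y) * (zarg y / y)).
  apply: is_derive1_comp => //; apply: is_derive_kummer_diff; [exact: kexp_gt0|exact: kexp_leB].
have := is_derive1M d1 d2; congr is_derive.
rewrite /kterm /=.
have e1 : zarg y `^ (k + j%:R) = zarg y `^ (k + j%:R - 1) * zarg y.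
  rewrite -[X in _ * X](powRr1 (ltW z0)) -powRD ?subrK//.
  by rewrite (gt_eqF z0) implybT.
have e2 : zarg y `^ (k + j.+1%:R) = zarg y `^ (k + j%:R) * zarg y.
  rewrite -[X in _ * X](powRr1 (ltW z0)) -powRD ?(gt_eqF z0) ?implybT//.
  by rewrite -natr1 addrA.
by rewrite e2 e1; field.
Qed.

Lemma kterm_bound j (y1 : R) : 0 < y1 -> exists2 K, 0 <= K & forall y, y1 <= y -> `|kterm j y| <= K.
Proof.
move=> y10; have z1 := zarg_gt0 y10.
exists (zarg y1 `^ (k + j%:R) * expR (zarg y1)) => [|y yy1].
  by rewrite mulr_ge0 ?powR_ge0 ?expR_ge0.
have y0 : 0 < y by exact: lt_le_trans yy1.
have z0 := zarg_gt0 y0.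
have zz : zarg y <= zarg y1.
  by rewrite ler_pM2l// lef_pV2 ?posrE ?mulr_gt0// ler_pM2r.
rewrite normrM ger0_norm ?powR_ge0//; apply: ler_pM; rewrite ?powR_ge0//.
  apply: ge0_ler_powR; rewrite ?nnegrE ?(ltW z0) ?(ltW z1)//.
  by rewrite addr_ge0// ltW// kexp_gt0.
apply: le_trans (kummer_diff_le kexp_gt0 kexp_leB _ _) _.
by rewrite normrN (gtr0_norm z0) ler_expR.
Qed.

(** Kummer's equation at - z, multiplied by z^(k + 1). *)
Lemma kterm_ode (y : R) : 0 < y ->
  kterm 2 y = (B + zarg y) * kterm 1 y - k * zarg y * kterm 0 y.
Proof.
move=> y0; have z0 := zarg_gt0 y0.
have pw j : zarg y `^ (k + j%:R) = zarg y `^ k * zarg y ^+ j.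
  by rewrite powRD ?(gt_eqF z0) ?implybT// powR_mulrn// ltW.
have := kummer_ode kexp_gt0 kexp_leB (- zarg y); rewrite /kterm !pw.
set m0 := kummer_diff _ _ 0 _; set m1 := kummer_diff _ _ 1 _; set m2 := kummer_diff _ _ 2 _.
move=> E.
have -> : zarg y `^ k * zarg y ^+ 2 * m2 = zarg y `^ k * zarg y * (zarg y * m2) by ring.
have -> : zarg y * m2 = (B + zarg y) * m1 - k * m0 by move: E; lra.
by ring.
Qed.

(** The normalization for which the solution tends to 1 at 0+. *)
Definition sol_const : R := Gamma (c + k) / Gamma B.

Definition kummer_sol (y : R) : R := sol_const * kterm 0 y.
(** With f the solution, [sol_p], [sol_q], [sol_t] are y f', y^2 f'', y^3 f''': the coefficients
    suited to an expansion in relative increments, bounded on every [y0, +oo[ with y0 > 0. *)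
Definition sol_p (y : R) : R := sol_const * (kterm 1 y - k * kterm 0 y).
Definition sol_q (y : R) : R := sol_const *
  (kterm 2 y - (2 * k + 2) * kterm 1 y + (k ^+ 2 + k) * kterm 0 y).
Definition sol_t (y : R) : R := sol_const *
  (kterm 3 y - (3 * k + 6) * kterm 2 y + (3 * k ^+ 2 + 9 * k + 6) * kterm 1 y
   - (k ^+ 3 + 3 * k ^+ 2 + 2 * k) * kterm 0 y).

Lemma is_derive_sol (y : R) : 0 < y -> is_derive y (1 : R) kummer_sol (sol_p y / y).
Proof.
move=> y0; have := is_derive1Z (is_derive_kterm 0 y0) sol_const; congr is_derive.
by rewrite /sol_p; field; exact: lt0r_neq0.
Qed.

Lemma is_derive_sol_p (y : R) : 0 < y ->
  is_derive y (1 : R) (fun t => sol_p t / t) (sol_q y / y ^+ 2).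
Proof.
move=> y0; have yn0 := lt0r_neq0 y0.
have d0 := is_derive_kterm 0 y0; have d1 := is_derive_kterm 1 y0.
have := is_derive1M (is_derive1Z (is_derive1B d1 (is_derive1Z d0 k)) sol_const) (is_derive1V yn0).
by congr is_derive; rewrite /sol_q; field.
Qed.

Lemma is_derive_sol_q (y : R) : 0 < y ->
  is_derive y (1 : R) (fun t => sol_q t / t ^+ 2) (sol_t y / y ^+ 3).
Proof.
move=> y0; have yn0 := lt0r_neq0 y0.
have d0 := is_derive_kterm 0 y0; have d1 := is_derive_kterm 1 y0.
have d2 := is_derive_kterm 2 y0.
have := is_derive1M (is_derive1M (is_derive1Z (is_derive1D (is_derive1B d2 (is_derive1Z d1 (2 * k + 2)))
   (is_derive1Z d0 (k ^+ 2 + k))) sol_const) (is_derive1V yn0)) (is_derive1V yn0).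
have -> : (fun t => sol_const * (kterm 2 t - (2 * k + 2) * kterm 1 t + (k ^+ 2 + k) * kterm 0 t) / t / t)
    = (fun t => sol_q t / t ^+ 2).
  by apply/funext => t; rewrite /sol_q -mulrA -invfM.
by congr is_derive; rewrite /sol_t; field.
Qed.

(** Once [kterm 2] and 1 / y = sigma^2 z / 2 are eliminated, the coefficients cancel by the
    quadratic equation of [kexp]. *)
Lemma sol_ode (y : R) : 0 < y ->
  sigma ^+ 2 / 2 * sol_q y + (mu + sigma ^+ 2 / 2 - y^-1) * sol_p y - lambda * kummer_sol y = 0.
Proof.
move=> y0; rewrite /sol_q /sol_p /kummer_sol kterm_ode//.
have -> : y^-1 = sigma ^+ 2 / 2 * zarg y.
  by rewrite /zarg; field; rewrite !lt0r_neq0.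
have -> : lambda = sigma ^+ 2 / 2 * k ^+ 2 - mu * k by have := kexp_root; lra.
have -> : c = 1 - 2 * mu / sigma ^+ 2 by [].
by field; exact: lt0r_neq0.
Qed.

(** The increment is relative because this makes the constants uniform in y >= y0: the derivatives
    in r of f(y (1 + r)) are the scaled derivatives at y (1 + r), up to powers of 1 + r. *)
Lemma sol_taylor (y0 : R) : 0 < y0 -> exists2 K, 0 <= K &
  (forall y, y0 <= y -> `|sol_p y| <= K /\ `|sol_q y| <= K) /\
  (forall y r, y0 <= y -> `|r| <= 2^-1 ->
    `|kummer_sol (y * (1 + r)) - kummer_sol y - sol_p y * r - sol_q y / 2 * r ^+ 2| <= K * `|r| ^+ 3).
Proof.
move=> y00; have y1 : 0 < y0 / 2 by rewrite divr_gt0.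
have [K0 K00 b0] := kterm_bound 0 y1; have [K1 K10 b1] := kterm_bound 1 y1.
have [K2 K20 b2] := kterm_bound 2 y1; have [K3 K30 b3] := kterm_bound 3 y1.
have k0 := kexp_gt0.
have le4 (C a0 a1 a2 a3 u0 u1 u2 u3 : R) : `|u0| <= K0 -> `|u1| <= K1 -> `|u2| <= K2 -> `|u3| <= K3 ->
   `|C * (a3 * u3 + a2 * u2 + a1 * u1 + a0 * u0)| <=
   `|C| * (`|a3| * K3 + `|a2| * K2 + `|a1| * K1 + `|a0| * K0).
  move=> h0 h1 h2 h3; rewrite normrM ler_wpM2l//.
  apply: le_trans (ler_normD _ _) _; apply: lerD; last by rewrite normrM ler_wpM2l.
  apply: le_trans (ler_normD _ _) _; apply: lerD; last by rewrite normrM ler_wpM2l.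
  apply: le_trans (ler_normD _ _) _; apply: lerD; by rewrite normrM ler_wpM2l.
have bnd (a0 a1 a2 a3 : R) : exists2 L, 0 <= L & forall y, y0 / 2 <= y ->
   `|sol_const * (a3 * kterm 3 y + a2 * kterm 2 y + a1 * kterm 1 y + a0 * kterm 0 y)| <= L.
  exists (`|sol_const| * (`|a3| * K3 + `|a2| * K2 + `|a1| * K1 + `|a0| * K0)).
    by rewrite mulr_ge0// !addr_ge0// mulr_ge0.
  by move=> y yy; apply: le4; [exact: b0|exact: b1|exact: b2|exact: b3].
have [Lp Lp0 pL] := bnd (- k) 1 0 0.
have [Lq Lq0 qL] := bnd (k ^+ 2 + k) (- (2 * k + 2)) 1 0.
have [Lt Lt0 tL] := bnd (- (k ^+ 3 + 3 * k ^+ 2 + 2 * k)) (3 * k ^+ 2 + 9 * k + 6) (- (3 * k + 6)) 1.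
have half y : y0 <= y -> y0 / 2 <= y by move=> yy; lra.
(* 8 = 2^3 bounds (1 + s)^(-3) for |s| <= 1/2, a range in which y (1 + s) >= y0 / 2. *)
exists (Lp + Lq + 8 * Lt); first by rewrite !addr_ge0// mulr_ge0.
split=> [y yy|y r yy r2].
  have := pL _ (half _ yy); have := qL _ (half _ yy).
  have -> : sol_const * (0 * kterm 3 y + 0 * kterm 2 y + 1 * kterm 1 y + - k * kterm 0 y) = sol_p y.
    by rewrite /sol_p; ring.
  have -> : sol_const * (0 * kterm 3 y + 1 * kterm 2 y + - (2 * k + 2) * kterm 1 y
     + (k ^+ 2 + k) * kterm 0 y) = sol_q y by rewrite /sol_q; ring.
  by move=> h1 h2; split; lra.
have y_gt0 : 0 < y by exact: lt_le_trans yy.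
have yn0 := lt0r_neq0 y_gt0.
pose Y (r : R) := y * (1 + r).
have r12 (s : R) : `|s| <= 2^-1 -> 2^-1 <= 1 + s by rewrite ler_norml => /andP[? ?]; lra.
have Y0 (s : R) : `|s| <= 2^-1 -> 0 < Y s.
  by move=> /r12 s1; rewrite mulr_gt0// (lt_le_trans _ s1)// invr_gt0.
have dY s : is_derive s (1 : R) Y y.
  have := is_derive1Z (is_derive1D (is_derive1_cstE s (1 : R)) (is_derive1_idE s)) y.
  by rewrite add0r mulr1.
have := @taylor2_bound R (fun s => kummer_sol (Y s)) (fun s => sol_p (Y s) / Y s * y)
  (fun s => sol_q (Y s) / Y s ^+ 2 * y ^+ 2) (fun s => sol_t (Y s) / Y s ^+ 3 * y ^+ 3)
  (8 * Lt) 2^-1.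
have Y00 : Y 0 = y by rewrite /Y addr0 mulr1.
rewrite Y00 => /(_ _ _ _ _ _ _ r r2)/wrap[].
- by rewrite mulr_ge0.
- by rewrite invr_gt0.
- move=> s s2; exact: (is_derive1_comp (is_derive_sol (Y0 s s2)) (dY s)).
- move=> s s2; have := is_derive1M (is_derive1_comp (is_derive_sol_p (Y0 s s2)) (dY s)) (is_derive1_cstE s y).
  by congr is_derive; rewrite mulr0 add0r; ring.
- move=> s s2; have := is_derive1M (is_derive1_comp (is_derive_sol_q (Y0 s s2)) (dY s)) (is_derive1_cstE s (y ^+ 2)).
  by congr is_derive; rewrite mulr0 add0r; ring.
- move=> s s2; have Ys := Y0 _ s2; have := r12 _ s2 => s3.
  have -> : sol_t (Y s) / Y s ^+ 3 * y ^+ 3 = sol_t (Y s) * ((1 + s)^-1) ^+ 3.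
    rewrite /Y; field; rewrite yn0 /= lt0r_neq0//; lra.
  rewrite normrM mulrC; apply: ler_pM => //.
    rewrite ger0_norm ?exprn_ge0 ?invr_ge0//; last by lra.
    have -> : (8 : R) = 2 ^+ 3 by ring.
    rewrite lerXn2r ?nnegrE ?invr_ge0//; first by lra.
    by rewrite -[leRHS]invrK lef_pV2 ?posrE//; lra.
  have yY : y0 / 2 <= Y s by rewrite /Y; nra.
  have := tL _ yY; congr (`|_| <= _); rewrite /sol_t; ring.
move=> H; apply: le_trans (_ : 8 * Lt * `|r| ^+ 3 <= _); last first.
  by rewrite ler_wpM2r ?exprn_ge0//; lra.
move: H; congr (`|_| <= _).
by rewrite divfK// divfK// expf_neq0.
Qed.

End kummer_solution.

(** * Laplace transform of the Beta law *)

Section beta_moments.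
Variable R : realType.
Local Notation mu := (@lebesgue_measure R).
Variables (x y : R).
Hypotheses (x_gt0 : 0 < x) (y_gt0 : 0 < y).

Lemma integrable_beta_dens : mu.-integrable setT (EFin \o beta_dens x y).
Proof.
apply/integrableP; split.
  by apply/measurable_EFinP; exact: measurable_beta_dens.
under eq_integral do rewrite /= ger0_norm ?beta_dens_ge0//.
by rewrite -/(beta_int x y) beta_int_fin// ltry.
Qed.

Lemma beta_densX (u : R) n : beta_dens x y u * u ^+ n = beta_dens (x + n%:R) y u.
Proof.
have [u01|u01] := boolP (0 < u < 1); last by rewrite !beta_dens0// mul0r.
have /andP[u0 _] := u01; rewrite !beta_densE// mulrAC; congr (_ * _).
by rewrite -powR_mulrn ?ltW// -powRD ?(gt_eqF u0) ?implybT//; congr powR; ring.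
Qed.

End beta_moments.

Section beta_expansion.
Variable R : realType.
Local Notation mu := (@lebesgue_measure R).
Variables (x y z : R).
Hypotheses (x_gt0 : 0 < x) (y_gt0 : 0 < y) (z_ge0 : 0 <= z).

Let xy_gt0 : 0 < x + y. Proof. exact: addr_gt0. Qed.

Let f_ (n : nat) (u : R) : \bar R :=
  (\sum_(i < n) (beta_dens x y u * exp_coeff (- (z * u)) i))%:E.

Let f_E n u : f_ n u = (beta_dens x y u * series (exp_coeff (- (z * u))) n)%:E.
Proof. by rewrite /f_ /series /= big_mkord mulr_sumr. Qed.

Let termE i u : beta_dens x y u * exp_coeff (- (z * u)) i =
  (- z) ^+ i / i`!%:R * beta_dens (x + i%:R) y u.
Proof. by rewrite /exp_coeff /= -beta_densX -mulNr exprMn; ring. Qed.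

Let K : R := Gamma x * Gamma y / Gamma (x + y).

Let int_term i : (\int[mu]_u (beta_dens x y u * exp_coeff (- (z * u)) i)%:E)%E =
  (K * (kummer_coef x (x + y) 0 i * (- z) ^+ i))%:E.
Proof.
under eq_integral do rewrite termE EFinM.
have xi : 0 < x + i%:R by rewrite ltr_wpDr.
rewrite integralZl//; last exact: integrable_beta_dens.
rewrite -/(beta_int (x + i%:R) y) beta_int_fin// -EFinM; congr EFin.
have -> : x + i%:R + y = x + y + i%:R by ring.
rewrite !Gamma_pochhammer// /kummer_coef add0n /K.
have /lt0r_neq0 f0 : 0 < i`!%:R :> R by rewrite ltr0n fact_gt0.
have := lt0r_neq0 (pochhammer_gt0 i xy_gt0); have := lt0r_neq0 (Gamma_gt0 xy_gt0).
move: (Gamma x) (Gamma y) (Gamma (x + y)) (pochhammer x i) (pochhammer (x + y) i).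
by move=> gx gy gxy px pxy gxy0 pxy0; field; rewrite f0 gxy0 pxy0.
Qed.

Let integrable_term i : mu.-integrable setT
  (fun u => (beta_dens x y u * exp_coeff (- (z * u)) i)%:E).
Proof.
under eq_fun do rewrite termE EFinM.
apply: integrableZl => //; apply: integrable_beta_dens => //.
by rewrite ltr_wpDr.
Qed.

(** The i-th moment of Beta(x, y) is (x)_i / (x + y)_i, so expanding the exponential and integrating
    term by term produces the series of M(x, x + y, - z). *)
Lemma integral_beta_expR : (\int[mu]_u (beta_dens x y u * expR (- (z * u)))%:E)%E =
  (K * kummer_diff x (x + y) 0 (- z))%:E.
Proof.
(* On ]0, 1[ every partial sum of the series of e^(- z u) is at most e^z in absolute value. *)
pose g (u : R) : \bar R := (expR z * beta_dens x y u)%:E.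
have ig : mu.-integrable setT g.
  rewrite /g; under eq_fun do rewrite EFinM.
  by apply: integrableZl => //; exact: integrable_beta_dens.
have mf n : measurable_fun setT (f_ n).
  rewrite /f_; apply/measurable_EFinP; apply: measurable_sum => i.
  by have /integrableP[/measurable_EFinP] := integrable_term i.
have mlim : measurable_fun setT (fun u => (beta_dens x y u * expR (- (z * u)))%:E).
  apply/measurable_EFinP; apply: measurable_funM; first exact: measurable_beta_dens.
  by apply: measurableT_comp => //; apply: measurableT_comp => //; exact: measurable_funM.
have cf u : f_ n u @[n --> \oo] --> (beta_dens x y u * expR (- (z * u)))%:E.
  under eq_fun do rewrite f_E.
  apply: cvg_EFin; first exact: nearW.
  by apply: cvgMl_tmp; exact: is_cvg_series_exp_coeff.
have bf u n : (`|f_ n u| <= g u)%E.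
  rewrite f_E /g lee_fin.
  have [u01|u01] := boolP (0 < u < 1); last by rewrite !beta_dens0// mul0r mulr0 normr0.
  rewrite normrM ger0_norm ?beta_dens_ge0// mulrC ler_wpM2r ?beta_dens_ge0//.
  have /andP[u0 u1] := u01.
  apply: (@le_trans _ _ (series (exp_coeff z) n)); last first.
    rewrite /expR; apply: nondecreasing_cvgn_le; last exact: is_cvg_series_exp_coeff.
    by apply/nondecreasing_seqP => i; rewrite /series /= big_nat_recr//= lerDl exp_coeff_ge0.
  rewrite /series /=; apply: le_trans (ler_norm_sum _ _ _) _.
  apply: ler_sum => i _; rewrite /exp_coeff /= normrM ler_pM//; last first.
    by rewrite ger0_norm ?invr_ge0.
  rewrite normrX normrN ger0_norm ?mulr_ge0 ?(ltW u0)//.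
  by rewrite lerXn2r ?nnegrE ?mulr_ge0 ?(ltW u0)// ler_piMr// ltW.
have [_ _ lim1] := @dominated_convergence _ _ _ mu setT measurableT f_
  (fun u => (beta_dens x y u * expR (- (z * u)))%:E) g mf mlim
  (aeW mu (fun u _ => cf u)) ig (aeW mu (fun u n _ => bf u n)).
have intf n : (\int[mu]_u f_ n u)%E = (K * pseries (kummer_coef x (x + y) 0) (- z) n)%:E.
  rewrite /f_ /pseries /series /= big_mkord mulr_sumr -[RHS]sumEFin.
  under eq_integral do rewrite -sumEFin.
  rewrite integral_sum//.
  by apply: eq_bigr => i _; exact: int_term.
apply: (cvg_unique _ lim1) => //.
rewrite [X in X @ \oo](_ : _ = (fun n => (K * pseries (kummer_coef x (x + y) 0) (- z) n)%:E)); last first.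
  by apply/funext => n /=; rewrite intf.
apply: cvg_EFin; first exact: nearW.
apply: cvgMl_tmp; apply: is_cvg_fact_dominated; apply: kummer_coef_dominated => //.
by rewrite lerDl ltW.
Qed.

End beta_expansion.

(** * Probabilistic representation of the solution *)

Section solution_integral.
Variables (R : realType) (mu sigma lambda : R).
Hypotheses (sigma_gt0 : 0 < sigma) (lambda_gt0 : 0 < lambda).
Local Notation leb := (@lebesgue_measure R).
Local Notation k := (kexp mu sigma lambda).
Local Notation c := (cpar mu sigma).
Local Notation z := (zarg sigma).
Local Notation sol := (kummer_sol mu sigma lambda).

Let k_gt0 : 0 < k. Proof. exact: kexp_gt0. Qed.
Let ck_gt1 : 1 < c + k. Proof. exact: cpar_kexp_gt1. Qed.

(* [P(beta > s)] for [beta] of law Beta(1, c + k - 1). *)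
Definition beta_tail (s : R) : R := if s < 1 then (1 - s) `^ (c + k - 1) else 0.

Lemma beta_tail_ge0 s : 0 <= beta_tail s.
Proof. by rewrite /beta_tail; case: ifP => // _; exact: powR_ge0. Qed.

Lemma beta_tail_anti s t : s <= t -> beta_tail t <= beta_tail s.
Proof.
move=> st; rewrite {1}/beta_tail; case: ifPn => [t1|_]; last exact: beta_tail_ge0.
rewrite /beta_tail (le_lt_trans st)//; apply: ge0_ler_powR; rewrite ?nnegrE ?subr_ge0 ?lerB//.
- exact: ltW.
- exact: ltW.
- by rewrite ltW// (le_lt_trans st).
Qed.

Lemma beta_tail_le1 s : 0 <= s -> beta_tail s <= 1.
Proof.
by move=> /beta_tail_anti/le_trans; apply; rewrite /beta_tail ltr01 subr0 powR1.
Qed.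

Lemma measurable_beta_tail : measurable_fun setT beta_tail.
Proof. by apply: nonincreasing_measurable => // s t; exact: beta_tail_anti. Qed.

Let integrand (t v : R) : R := gamma_dens k v * beta_tail (v * t).

Let integrand_ge0 t v : 0 <= integrand t v.
Proof. by rewrite mulr_ge0 ?gamma_dens_ge0 ?beta_tail_ge0. Qed.

Let integrand_le t v : 0 <= t -> integrand t v <= gamma_dens k v.
Proof.
move=> t0; rewrite /integrand; have [v0|v0] := leP v 0.
  by rewrite gamma_dens0 ?mul0r.
by rewrite ler_piMr ?gamma_dens_ge0// beta_tail_le1// mulr_ge0// ltW.
Qed.

Let measurable_integrand t : measurable_fun setT (integrand t).
Proof.
apply: measurable_funM; first exact: measurable_gamma_dens.
by apply: (measurableT_comp measurable_beta_tail); exact: measurable_funM.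
Qed.

(** The substitution v = z u leads to the Laplace transform of Beta(k, c + k). With independent
    gamma of law Gamma(k) and beta of law Beta(1, c + k - 1), the identity reads sol y = P(2 beta /
    (sigma^2 gamma) > y): bounds, monotonicity and the limit at 0, invisible on the alternating
    series, can be read off. *)
Lemma sol_integral (y : R) : 0 < y ->
  (Gamma k * sol y)%:E = (\int[leb]_v (integrand (z y)^-1 v)%:E)%E.
Proof.
move=> y0; have z0 : 0 < z y by exact: zarg_gt0.
have zn0 := lt0r_neq0 z0.
rewrite (@ge0_integral_affine R (fun v => (integrand (z y)^-1 v)%:E) (z y) 0)//; last 2 first.
- by apply/measurable_EFinP; exact: measurable_integrand.
- by move=> v; rewrite lee_fin integrand_ge0.
have E u : integrand (z y)^-1 (z y * u + 0) =
    z y `^ (k - 1) * (beta_dens k (c + k) u * expR (- (z y * u))).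
  rewrite addr0 /integrand (mulrAC (z y) u) divff// mul1r.
  have [u0|u0] := leP u 0.
    rewrite gamma_dens0; last by rewrite mulr_ge0_le0// ltW.
    by rewrite beta_dens0 ?mul0r ?mulr0// negb_and -leNgt u0.
  have [u1|u1] := ltP u 1; last first.
    rewrite /beta_tail ltNge u1 /= mulr0 beta_dens0 ?mul0r ?mulr0//.
    by rewrite negb_and -!leNgt u1 orbT.
  have u01 : 0 < u < 1 by rewrite u0 u1.
  rewrite /beta_tail u1 (gamma_densE _ (mulr_gt0 z0 u0)) (beta_densE _ _ u01).
  by rewrite powRM ?ltW//; ring.
under eq_integral do rewrite E EFinM.
rewrite ge0_integralZl_EFin ?powR_ge0//; last 2 first.
- by move=> u _; rewrite lee_fin mulr_ge0 ?beta_dens_ge0 ?expR_ge0.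
- apply/measurable_EFinP; apply: measurable_funM; first exact: measurable_beta_dens.
  by apply: measurableT_comp => //; apply: measurableT_comp => //; exact: measurable_funM.
have ck0 : 0 < c + k by exact: lt_trans ck_gt1.
rewrite integral_beta_expR// ?(ltW z0)// -!EFinM; congr EFin.
have kck : k + (c + k) = c + 2 * k by ring.
have zk : z y `^ (k + 0) = z y * z y `^ (k - 1).
  by rewrite -{2}(powRr1 (ltW z0)) -powRD ?(gt_eqF z0) ?implybT//; congr powR; ring.
rewrite /kummer_sol /kterm /sol_const zk kck; ring.
Qed.

Lemma sol01 (y : R) : 0 < y -> 0 <= sol y <= 1.
Proof.
move=> y0; have G0 : 0 < Gamma k by exact: Gamma_gt0.
have z0 : 0 <= (z y)^-1 by rewrite invr_ge0 ltW// zarg_gt0.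
rewrite -(pmulr_rge0 _ G0) -[sol y <= 1](ler_pM2l G0) mulr1 -!lee_fin sol_integral//.
rewrite -gamma_int_fin// integral_ge0 => [/=|v _]; last by rewrite lee_fin integrand_ge0.
apply: ge0_le_integral => //.
- by move=> v _; rewrite lee_fin integrand_ge0.
- by apply/measurable_EFinP; exact: measurable_integrand.
- by apply/measurable_EFinP; exact: measurable_gamma_dens.
- by move=> v _; rewrite lee_fin integrand_le.
Qed.

(** In the integral only the argument v / z = v y sigma^2 / 2 of [beta_tail] depends on y. *)
Lemma sol_anti (y y' : R) : 0 < y -> y <= y' -> sol y' <= sol y.
Proof.
move=> y0 yy'; have G0 : 0 < Gamma k by exact: Gamma_gt0.
have y'0 : 0 < y' by exact: lt_le_trans yy'.
rewrite -(ler_pM2l G0) -lee_fin (sol_integral y0) (sol_integral y'0).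
apply: ge0_le_integral => //.
- by move=> v _; rewrite lee_fin integrand_ge0.
- by apply/measurable_EFinP; exact: measurable_integrand.
- by apply/measurable_EFinP; exact: measurable_integrand.
move=> v _; rewrite lee_fin /integrand; have [v0|v0] := leP v 0.
  by rewrite gamma_dens0 ?mul0r.
rewrite ler_wpM2l ?gamma_dens_ge0//; apply: beta_tail_anti.
rewrite ler_pM2l// /zarg !invf_div ler_pM2r ?invr_gt0//.
by rewrite ler_pM2r// exprn_gt0.
Qed.

(** Dominated convergence along y = 1 / (n + 1); monotonicity then passes from the sequence to all
    smaller y. *)
Lemma sol_near0 (eta : R) : 0 < eta -> exists2 y0, 0 < y0 &
  forall y, 0 < y <= y0 -> 1 - eta <= sol y.
Proof.
move=> eta0; have G0 : 0 < Gamma k by exact: Gamma_gt0.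
pose yn (n : nat) : R := n.+1%:R^-1.
have yn0 n : 0 < yn n by rewrite invr_gt0.
have lim1 : (\int[leb]_v (integrand (z (yn n))^-1 v)%:E)%E @[n --> \oo] -->
    (\int[leb]_v (gamma_dens k v)%:E)%E.
  have mI n : measurable_fun setT (fun v => (integrand (z (yn n))^-1 v)%:E).
    by apply/measurable_EFinP; exact: measurable_integrand.
  have mg : measurable_fun setT (fun v => (gamma_dens k v)%:E).
    by apply/measurable_EFinP; exact: measurable_gamma_dens.
  have := @dominated_convergence _ _ _ leb setT measurableT
    (fun n v => (integrand (z (yn n))^-1 v)%:E) (fun v => (gamma_dens k v)%:E)
    (fun v => (gamma_dens k v)%:E) mI mg.
  move=> /(_ _ _ _)/wrap[]; last by case.
  - apply: aeW => v _; apply: cvg_EFin; first exact: nearW.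
    rewrite /integrand; have [v0|v0] := leP v 0.
      rewrite gamma_dens0//; under eq_fun do rewrite mul0r.
      exact: cvg_cst.
    rewrite -[X in _ --> X]mulr1; apply: cvgMl_tmp.
    have sn : v * (z (yn n))^-1 @[n --> \oo] --> (0 : R).
      have -> : (fun n => v * (z (yn n))^-1) = (fun n => v * sigma ^+ 2 / 2 * harmonic n).
        by apply/funext => n; rewrite /zarg invf_div /yn /=; ring.
      rewrite -[X in _ --> X](mulr0 (v * sigma ^+ 2 / 2)).
      by apply: cvgMl_tmp; exact: cvg_harmonic.
    have c1 : {for (1 : R), continuous (fun s : R => s `^ (c + k - 1))}.
      have h1 : (1 : R) \in `]0, +oo[ by rewrite in_itv /= ltr01.
      by have /derivable1_diffP/differentiable_continuous :=
        @derivable_powR R 1 (c + k - 1) 1 h1.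
    have c2 : (1 - v * (z (yn n))^-1) `^ (c + k - 1) @[n --> \oo] --> (1 : R).
      have h1 : 1 - v * (z (yn n))^-1 @[n --> \oo] --> (1 : R).
        by rewrite -[X in _ --> X]subr0; apply: cvgB => //; exact: cvg_cst.
      by have := cvg_comp _ _ h1 c1; rewrite powR1.
    apply: cvg_trans c2; apply: near_eq_cvg; near=> n.
    rewrite /beta_tail ifT//.
    by near: n; apply: (cvgr_lt 0 sn); exact: ltr01.
  - apply/integrableP; split; first by apply/measurable_EFinP; exact: measurable_gamma_dens.
    under eq_integral do rewrite /= ger0_norm ?gamma_dens_ge0//.
    by rewrite -/(gamma_int k) gamma_int_lty.
  - apply: aeW => v n _ /=; rewrite lee_fin ger0_norm ?integrand_ge0//.
    by apply: integrand_le; rewrite invr_ge0 ltW// zarg_gt0.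
have lim2 : sol (yn n) @[n --> \oo] --> (1 : R).
  have : (Gamma k * sol (yn n))%:E @[n --> \oo] --> (Gamma k * 1)%:E.
    under eq_fun do rewrite sol_integral//.
    by rewrite mulr1 -gamma_int_fin.
  move=> /fine_cvg /= H.
  have -> : (fun n => sol (yn n)) = (fun n => (Gamma k)^-1 * (Gamma k * sol (yn n))).
    by apply/funext => n; rewrite mulrA mulVf ?mul1r// gt_eqF.
  have -> : (1 : R) = (Gamma k)^-1 * (Gamma k * 1) by rewrite mulr1 mulVf// gt_eqF.
  exact: cvgMl_tmp.
have /cvgrPdist_lt/(_ _ eta0)[n _ /(_ n (leqnn n)) /= H] := lim2.
exists (yn n) => // y /andP[y0 yy].
apply: le_trans (sol_anti y0 yy).
by move: H; rewrite ltr_norml => /andP[_]; lra.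
Unshelve. all: by end_near. Qed.

End solution_integral.

(** * One step of the lognormal kernel *)

Section integral_density.
Variable R : realType.
Local Notation mu := (@lebesgue_measure R).
Import HBNNSimple.
Local Open Scope ereal_scope.

Lemma ge0_integral_density (g : R -> R) (m : {measure set (measurableTypeR R) -> \bar R}) :
  measurable_fun [set: R] g -> (forall x, (0 <= g x)%R) ->
  (forall A, measurable A -> m A = \int[mu]_(x in A) (g x)%:E) ->
  forall f : R -> \bar R, measurable_fun [set: R] f -> (forall x, 0 <= f x) ->
  \int[m]_x f x = \int[mu]_x (f x * (g x)%:E).
Proof.
move=> mg g0 mE f mf f0.
have mgE : measurable_fun [set: R] (EFin \o g) by apply/measurable_EFinP.
pose f_ := nnsfun_approx measurableT mf.
have f_cvg x : (f_ n x)%:E @[n --> \oo] --> f x.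
  by apply: cvg_nnsfun_approx.
have f_nd x : nondecreasing_seq (fun n => (f_ n x)%:E).
  by move=> i j ij; rewrite lee_fin; exact/lefP/nd_nnsfun_approx.
transitivity (limn (fun n => \int[m]_x (f_ n x)%:E)).
  rewrite -monotone_convergence//.
  - by apply: eq_integral => y _; apply/esym/cvg_lim.
  - by move=> n; apply/measurable_EFinP; exact: (measurable_funP (f_ n)).
  - by move=> n y _; rewrite lee_fin.
transitivity (limn (fun n => \int[mu]_x ((f_ n x)%:E * (g x)%:E))); last first.
  rewrite -monotone_convergence//.
  - apply: eq_integral => y _; apply/cvg_lim => //.
    by apply: cvgeZr => //; exact: f_cvg.
  - move=> n; apply: emeasurable_funM => //.
    by apply/measurable_EFinP; exact: (measurable_funP (f_ n)).
  - by move=> n y _; rewrite mule_ge0// lee_fin.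
  - by move=> y _ i j ij; rewrite lee_wpmul2r ?lee_fin//; exact: (f_nd y i j ij).
congr (limn _); apply/funext => n.
have mpre y : measurable (f_ n @^-1` [set y] : set R).
  by rewrite -[X in measurable X]setTI; exact: (measurable_funP (f_ n)).
have mind y : measurable_fun [set: R] (fun x => (y * \1_(f_ n @^-1` [set y]) x)%:E).
  by apply/measurable_EFinP; apply: measurable_funM => //; exact: measurable_indic.
transitivity (\sum_(k \in range (f_ n)) (k%:E * m (f_ n @^-1` [set k]))).
  under eq_integral do rewrite fimfunE -fsumEFin//.
  rewrite ge0_integral_fsum//; try exact: mind;
    try by (move=> y x _; rewrite nnfun_muleindic_ge0).
  apply: eq_fsbigr => r rr.
  have r0 : (0 <= r)%R by move: rr; rewrite inE => -[x _ <-].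
  under eq_integral do rewrite EFinM.
  have mi : measurable_fun [set: R] (fun x => (\1_(f_ n @^-1` [set r]) x : R)%:E).
    by apply/measurable_EFinP; exact: measurable_indic.
  rewrite ge0_integralZl_EFin//; try by (move=> x _; rewrite lee_fin).
  by rewrite integral_indic//= ?setIT ?setTI//; exact: mpre.
under [RHS]eq_integral => x _.
  rewrite fimfunE -fsumEFin// ge0_mule_fsuml; last first.
    by move=> r; rewrite nnfun_muleindic_ge0.
  over.
rewrite ge0_integral_fsum//.
2: by move=> r; apply: emeasurable_funM => //; exact: mind.
2: by move=> r x _; rewrite mule_ge0 ?lee_fin//; exact: (nnfun_muleindic_ge0 (f_ n)).
apply: eq_fsbigr => r rr; rewrite mE; last exact: mpre.
have r0 : (0 <= r)%R by move: rr; rewrite inE => -[x _ <-].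
rewrite [in LHS]integral_mkcond -ge0_integralZl_EFin//; last 2 first.
- by move=> x _; apply: erestrict_ge0 => y _; rewrite lee_fin.
- by apply/(measurable_restrictT _ _).1; [exact: mpre|exact: measurable_funTS].
apply: eq_integral => x _; rewrite patchE indicE.
case: ifPn => _; first by rewrite mulr1.
by rewrite mulr0 mule0 mul0e.
Qed.

(** Completing the square turns the exponentially tilted centred density into a constant times the
    density with mean t s^2. *)
Lemma normal_mgf (s t : R) : s != 0%R ->
  \int[normal_prob 0 s]_x (expR (t * x))%:E = (expR (t ^+ 2 * s ^+ 2 / 2))%:E.
Proof.
move=> s0.
have me : measurable_fun [set: R] (fun x : R => (expR (t * x))%:E).
  by apply/measurable_EFinP; apply: measurableT_comp => //; exact: measurable_funM.
rewrite (@ge0_integral_density (normal_pdf 0 s)) //; last 2 first.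
- exact: measurable_normal_pdf.
- exact: normal_pdf_ge0.
transitivity (\int[mu]_x ((expR (t ^+ 2 * s ^+ 2 / 2))%:E *
    (normal_pdf (t * s ^+ 2) s x)%:E)).
  apply: eq_integral => x _; rewrite -!EFinM; congr EFin.
  rewrite /normal_pdf (negbTE s0) /normal_fun.
  rewrite ![(_ * (normal_peak _ * _))%R]mulrCA -!expRD; congr (_ * expR _)%R.
  by field.
rewrite ge0_integralZl_EFin ?expR_ge0//; last 2 first.
- by move=> x _; rewrite lee_fin normal_pdf_ge0.
- by apply/measurable_EFinP; exact: measurable_normal_pdf.
by rewrite integral_normal_pdf mule1.
Qed.

End integral_density.

(** * First-order expansions with uniform quadratic error *)

Section second_order.
Variables (R : realType) (s0 : R).
Implicit Types (u v : R -> R -> R) (k l : R -> R).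

(* [u h s = 1 + k s * h + O(h ^ 2)], uniformly in [0 <= s <= s0]. *)
Definition expand2 u k := exists2 L : R, (forall s, 0 <= s <= s0 -> `|k s| <= L) &
  forall h s, 0 < h <= 1 -> 0 <= s <= s0 -> `|u h s - 1 - k s * h| <= L * h ^+ 2.

Lemma expand2M u v k l : expand2 u k -> expand2 v l ->
  expand2 (fun h s => u h s * v h s) (fun s => k s + l s).
Proof.
move=> [L kL uL] [M lM vM].
have [s00|s00] := leP 0 s0; last first.
  by exists 0 => [s|h s _] /andP[a1 a2]; have := le_lt_trans (le_trans a1 a2) s00;
    rewrite ltxx.
have L0 : 0 <= L by apply: le_trans (kL 0 _); rewrite ?lexx.
have M0 : 0 <= M by apply: le_trans (lM 0 _); rewrite ?lexx.
have LM0 := mulr_ge0 L0 M0.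
(* With h <= 1 the remainder is at most (L + M + 4 L M) h^2; the larger constant leaves room and
   bounds [k s + l s] as well. *)
exists (3 * L + 3 * M + 4 * L * M) => [s ss|h s hh ss].
  have := kL _ ss; have := lM _ ss => h1 h2.
  by apply: le_trans (ler_normD _ _) _; nra.
have /andP[h0 h1] := hh.
have := uL _ _ hh ss; have := vM _ _ hh ss; have := kL _ ss; have := lM _ ss.
set du := u h s - 1 - k s * h; set dv := v h s - 1 - l s * h => lk kk dvM duL.
have -> : u h s * v h s - 1 - (k s + l s) * h =
    k s * l s * h ^+ 2 + du * (1 + l s * h) + dv * (1 + k s * h) + du * dv.
  by rewrite /du /dv; ring.
have hh0 : 0 <= h ^+ 2 by rewrite exprn_ge0// ltW.
have hh1 : h ^+ 2 <= 1 by rewrite exprn_ile1// ltW.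
have n1 : `|1 + l s * h| <= 1 + M.
  rewrite (le_trans (ler_normD _ _))// normr1 lerD2l normrM (gtr0_norm h0).
  by rewrite -[leRHS]mulr1 ler_pM// ltW.
have n2 : `|1 + k s * h| <= 1 + L.
  rewrite (le_trans (ler_normD _ _))// normr1 lerD2l normrM (gtr0_norm h0).
  by rewrite -[leRHS]mulr1 ler_pM// ltW.
have t1 : `|k s * l s * h ^+ 2| <= L * M * h ^+ 2.
  by rewrite normrM (ger0_norm hh0) normrM ler_wpM2r// ler_pM.
have t2 : `|du * (1 + l s * h)| <= L * h ^+ 2 * (1 + M).
  by rewrite normrM ler_pM.
have t3 : `|dv * (1 + k s * h)| <= M * h ^+ 2 * (1 + L).
  by rewrite normrM ler_pM.
have t4 : `|du * dv| <= L * h ^+ 2 * (M * 1).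
  rewrite normrM ler_pM// (le_trans dvM)// ler_wpM2l//.
apply: le_trans (ler_normD _ _) _.
apply: le_trans (lerD (ler_normD _ _) t4) _.
apply: le_trans (lerD (lerD (ler_normD _ _) t3) (lexx _)) _.
apply: le_trans (lerD (lerD (lerD t1 t2) (lexx _)) (lexx _)) _.
by nra.
Qed.

(** |e^x - 1 - x| <= x^2 e^|x| follows from e^t >= 1 + t at t = x and t = - x. *)
Lemma expand2_expR (c : R) : expand2 (fun h _ => expR (c * h)) (fun=> c).
Proof.
have e2 (x : R) : `|expR x - 1 - x| <= x ^+ 2 * expR `|x|.
  have g1 : 1 + x <= expR x := expR_ge1Dx x.
  have g2 : 1 - x <= expR (- x) := expR_ge1Dx (- x).
  have g3 : expR x - 1 <= x * expR x.
    have := ler_wpM2r (expR_ge0 x) g2; rewrite -expRD addNr expR0.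
    by rewrite mulrBl mul1r; lra.
  rewrite ger0_norm; last by lra.
  have [x0|x0] := leP 0 x.
    rewrite ger0_norm//; apply: (@le_trans _ _ (x * (expR x - 1))); first by nra.
    by rewrite expr2 -mulrA ler_wpM2l.
  apply: (@le_trans _ _ (x ^+ 2)); first by nra.
  by rewrite ler_peMr ?sqr_ge0// -expR0 ler_expR.
exists (`|c| + c ^+ 2 * expR `|c|) => [s _|h s /andP[h0 h1] _].
  by rewrite lerDl mulr_ge0 ?sqr_ge0 ?expR_ge0.
apply: le_trans (e2 _) _.
have : expR `|c * h| <= expR `|c|.
  by rewrite ler_expR normrM (gtr0_norm h0) ler_piMr.
have := expR_ge0 `|c * h|; have := normr_ge0 c; have := sqr_ge0 c.
move=> c2 nc e0 ee; rewrite exprMn [leRHS]mulrDl mulrAC.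
have h2 := sqr_ge0 h.
apply: (@le_trans _ _ (c ^+ 2 * expR `|c| * h ^+ 2)).
  by rewrite ler_wpM2r// ler_wpM2l.
by rewrite lerDr mulr_ge0.
Qed.

Lemma expand2_lin : expand2 (fun h s => 1 - h * s) (fun s => - s).
Proof.
exists `|s0| => [s /andP[a1 a2]|h s _ _].
  by rewrite normrN ger0_norm// (le_trans a2)// ler_norm.
have -> : 1 - h * s - 1 - - s * h = 0 by ring.
by rewrite normr0 mulr_ge0 ?sqr_ge0.
Qed.

Lemma expand2X u k n : expand2 u k ->
  expand2 (fun h s => u h s ^+ n) (fun s => n%:R * k s).
Proof.
move=> uk; elim: n => [|n [L kL uL]].
  exists 0 => [s _|h s _ _]; first by rewrite mul0r normr0.
  by rewrite expr0 subrr !mul0r subrr normr0.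
have [M kM uM] := expand2M uk (ex_intro2 _ _ L kL uL).
have nE s : n.+1%:R * k s = k s + n%:R * k s by rewrite -natr1; ring.
exists M => [s /kM|h s hh ss]; first by rewrite nE.
rewrite exprS nE; exact: (uM _ _ hh ss).
Qed.

End second_order.

Lemma norm_le_sum7 (R : realType) (a1 a2 a3 a4 a5 a6 a7 : R) :
  let s := `|a1| + `|a2| + `|a3| + `|a4| + `|a5| + `|a6| + `|a7| in
  [/\ `|a1| <= s, `|a2| <= s, `|a3| <= s, `|a4| <= s &
   [/\ `|a5| <= s, `|a6| <= s & `|a7| <= s]].
Proof.
move=> s; rewrite /s; clear s.
have := normr_ge0 a1; have := normr_ge0 a2; have := normr_ge0 a3; have := normr_ge0 a4.
have := normr_ge0 a5; have := normr_ge0 a6; have := normr_ge0 a7.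
by repeat split; lra.
Qed.

(** Expectations of even powers of the increment are combinations of exponential moments, that of
    |t|^3 is not. For |t| <= 1/2, |t|^3 <= ee t^2 + t^4 / ee; for |t| > 1/2, 1 <= 16 t^4 absorbs
    everything. In the application E t^2 = O(h) meets the small factor [ee], and E t^4 = O(h^2). *)
Lemma remainder_bound (R : realType) (F f p q t K ee : R) : 0 <= K -> 0 < ee <= 1 ->
  `|p| <= K -> `|q| <= K -> 0 <= F <= 1 -> 0 <= f <= 1 ->
  (`|t| <= 2^-1 -> `|F - f - p * t - q / 2 * t ^+ 2| <= K * `|t| ^+ 3) ->
  `|F - f - p * t - q / 2 * t ^+ 2| <=
    (16 + 12 * K) * ee * t ^+ 2 + (16 + 12 * K) / ee * t ^+ 4.
Proof.
move=> K0 /andP[ee0 ee1] pK qK F01 f01 small.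
(* 16 comes from 1 <= 16 t^4; 12 K exceeds the 8 K + 2 K due to the terms K |t| and K t^2 / 2. *)
pose K' := 16 + 12 * K; rewrite -/K'.
have K'0 : 0 < K' by rewrite ltr_wpDr// mulr_ge0.
have E2 : t ^+ 2 = `|t| ^+ 2 by rewrite real_normK ?num_real.
have E4 : t ^+ 4 = `|t| ^+ 4 by rewrite (exprM t 2 2) E2 -exprM.
have n0 : 0 <= `|t| by exact: normr_ge0.
have [t12|t12] := leP `|t| 2^-1.
  apply: le_trans (small t12) _; rewrite E2 E4; clear small E2 E4 t12.
  set n := `|t| in n0 *.
  have amgm : n ^+ 3 <= ee * n ^+ 2 + n ^+ 4 / ee.
    rewrite -(ler_pM2r ee0) mulrDl divfK ?gt_eqF//.
    have : 0 <= (n * ee - n ^+ 2 / 2) ^+ 2 by exact: sqr_ge0.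
    have : 0 <= n ^+ 4 by exact: exprn_ge0.
    by move=> a1 a2; clear -a1 a2; nra.
  have -> : K' * ee * n ^+ 2 + K' / ee * n ^+ 4 = K' * (ee * n ^+ 2 + n ^+ 4 / ee) by ring.
  have KK' : K <= K' by clear -K0; rewrite /K'; lra.
  by apply: ler_pM => //; exact: exprn_ge0.
apply: (@le_trans _ _ (1 + K * `|t| + K / 2 * `|t| ^+ 2)).
  apply: le_trans (ler_normB _ _) _; apply: lerD; last first.
    rewrite normrM -E2 [`|t ^+ 2|]ger0_norm ?sqr_ge0// ler_wpM2r ?sqr_ge0//.
    by rewrite normrM [`|2^-1|]ger0_norm ?invr_ge0// ler_wpM2r ?invr_ge0.
  apply: le_trans (ler_normB _ _) _; apply: lerD; last by rewrite normrM ler_wpM2r.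
  by clear -F01 f01; rewrite ler_norml; lra.
rewrite E2 E4; clear small E2 E4 F01 f01 pK qK; set n := `|t| in n0 t12 *.
have n2 : 1 <= 2 * n by clear -t12; lra.
have n4 : 1 <= 16 * n ^+ 4.
  have -> : 16 * n ^+ 4 = (2 * n) ^+ 4 by ring.
  exact: exprn_ege1.
have n41 : n <= 8 * n ^+ 4.
  have -> : 8 * n ^+ 4 = (2 * n) ^+ 3 * n by ring.
  by rewrite ler_peMl// exprn_ege1.
have n42 : n ^+ 2 <= 4 * n ^+ 4.
  have -> : 4 * n ^+ 4 = (2 * n) ^+ 2 * n ^+ 2 by ring.
  by rewrite ler_peMl ?sqr_ge0// exprn_ege1.
have n4p : 0 <= n ^+ 4 by rewrite exprn_ge0.
have g1 : K' * n ^+ 4 <= K' / ee * n ^+ 4.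
  by rewrite ler_wpM2r// ler_pdivlMr// ler_piMr// ltW.
have g2 : 0 <= K' * ee * n ^+ 2 by rewrite mulr_ge0 ?sqr_ge0// mulr_ge0// ltW.
have g3 : K * n <= K * (8 * n ^+ 4) by rewrite ler_wpM2l.
have g4 : K * n ^+ 2 <= K * (4 * n ^+ 4) by rewrite ler_wpM2l.
have g5 : 0 <= K * n ^+ 4 by rewrite mulr_ge0.
move: g1; rewrite {1}/K'; clear -n4 g2 g3 g4 g5; lra.
Qed.

(** Here m_n = E (1 + r)^n for the relative increment r, so E r^2 and E r^4 are a second and a
    fourth difference of m. The rates n mu + n^2 sigma^2 / 2 - n s are quadratic in n, hence E r^2 =
    sigma^2 h + O(H) and E r^4 = O(H), where [H] stands for a multiple of h^2. *)
Lemma step_error (R : realType) (mu sigma lambda G Q f p q s h H K be ga m1 m2 m3 m4 : R) :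
  0 <= f <= 1 -> 0 <= Q <= 1 -> 0 <= K -> `|p| <= K -> `|q| <= K ->
  0 <= be -> 0 <= ga -> 0 <= H ->
  sigma ^+ 2 / 2 * q + (mu + sigma ^+ 2 / 2 - s) * p - lambda * f = 0 ->
  `|m1 - 1 - (1%:R * mu + 1%:R ^+ 2 * sigma ^+ 2 / 2 + 1%:R * - s) * h| <= H ->
  `|m2 - 1 - (2%:R * mu + 2%:R ^+ 2 * sigma ^+ 2 / 2 + 2%:R * - s) * h| <= H ->
  `|m3 - 1 - (3%:R * mu + 3%:R ^+ 2 * sigma ^+ 2 / 2 + 3%:R * - s) * h| <= H ->
  `|m4 - 1 - (4%:R * mu + 4%:R ^+ 2 * sigma ^+ 2 / 2 + 4%:R * - s) * h| <= H ->
  `|Q - 1 - - lambda * h| <= H ->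
  `|Q * m1 - 1 - (- lambda + (1%:R * mu + 1%:R ^+ 2 * sigma ^+ 2 / 2 + 1%:R * - s)) * h| <= H ->
  `|Q * m2 - 1 - (- lambda + (2%:R * mu + 2%:R ^+ 2 * sigma ^+ 2 / 2 + 2%:R * - s)) * h| <= H ->
  G <= f + p * (m1 - 1) + (q / 2 + be) * (m2 - 2 * m1 + 1)
    + ga * (m4 - 4 * m3 + 6 * m2 - 4 * m1 + 1) ->
  f + p * (m1 - 1) + (q / 2 - be) * (m2 - 2 * m1 + 1)
    + - ga * (m4 - 4 * m3 + 6 * m2 - 4 * m1 + 1) <= G ->
  `|Q * G - f| <= be * (sigma ^+ 2 * h + 4 * H) + ga * (16 * H) + (1 + 4 * K) * H.
Proof.
move=> f01 Q01 K0 pK qK be0 ga0 H0 ode b1 b2 b3 b4 b5 b6 b7 GU GV.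
set e2 := m2 - 2 * m1 + 1 in GU GV; set e4 := m4 - 4 * m3 + 6 * m2 - 4 * m1 + 1 in GU GV.
have e2b : e2 <= sigma ^+ 2 * h + 4 * H.
  move: b1 b2; rewrite /e2 !ler_norml => /andP[c1 c2] /andP[c3 c4].
  by clear -c1 c2 c3 c4 H0; lra.
have e4b : e4 <= 16 * H.
  move: b1 b2 b3 b4; rewrite /e4 !ler_norml.
  move=> /andP[c1 c2] /andP[c3 c4] /andP[c5 c6] /andP[c7 c8].
  by clear -c1 c2 c3 c4 c5 c6 c7 c8 H0; lra.
set T := f + p * (m1 - 1) + q / 2 * e2.
have GT : `|G - T| <= be * (sigma ^+ 2 * h + 4 * H) + ga * (16 * H).
  have k1 : be * e2 <= be * (sigma ^+ 2 * h + 4 * H) by rewrite ler_wpM2l.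
  have k2 : ga * e4 <= ga * (16 * H) by rewrite ler_wpM2l.
  by rewrite ler_norml /T; clear -GU GV k1 k2; lra.
have QT : `|Q * T - f| <= (1 + 4 * K) * H.
  clear GU GV GT e4 e4b b1 b2 b3 b4.
  set u5 := Q - 1 - _ in b5; set u6 := Q * m1 - 1 - _ in b6; set u7 := Q * m2 - 1 - _ in b7.
  (* The terms of order h in [Q], [Q * m1] and [Q * m2] add up to h times the left-hand side of the
     equation; only the remainders [u5], [u6], [u7] survive. *)
  have -> : Q * T - f = f * u5 + p * (u6 - u5) + q / 2 * (u7 - 2 * u6 + u5).
    have -> : f * u5 = f * (Q - 1) + h * (lambda * f) by rewrite /u5; ring.
    have -> : lambda * f = sigma ^+ 2 / 2 * q + (mu + sigma ^+ 2 / 2 - s) * p.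
      by apply/esym/eqP; rewrite -subr_eq0 ode.
    by rewrite /T /e2 /u5 /u6 /u7; field.
  clearbody u5 u6 u7.
  have w1 : `|f * u5| <= 1 * H by rewrite normrM ler_pM// ger0_norm; case/andP: f01.
  have w2 : `|p * (u6 - u5)| <= K * (2 * H).
    rewrite normrM ler_pM// mulr_natl mulr2n; apply: le_trans (ler_normB _ _) _.
    exact: lerD.
  have w3 : `|q / 2 * (u7 - 2 * u6 + u5)| <= K / 2 * (4 * H).
    rewrite normrM ler_pM//.
      by rewrite normrM [`|2^-1|]ger0_norm ?invr_ge0// ler_wpM2r ?invr_ge0.
    apply: le_trans (ler_normD _ _) _.
    apply: le_trans (lerD (ler_normB _ _) (lexx _)) _.
    by rewrite normrM [`|2|]ger0_norm//; clear -b5 b6 b7; lra.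
  apply: le_trans (ler_normD _ _) _.
  apply: le_trans (lerD (ler_normD _ _) w3) _; clear -w1 w2; lra.
have -> : Q * G - f = Q * (G - T) + (Q * T - f) by ring.
apply: le_trans (ler_normD _ _) _.
have QG : `|Q * (G - T)| <= `|G - T|.
  by case/andP: Q01 => q0 q1; rewrite normrM ger0_norm// ler_piMl.
exact: le_trans (lerD QG QT) (lerD GT (lexx _)).
Qed.

(** * Consistency of one discounted step *)

Section one_step.
Variables (R : realType) (mu sigma lambda : R).
Hypotheses (sigma_gt0 : 0 < sigma) (lambda_gt0 : 0 < lambda).

Definition gauss_mean (h : R) (phi : R -> R) : R :=
  \int[normal_prob 0 (Num.sqrt h)]_x phi x.

Definition lognormal_step (h x : R) : R := expR (mu * h + sigma * x).

Lemma measurable_lognormal_step h : measurable_fun setT (lognormal_step h).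
Proof.
by apply: measurableT_comp => //; apply: measurable_funD => //; exact: measurable_funM.
Qed.

Definition lognormal_rate (n : nat) : R := n%:R * mu + n%:R ^+ 2 * sigma ^+ 2 / 2.

Lemma integral_lognormal_stepX h n : 0 < h ->
  (\int[normal_prob 0 (Num.sqrt h)]_x (lognormal_step h x ^+ n)%:E =
   (expR (lognormal_rate n * h))%:E)%E.
Proof.
move=> h0; have sh : Num.sqrt h != 0 by rewrite gt_eqF// sqrtr_gt0.
under eq_integral => x _.
  have -> : lognormal_step h x ^+ n = expR (n%:R * mu * h) * expR ((n%:R * sigma) * x).
    rewrite /lognormal_step -expRM_natl -expRD; congr expR; ring.
  rewrite EFinM; over.
rewrite ge0_integralZl_EFin ?expR_ge0//; last first.
  by apply/measurable_EFinP; apply: measurableT_comp => //; exact: measurable_funM.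
rewrite normal_mgf// sqr_sqrtr ?ltW// -EFinM -expRD; congr (expR _)%:E.
by rewrite /lognormal_rate; field.
Qed.

Local Notation N h := (normal_prob 0 (Num.sqrt h)).

Lemma gauss_integrable_bounded h (phi : R -> R) (C : R) :
  measurable_fun setT phi -> (forall x, `|phi x| <= C) ->
  (N h).-integrable setT (EFin \o phi).
Proof.
move=> mphi phiC; apply: measurable_bounded_integrable => //.
  by rewrite (le_lt_trans (probability_le1 _ _))// ltry.
by exists C; split; [rewrite num_real|move=> D CD x _; exact: le_trans (phiC x) (ltW CD)].
Qed.

Lemma gauss_integrableX h n : 0 < h ->
  (N h).-integrable setT (fun x => (lognormal_step h x ^+ n)%:E).
Proof.
move=> h0; apply/integrableP; split.
  by apply/measurable_EFinP; apply: measurable_funX; exact: measurable_lognormal_step.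
under eq_integral do rewrite gee0_abs ?lee_fin ?exprn_ge0 ?expR_ge0//.
by rewrite integral_lognormal_stepX// ltry.
Qed.

Lemma gauss_meanX h n : 0 < h ->
  gauss_mean h (fun x => lognormal_step h x ^+ n) = expR (lognormal_rate n * h).
Proof. by move=> h0; rewrite /gauss_mean /Rintegral integral_lognormal_stepX. Qed.

Lemma gauss_mean_quartic h (a : nat -> R) : 0 < h ->
  let g := fun x => a 0 + a 1 * lognormal_step h x ^+ 1 + a 2 * lognormal_step h x ^+ 2
    + a 3 * lognormal_step h x ^+ 3 + a 4 * lognormal_step h x ^+ 4 in
  (N h).-integrable setT (EFin \o g) /\
  gauss_mean h g = a 0 + a 1 * expR (lognormal_rate 1 * h)
   + a 2 * expR (lognormal_rate 2 * h) + a 3 * expR (lognormal_rate 3 * h)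
   + a 4 * expR (lognormal_rate 4 * h).
Proof.
move=> h0 /=.
have iX n : (N h).-integrable setT (EFin \o (fun x => a n * lognormal_step h x ^+ n)).
  have -> : EFin \o (fun x => a n * lognormal_step h x ^+ n) =
    (fun x => (a n)%:E * (lognormal_step h x ^+ n)%:E)%E by apply/funext.
  exact/integrableZl/gauss_integrableX.
have i0 : (N h).-integrable setT (EFin \o (fun _ : R => a 0)).
  exact: (@gauss_integrable_bounded _ _ `|a 0|).
have eX n : gauss_mean h (fun x => a n * lognormal_step h x ^+ n)
    = a n * expR (lognormal_rate n * h).
  rewrite /gauss_mean RintegralZl//; last exact: gauss_integrableX.
  by congr (_ * _); exact: gauss_meanX.
have e0 : gauss_mean h (fun _ => a 0) = a 0.
  rewrite /gauss_mean Rintegral_cst//.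
  have -> : fine (N h setT) = 1 by rewrite (@probability_setT _ _ _ (N h)).
  by rewrite mulr1.
have iD (f g : R -> R) : (N h).-integrable setT (EFin \o f) ->
    (N h).-integrable setT (EFin \o g) ->
    (N h).-integrable setT (EFin \o (fun x => f x + g x)).
  by move=> fi gi; have := integrableD measurableT fi gi.
have eD (f g : R -> R) : (N h).-integrable setT (EFin \o f) ->
    (N h).-integrable setT (EFin \o g) ->
    gauss_mean h (fun x => f x + g x) = gauss_mean h f + gauss_mean h g.
  by move=> fi gi; rewrite /gauss_mean RintegralD.
have i1 := iD _ _ i0 (iX 1); have i2 := iD _ _ i1 (iX 2).
have i3 := iD _ _ i2 (iX 3); have i4 := iD _ _ i3 (iX 4).
split; first exact: i4.
by rewrite (eD _ _ i3 (iX 4)) (eD _ _ i2 (iX 3)) (eD _ _ i1 (iX 2)) (eD _ _ i0 (iX 1)) e0 !eX.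
Qed.

Lemma le_gauss_mean h (f g : R -> R) : (N h).-integrable setT (EFin \o f) ->
  (N h).-integrable setT (EFin \o g) -> (forall x, f x <= g x) ->
  gauss_mean h f <= gauss_mean h g.
Proof. by move=> fi gi fg; apply: le_Rintegral => // x _; exact: fg. Qed.

(** For s = 1 / y, the [n]-th moment of the relative position e^{X_h} (y - h) / y after one step. *)
Definition step_moment (n : nat) (h s : R) : R :=
  expR (lognormal_rate n * h) * (1 - h * s) ^+ n.

Lemma expand2_step_moment s0 n :
  expand2 s0 (step_moment n) (fun s => lognormal_rate n + n%:R * - s).
Proof.
by apply: expand2M; [exact: expand2_expR|apply: expand2X; exact: expand2_lin].
Qed.

Lemma gauss_mean_increment h s (f al be ga : R) : 0 < h ->
  let r := fun x => lognormal_step h x * (1 - h * s) - 1 in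
  let g := fun x => f + al * r x + be * r x ^+ 2 + ga * r x ^+ 4 in
  (N h).-integrable setT (EFin \o g) /\
  gauss_mean h g = f + al * (step_moment 1 h s - 1)
    + be * (step_moment 2 h s - 2 * step_moment 1 h s + 1)
    + ga * (step_moment 4 h s - 4 * step_moment 3 h s
            + 6 * step_moment 2 h s - 4 * step_moment 1 h s + 1).
Proof.
move=> h0 r g; set c := 1 - h * s.
pose a (n : nat) : R := match n with
  | 0 => f - al + be + ga
  | 1 => (al - 2 * be - 4 * ga) * c
  | 2 => (be + 6 * ga) * c ^+ 2
  | 3 => - 4 * ga * c ^+ 3
  | _ => ga * c ^+ 4 end.
have := gauss_mean_quartic a h0; rewrite /=.
have -> : (fun x => a 0 + a 1 * lognormal_step h x ^+ 1 + a 2 * lognormal_step h x ^+ 2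
    + a 3 * lognormal_step h x ^+ 3 + a 4 * lognormal_step h x ^+ 4) = g.
  by apply/funext => x; rewrite /g /r /a /= -/c; ring.
move=> [gi ->]; split => //; rewrite /a /= /step_moment -/c; ring.
Qed.

(** When h >= y the step leads to a nonpositive position, where [f] has no meaning. [fhat] only has
    to stay in [0, 1] there: such a move has relative increment at most -1 and falls under the crude
    case of [remainder_bound]. *)
Lemma one_step_consistency (f fhat p q : R -> R) (y0 K : R) : 0 < y0 -> 0 <= K ->
  (forall y, 0 < y -> fhat y = f y) -> (forall y, 0 <= fhat y <= 1) ->
  measurable_fun setT fhat ->
  (forall y, y0 <= y -> `|p y| <= K /\ `|q y| <= K) ->
  (forall y r, y0 <= y -> `|r| <= 2^-1 ->
    `|f (y * (1 + r)) - f y - p y * r - q y / 2 * r ^+ 2| <= K * `|r| ^+ 3) ->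
  (forall y, y0 <= y ->
    sigma ^+ 2 / 2 * q y + (mu + sigma ^+ 2 / 2 - y^-1) * p y - lambda * f y = 0) ->
  forall e, 0 < e -> exists2 h0, 0 < h0 & forall h y, 0 < h < h0 -> y0 <= y ->
    `|expR (- lambda * h) * gauss_mean h (fun x => fhat (lognormal_step h x * (y - h)))
      - f y| <= e * h.
Proof.
move=> y00 K0 fhatE fhat01 mfhat pqK taylor ode e e0.
pose K' := 16 + 12 * K.
have K'0 : 0 < K' by rewrite /K'; lra.
pose s0 := y0^-1.
have s00 : 0 < s0 by rewrite invr_gt0.
have [L1 _ M1] := expand2_step_moment s0 1.
have [L2 _ M2] := expand2_step_moment s0 2.
have [L3 _ M3] := expand2_step_moment s0 3.
have [L4 _ M4] := expand2_step_moment s0 4.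
have [L5 _ M5] := expand2_expR s0 (- lambda).
have [L6 _ M6] := expand2M (expand2_expR s0 (- lambda)) (expand2_step_moment s0 1).
have [L7 _ M7] := expand2M (expand2_expR s0 (- lambda)) (expand2_step_moment s0 2).
pose L := `|L1| + `|L2| + `|L3| + `|L4| + `|L5| + `|L6| + `|L7|.
have L0 : 0 <= L by rewrite /L !addr_ge0.
have ss : 0 < sigma ^+ 2 by rewrite exprn_gt0.
(* [ee] is fixed before h and brings the error K' ee sigma^2 h below (e / 2) h. The bound h0 then
   brings D h^2 below (e / 2) h, although D contains 1 / ee. *)
pose ee := Num.min 1 (e / (2 * K' * sigma ^+ 2)).
have ee0 : 0 < ee by rewrite lt_min ltr01 divr_gt0// !mulr_gt0.
have ee1 : ee <= 1 by rewrite ge_min lexx.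
have eee : K' * ee * sigma ^+ 2 <= e / 2.
  have : ee <= e / (2 * K' * sigma ^+ 2) by rewrite ge_min lexx orbT.
  rewrite ler_pdivlMr ?mulr_gt0// => H; rewrite ler_pdivlMr//.
  by apply: le_trans H; rewrite le_eqVlt; apply/orP; left; apply/eqP; ring.
pose D := K' * ee * 4 * L + K' / ee * 16 * L + (1 + 4 * K) * L.
have D0 : 0 <= D.
  rewrite /D !addr_ge0// !mulr_ge0//; try exact: ltW; first by rewrite invr_ge0 ltW.
  by rewrite addr_ge0// mulr_ge0.
pose h0 := Num.min 1 (e / (2 * (D + 1))).
exists h0 => [|h y /andP[hp hh0] yy0].
  by rewrite lt_min ltr01 divr_gt0// mulr_gt0// ltr_wpDl.
have h1 : h <= 1 by rewrite ltW// (lt_le_trans hh0)// ge_min lexx.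
have hD : D * h <= e / 2.
  have : h <= e / (2 * (D + 1)) by rewrite ltW// (lt_le_trans hh0)// ge_min lexx orbT.
  rewrite ler_pdivlMr ?mulr_gt0 ?ltr_wpDl// => H; rewrite ler_pdivlMr//.
  by apply: le_trans H; nra.
have y_gt0 : 0 < y by exact: lt_le_trans yy0.
pose s := y^-1.
have s01 : 0 <= s <= s0 by rewrite invr_ge0 ltW//= lef_pV2 ?posrE.
have hh : 0 < h <= 1 by rewrite hp.
have [pK qK] := pqK _ yy0.
have fy01 : 0 <= f y <= 1 by rewrite -fhatE.
pose r := fun x => lognormal_step h x * (1 - h * s) - 1.
have YE x : lognormal_step h x * (y - h) = y * (1 + r x).
  by rewrite /r /s; field; exact: lt0r_neq0.
have bound x : `|fhat (lognormal_step h x * (y - h)) - f y - p y * r x - q y / 2 * r x ^+ 2|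
    <= K' * ee * r x ^+ 2 + K' / ee * r x ^+ 4.
  apply: remainder_bound => //; first by rewrite ee0.
  move=> rx; rewrite YE fhatE; first exact: taylor.
  rewrite mulr_gt0//; move: rx; rewrite ler_norml => /andP[rx _].
  by rewrite -ltrBlDl sub0r (lt_le_trans _ rx)// ltrN2 invf_lt1// ltr1n.
set G := gauss_mean h _.
have iG : (N h).-integrable setT (EFin \o (fun x => fhat (lognormal_step h x * (y - h)))).
  apply: (@gauss_integrable_bounded _ _ 1).
    apply: (measurableT_comp mfhat); apply: measurable_funM => //.
    exact: measurable_lognormal_step.
  by move=> x; have /andP[a1 a2] := fhat01 (lognormal_step h x * (y - h)); rewrite ger0_norm.
have [iU eU] := gauss_mean_increment s (f y) (p y) (q y / 2 + K' * ee) (K' / ee) hp.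
have [iV eV] := gauss_mean_increment s (f y) (p y) (q y / 2 - K' * ee) (- (K' / ee)) hp.
have GU : G <= f y + p y * (step_moment 1 h s - 1)
    + (q y / 2 + K' * ee) * (step_moment 2 h s - 2 * step_moment 1 h s + 1)
    + K' / ee * (step_moment 4 h s - 4 * step_moment 3 h s
            + 6 * step_moment 2 h s - 4 * step_moment 1 h s + 1).
  rewrite -eU; apply: le_gauss_mean => // x; have := bound x.
  by rewrite -/(r x) ler_norml => /andP[_]; lra.
have GV : f y + p y * (step_moment 1 h s - 1)
    + (q y / 2 - K' * ee) * (step_moment 2 h s - 2 * step_moment 1 h s + 1)
    + - (K' / ee) * (step_moment 4 h s - 4 * step_moment 3 h s
            + 6 * step_moment 2 h s - 4 * step_moment 1 h s + 1) <= G.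
  rewrite -eV; apply: le_gauss_mean => // x; have := bound x.
  by rewrite -/(r x) ler_norml => /andP[+ _]; lra.
have h2 : 0 <= h ^+ 2 by exact: sqr_ge0.
have LL (a x : R) : `|a| <= L -> x <= a * h ^+ 2 -> x <= L * h ^+ 2.
  by move=> aL /le_trans; apply; rewrite ler_wpM2r// (le_trans (ler_norm _)).
have [l1 l2 l3 l4 [l5 l6 l7]] := norm_le_sum7 L1 L2 L3 L4 L5 L6 L7.
have := LL _ _ l7 (M7 _ _ hh s01); have := LL _ _ l6 (M6 _ _ hh s01).
have := LL _ _ l5 (M5 _ _ hh s01); have := LL _ _ l4 (M4 _ _ hh s01).
have := LL _ _ l3 (M3 _ _ hh s01); have := LL _ _ l2 (M2 _ _ hh s01).
have := LL _ _ l1 (M1 _ _ hh s01).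
have := ode _ yy0; rewrite -/s.
have Q0 : 0 <= expR (- lambda * h) <= 1.
  by rewrite expR_ge0 -expR0 ler_expR mulNr oppr_le0 mulr_ge0// ltW.
have H0 : 0 <= L * h ^+ 2 by rewrite mulr_ge0.
move=> odey b1 b2 b3 b4 b5 b6 b7.
have K'ee : 0 <= K' * ee by rewrite mulr_ge0// ltW.
have K'Vee : 0 <= K' / ee by rewrite divr_ge0// ltW.
apply: le_trans (step_error fy01 Q0 K0 pK qK K'ee K'Vee H0 odey b1 b2 b3 b4 b5 b6 b7 GU GV) _.
have -> : K' * ee * (sigma ^+ 2 * h + 4 * (L * h ^+ 2)) + K' / ee * (16 * (L * h ^+ 2))
    + (1 + 4 * K) * (L * h ^+ 2) = (K' * ee * sigma ^+ 2 + D * h) * h by rewrite /D; ring.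
by rewrite ler_pM2r// [leRHS]splitr lerD.
Qed.

End one_step.

(** * Discretized functional *)

Section joint_law.
Context d (T : measurableType d) (R : realType) (P : probability T R).
Local Open Scope ereal_scope.

Lemma law_exists (V : T -> R) : measurable_fun setT V ->
  exists rho : probability (measurableTypeR R) R,
    forall B, rho B = P (V @^-1` B).
Proof.
move=> mV; pose V' := @mfun_Sub _ _ T (measurableTypeR R) V (mem_set mV).
by exists (distribution P V' : probability _ R).
Qed.

(** After division by P(E), the conditional law of (U, V) agrees with the product measure on
    rectangles, hence everywhere. The event [E] is carried along so that independence of the past
    can be propagated. *)
Lemma joint_law (E : set T) (U V : T -> R) (nu rho : probability (measurableTypeR R) R) :
  measurable E -> measurable_fun setT U -> measurable_fun setT V ->
  (forall A B, measurable A -> measurable B ->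
    P (E `&` (U @^-1` A `&` V @^-1` B)) = P E * nu A * rho B) ->
  forall C : set (measurableTypeR R * measurableTypeR R), measurable C ->
    P (E `&` [set w | C (U w, V w)]) = P E * (nu \x rho) C.
Proof.
move=> mE mU mV EUV C mC.
pose phi : T -> measurableTypeR R * measurableTypeR R := fun w => (U w, V w).
have mphi : measurable_fun setT phi by exact: measurable_fun_pair.
have mpre (D : set (measurableTypeR R * measurableTypeR R)) : measurable D -> measurable (phi @^-1` D).
  by move=> mD; rewrite -[X in measurable X]setTI; exact: mphi.
have [PE0|PE0] := eqVneq (P E) 0.
  rewrite PE0 mul0e; apply/eqP; rewrite -measure_le0 -PE0.
  by apply: le_measure; rewrite ?inE//; apply: measurableI => //; exact: mpre.
have PEfin : P E \is a fin_num by exact: fin_num_measure.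
have c0 : (0 < fine (P E))%R by rewrite fine_gt0// lt0e PE0 measure_ge0 -ge0_fin_numE.
pose m0 : {measure set (measurableTypeR R * measurableTypeR R) -> \bar R} :=
  measure_function_pushforward__canonical__measure_function_Measure (mrestr P mE) mphi.
have ci0 : (0 <= (fine (P E))^-1)%R by rewrite invr_ge0 ltW.
pose m' := mscale (NngNum ci0) m0.
have m'E D : measurable D -> m' D = ((fine (P E))^-1)%:E * P (E `&` phi @^-1` D).
  by move=> mD; rewrite /m' /mscale /=; congr (_ * _); rewrite setIC.
have PEV : ((fine (P E))^-1)%:E * P E = 1.
  by rewrite -[X in _ * X]fineK// -EFinM mulVf// gt_eqF.
have key : (nu \x rho) C = m' C.
  apply: product_measure_unique => // A B mA mB.
  apply: (etrans (m'E _ _)); first exact: measurableX.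
  have -> : phi @^-1` (A `*` B) = U @^-1` A `&` V @^-1` B by apply/seteqP; split.
  by rewrite EUV// -muleA (muleA _ (P E)) PEV mul1e.
by rewrite key m'E// (muleA (P E)) (muleC (P E)) PEV mul1e.
Qed.

End joint_law.

(** * Riemann sums as functionals of the increments *)

Section discretization.
Context d (T : measurableType d) (R : realType) (P : probability T R).
Variables (W : R -> T -> R) (mu sigma h : R).
Hypotheses (BM : standard_brownian_motion P W) (h_gt0 : 0 < h).

Definition incr (i : nat) (w : T) : R := W (i.+1%:R * h) w - W (i%:R * h) w.

Lemma measurable_incr i : measurable_fun setT (incr i).
Proof.
by case: BM => _ _ mW _ _; apply: measurable_funB; apply: mW; rewrite mulr_ge0// ltW.
Qed.

(* [disc_sum m j] is [e^{X_{mh}}] times the left Riemann sum, with mesh [h] and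
   [j] terms, of [e^{-X}] from time [mh] on, where [X_t = mu t + sigma W_t]. *)
Fixpoint disc_sum (m j : nat) (w : T) : R :=
  if j is j'.+1 then h + expR (- (mu * h + sigma * incr m w)) * disc_sum m.+1 j' w
  else 0.

Lemma measurable_disc_sum m j : measurable_fun setT (disc_sum m j).
Proof.
elim: j m => [|j IH] m //=; apply: measurable_funD => //.
apply: measurable_funM; last exact: IH.
apply: measurableT_comp => //; apply: measurableT_comp => //.
by apply: measurable_funD => //; apply: measurable_funM => //; exact: measurable_incr.
Qed.

Lemma disc_sum_nd m j w : disc_sum m j w <= disc_sum m j.+1 w.
Proof.
elim: j m => [|j IH] m /=; first by rewrite mulr0 addr0 ltW.
by rewrite lerD2l ler_wpM2l ?expR_ge0//; exact: IH.
Qed.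

(** The recursion is a Horner scheme: each level factors out the exponential of one increment. *)
Lemma disc_sumE m j w : expR (- (mu * (m%:R * h) + sigma * W (m%:R * h) w)) * disc_sum m j w
  = \sum_(m <= i < m + j) h * expR (- (mu * (i%:R * h) + sigma * W (i%:R * h) w)).
Proof.
elim: j m => [|j IH] m; first by rewrite addn0 big_geq// mulr0.
rewrite big_ltn; last by rewrite addnS ltnS leq_addr.
rewrite addnS -addSn -IH /= mulrDr mulrC; congr (_ + _).
rewrite mulrA -expRD /incr; congr (expR _ * _).
by rewrite -natr1; ring.
Qed.

(** Cylinder events stand in for the sigma-algebra of the first [m] increments. *)
Definition past (A : nat -> set R) (m : nat) : set T :=
  [set w | forall i, (i < m)%N -> A i (incr i w)].

Lemma pastS A m : past A m.+1 = past A m `&` incr m @^-1` A m.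
Proof.
apply/seteqP; split => w /=.
  by move=> H; split => [i im|]; apply: H => //; exact: ltnW.
by move=> [H1 H2] i; rewrite ltnS leq_eqVlt => /orP[/eqP ->|/H1].
Qed.

Local Open Scope ereal_scope.

Lemma measurable_past A m : (forall i, measurable (A i)) -> measurable (past A m).
Proof.
move=> mA; elim: m => [|m IH].
  by rewrite (_ : past A 0 = setT) //; apply/seteqP; split.
rewrite pastS; apply: measurableI => //.
by rewrite -[X in measurable X]setTI; exact: measurable_incr.
Qed.

Lemma prob_past A m : (forall i, measurable (A i)) ->
  P (past A m) = \prod_(i < m) normal_prob 0 (Num.sqrt h) (A i).
Proof.
move=> mA; case: BM => _ _ _ nW iW.
have := iW m (fun i => (i%:R * h)%R) _ _ (fun i : 'I_m => A i) (fun i => mA i).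
rewrite mul0r lexx => /(_ isT) H.
have -> : past A m = \bigcap_(i in [set: 'I_m]) [set w | A i (W (i.+1%:R * h) w - W (i%:R * h) w)%R].
  apply/seteqP; split => w /=; first by move=> H1 i _; exact: H1.
  by move=> H1 i im; exact: (H1 (Ordinal im)).
rewrite H; last by move=> i _; rewrite ler_wpM2r ?ler_nat// ltW.
apply: eq_bigr => i _.
have s0 : (0 <= i%:R * h)%R by rewrite mulr_ge0// ltW.
have st : (i%:R * h < i.+1%:R * h)%R by rewrite ltr_pM2r// ltr_nat.
apply: (etrans (nW _ _ s0 st _ (mA i))).
have -> : (i.+1%:R * h - i%:R * h = h)%R by rewrite -mulrBl -natr1 addrAC subrr add0r mul1r.
by [].
Qed.

Lemma prob_pastS A m : (forall i, measurable (A i)) ->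
  P (past A m.+1) = P (past A m) * normal_prob 0 (Num.sqrt h) (A m).
Proof. by move=> mA; rewrite !prob_past// big_ord_recr. Qed.

(** Independence of the past (the product form) and stationarity (the index 0 on the right) are
    obtained together, by induction on [j] for all [m] at once. *)
Lemma disc_sum_law j m A B : (forall i, measurable (A i)) -> measurable B ->
  P (past A m `&` disc_sum m j @^-1` B) = P (past A m) * P (disc_sum 0 j @^-1` B).
Proof.
elim: j m A B => [|j IH] m A B mA mB.
  have [B0|B0] := pselect (B 0%R).
    rewrite (_ : _ @^-1` B = setT); last by apply/seteqP; split.
    by rewrite setIT probability_setT mule1.
  rewrite (_ : _ @^-1` B = set0); last by apply/seteqP; split.
  by rewrite setI0 measure0 mule0.
have [rho rhoE] := law_exists P (measurable_disc_sum 0 j).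
pose C : set (measurableTypeR R * measurableTypeR R) :=
  [set p | B (h + expR (- (mu * h + sigma * p.1)) * p.2)%R].
have mC : measurable C.
  rewrite -[X in measurable X]setTI /C.
  pose g (p : measurableTypeR R * measurableTypeR R) : measurableTypeR R :=
    (h + expR (- (mu * h + sigma * p.1)) * p.2)%R.
  suff mg : measurable_fun setT g by exact: mg.
  apply: measurable_funD => //; apply: measurable_funM => //.
  apply: measurableT_comp => //; apply: measurableT_comp => //.
  by apply: measurable_funD => //; exact: measurable_funM.
(* The second factor does not depend on [k]: the case k = m is compared with k = 0 and trivial
   constraints. *)
have key k D : (forall i, measurable (D i)) ->
    P (past D k `&` disc_sum k j.+1 @^-1` B) =
    P (past D k) * (normal_prob 0 (Num.sqrt h) \x rho) C.
  move=> mD.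
  apply: (@joint_law _ _ _ P (past D k) (incr k) (disc_sum k.+1 j)
     (normal_prob 0 (Num.sqrt h)) rho _ _ _ _ C mC).
  - exact: measurable_past.
  - exact: measurable_incr.
  - exact: measurable_disc_sum.
  (* The constraint on increment [k] becomes the entry [k] of a past of length k + 1, to which the
     induction hypothesis applies. *)
  move=> A1 B1 mA1 mB1; pose D' i := if (i < k)%N then D i else A1.
  have mD' i : measurable (D' i) by rewrite /D'; case: ifP.
  have pD : past D k = past D' k.
    by apply/seteqP; split => w H i ik; have := H i ik; rewrite /D' ik.
  have D'k : D' k = A1 by rewrite /D' ltnn.
  rewrite setIA pD -{1}D'k -pastS IH// prob_pastS// D'k.
  by rewrite rhoE.
rewrite key//; congr (_ * _).
have := key 0%N (fun=> setT) (fun=> measurableT).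
rewrite (_ : past _ 0 = setT); last by apply/seteqP; split.
by rewrite setTI probability_setT mul1e => ->.
Qed.

Lemma disc_sum_tailS j (y : R) :
  P [set w | (y < disc_sum 0 j.+1 w)%R] =
  \int[normal_prob 0 (Num.sqrt h)]_x
    P [set w | (expR (mu * h + sigma * x) * (y - h) < disc_sum 0 j w)%R].
Proof.
have [rho rhoE] := law_exists P (measurable_disc_sum 0 j).
pose C : set (measurableTypeR R * measurableTypeR R) :=
  [set p | (y < h + expR (- (mu * h + sigma * p.1)) * p.2)%R].
have mC : measurable C.
  rewrite -[X in measurable X]setTI /C.
  pose g (p : measurableTypeR R * measurableTypeR R) : measurableTypeR R :=
    (h + expR (- (mu * h + sigma * p.1)) * p.2)%R.
  have mg : measurable_fun setT g.
    apply: measurable_funD => //; apply: measurable_funM => //.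
    apply: measurableT_comp => //; apply: measurableT_comp => //.
    by apply: measurable_funD => //; exact: measurable_funM.
  have := mg measurableT [set` `]y, +oo[%R]; rewrite (_ : g @^-1` _ = C).
    by apply; exact: measurable_itv.
  by apply/seteqP; split => p /=; rewrite in_itv /= andbT.
transitivity ((normal_prob 0 (Num.sqrt h) \x rho) C).
  have : P (setT `&` [set w | C (incr 0 w, disc_sum 1 j w)]) =
      P setT * (normal_prob 0 (Num.sqrt h) \x rho) C.
    apply: joint_law => //; [exact: measurable_incr|exact: measurable_disc_sum|].
    move=> A B mA mB; rewrite setTI probability_setT mul1e rhoE.
    have := @disc_sum_law j 1 (fun=> A) B (fun=> mA) mB; rewrite prob_pastS// pastS.
    rewrite (_ : past _ 0 = setT); last by apply/seteqP; split.
    by rewrite probability_setT mul1e setTI.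
  by rewrite setTI probability_setT mul1e => <-.
rewrite /product_measure1 /=; apply: eq_integral => x _; rewrite rhoE; congr (P _).
apply/seteqP; split => w /=; rewrite /xsection /= inE /C /= -ltrBlDl expRN.
  by rewrite ltr_pdivlMl ?expR_gt0.
by rewrite ltr_pdivlMl ?expR_gt0.
Qed.

End discretization.

(** * Geometric averages of the tails and the maximum principle *)

Section comparison.
Context d (T : measurableType d) (R : realType) (P : probability T R).
Variables (W : R -> T -> R) (mu sigma lambda h : R).
Hypotheses (BM : standard_brownian_motion P W).
Hypotheses (lambda_gt0 : 0 < lambda) (h_gt0 : 0 < h).
Local Notation N := (normal_prob 0 (Num.sqrt h)).
Local Notation Y y x := (lognormal_step mu sigma h x * (y - h)).

Lemma gauss_mean_cst (c : R) : gauss_mean h (fun=> c) = c.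
Proof.
rewrite /gauss_mean Rintegral_cst//.
have -> : fine (N setT) = 1 by rewrite (@probability_setT _ _ _ N).
by rewrite mulr1.
Qed.

Definition disc_tail (j : nat) (y : R) : R :=
  fine (P [set w | y < disc_sum W mu sigma h 0 j w]).

Let q := expR (- lambda * h).

Let q_gt0 : 0 < q. Proof. exact: expR_gt0. Qed.

Let q_lt1 : q < 1.
Proof. by rewrite -expR0 ltr_expR mulNr oppr_lt0 mulr_gt0. Qed.

Lemma measurable_disc_event j y : measurable [set w | y < disc_sum W mu sigma h 0 j w].
Proof.
have := measurable_disc_sum mu sigma BM h_gt0 0 j measurableT (measurable_itv `]y, +oo[).
rewrite setTI; congr measurable; apply/seteqP; split => w /=.
  by rewrite in_itv /= andbT.
by rewrite in_itv /= andbT.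
Qed.

Lemma disc_tailE j y :
  (disc_tail j y)%:E = P [set w | y < disc_sum W mu sigma h 0 j w].
Proof. by rewrite fineK// fin_num_measure//; exact: measurable_disc_event. Qed.

Lemma disc_tail01 j y : 0 <= disc_tail j y <= 1.
Proof.
by rewrite -!lee_fin disc_tailE measure_ge0 probability_le1//; exact: measurable_disc_event.
Qed.

Lemma disc_tail_anti j y y' : y <= y' -> disc_tail j y' <= disc_tail j y.
Proof.
move=> yy'; rewrite -lee_fin !disc_tailE; apply: le_measure; rewrite ?inE;
  [exact: measurable_disc_event..|].
by move=> w /=; exact: le_lt_trans.
Qed.

Lemma disc_tail_nd i j y : (i <= j)%N -> disc_tail i y <= disc_tail j y.
Proof.
move=> ij; rewrite -(subnK ij); elim: (j - i)%N => [//|n IH].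
apply: le_trans IH _; rewrite addSn.
rewrite -lee_fin !disc_tailE; apply: le_measure; rewrite ?inE;
  [exact: measurable_disc_event..|].
by move=> w /= /lt_le_trans; apply; exact: disc_sum_nd.
Qed.

Lemma disc_tail0 y : 0 <= y -> disc_tail 0 y = 0.
Proof.
move=> y0; rewrite /disc_tail /= (_ : [set _ | _] = set0) ?measure0//.
by apply/seteqP; split => w //=; rewrite ltNge y0.
Qed.

Lemma measurable_disc_tail j : measurable_fun setT (disc_tail j).
Proof. by apply: nonincreasing_measurable => // x y; exact: disc_tail_anti. Qed.

Lemma measurable_step y : measurable_fun setT (fun x => Y y x).
Proof. by apply: measurable_funM => //; exact: measurable_lognormal_step. Qed.

Lemma disc_tailS j y : disc_tail j.+1 y = gauss_mean h (fun x => disc_tail j (Y y x)).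
Proof.
rewrite /disc_tail disc_sum_tailS//; congr fine; apply: eq_integral => x _.
by rewrite -disc_tailE.
Qed.

Lemma integrable_step (phi : R -> R) y : measurable_fun setT phi ->
  (forall z, 0 <= phi z <= 1) -> N.-integrable setT (EFin \o (fun x => phi (Y y x))).
Proof.
move=> mphi phi01; apply: (@gauss_integrable_bounded _ _ _ 1).
  by apply: (measurableT_comp mphi); exact: measurable_step.
by move=> x; have /andP[p0 p1] := phi01 (Y y x); rewrite ger0_norm.
Qed.

(** Beyond [n] cells the tail is replaced by its upper bound 1: the weights then add up to 1, and
    the recursion starts from the constant 1. *)
Definition disc_laplace (n : nat) (y : R) : R :=
  \sum_(j < n) (1 - q) * q ^+ j * disc_tail j y + q ^+ n.

Lemma measurable_disc_laplace n : measurable_fun setT (disc_laplace n).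
Proof.
apply: nonincreasing_measurable => // x y xy; rewrite lerD2r; apply: ler_sum => j _.
rewrite ler_wpM2l ?disc_tail_anti// mulr_ge0 ?exprn_ge0 ?(ltW q_gt0)//.
by rewrite subr_ge0 ltW.
Qed.

Lemma sum_weights n : \sum_(j < n) (1 - q) * q ^+ j = 1 - q ^+ n.
Proof.
elim: n => [|n IH]; first by rewrite big_ord0 expr0 subrr.
by rewrite big_ord_recr /= IH exprS; ring.
Qed.

Lemma disc_laplace01 n y : 0 <= disc_laplace n y <= 1.
Proof.
apply/andP; split.
  rewrite addr_ge0 ?exprn_ge0 ?(ltW q_gt0)//; apply: sumr_ge0 => j _.
  have /andP[t0 _] := disc_tail01 j y.
  by rewrite !mulr_ge0 ?exprn_ge0 ?subr_ge0 ?(ltW q_gt0) ?(ltW q_lt1).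
rewrite -lerBrDr -sum_weights; apply: ler_sum => j _.
have /andP[_ t1] := disc_tail01 j y.
by rewrite ler_piMr// mulr_ge0 ?exprn_ge0 ?subr_ge0 ?(ltW q_gt0) ?(ltW q_lt1).
Qed.

Lemma disc_laplaceS n y : disc_laplace n.+1 y =
  (1 - q) * disc_tail 0 y + q * gauss_mean h (fun x => disc_laplace n (Y y x)).
Proof.
(* The constant is generalized because [q ^+ n] also varies with [n], while the induction concerns
   the number of terms. *)
have mean_sum : forall n c,
    N.-integrable setT (EFin \o (fun x => \sum_(j < n) (1 - q) * q ^+ j * disc_tail j (Y y x) + c)) /\
    gauss_mean h (fun x => \sum_(j < n) (1 - q) * q ^+ j * disc_tail j (Y y x) + c) =
    \sum_(j < n) (1 - q) * q ^+ j * disc_tail j.+1 y + c.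
  elim=> [|m IH] c.
    rewrite big_ord0 add0r (_ : (fun x => _) = cst c); last first.
      by apply/funext => x; rewrite big_ord0 add0r.
    split; last exact: gauss_mean_cst.
    exact: (@gauss_integrable_bounded _ _ _ `|c|).
  have [iI eI] := IH c.
  pose k := (1 - q) * q ^+ m.
  have it := integrable_step y (measurable_disc_tail m) (disc_tail01 m).
  have ik : N.-integrable setT (EFin \o (fun x => k * disc_tail m (Y y x))).
    have -> : EFin \o (fun x => k * disc_tail m (Y y x)) =
      (fun x => k%:E * (disc_tail m (Y y x))%:E)%E by apply/funext.
    exact: integrableZl.
  have E : (fun x => \sum_(j < m.+1) (1 - q) * q ^+ j * disc_tail j (Y y x) + c) =
    (fun x => k * disc_tail m (Y y x) + (\sum_(j < m) (1 - q) * q ^+ j * disc_tail j (Y y x) + c)).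
    by apply/funext => x; rewrite big_ord_recr /= /k; ring.
  rewrite E; split; first by have := integrableD measurableT ik iI.
  rewrite {1}/gauss_mean RintegralD// RintegralZl//.
  rewrite -/(gauss_mean h (fun x => disc_tail m (Y y x))) -disc_tailS.
  rewrite /gauss_mean in eI; rewrite eI big_ord_recr /= /k; ring.
have [_ E] := mean_sum n (q ^+ n).
rewrite /disc_laplace E big_ord_recl expr0 mulr1 -!addrA; congr (_ + _).
rewrite mulrDr -exprS mulr_sumr; congr (_ + _); apply: eq_bigr => j _.
by rewrite /= exprS; ring.
Qed.

(** The tails increase with the index, so those from J on are at least [disc_tail J y], and they
    carry the mass q^J once the final [q ^+ n] is included. The uniformity in [n] is what pins all
    averages near 1 for small y. *)
Lemma disc_laplace_ge J n y : q ^+ J * disc_tail J y <= disc_laplace n y.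
Proof.
have tJ := disc_tail01 J y.
have sum_ge0 m : 0 <= \sum_(j < m) (1 - q) * q ^+ j * disc_tail j y.
  apply: sumr_ge0 => j _; have /andP[t0 _] := disc_tail01 j y.
  by rewrite !mulr_ge0 ?exprn_ge0 ?subr_ge0 ?(ltW q_gt0) ?(ltW q_lt1).
have qJ : q ^+ J * disc_tail J y <= q ^+ J.
  by case/andP: tJ => _ t1; rewrite ler_piMr// exprn_ge0// ltW.
have [nJ|/ltnW Jn] := leqP n J.
  rewrite /disc_laplace (le_trans qJ)// (le_trans (y := q ^+ n))//.
    by apply: ler_wiXn2l; rewrite ?(ltW q_gt0) ?(ltW q_lt1).
  by rewrite lerDr.
(* The left-hand side is the average obtained with tails equal to 0 before J and frozen at
   [disc_tail J y] from J on; this sharper form passes through the induction. *)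
suff H m : q ^+ J * disc_tail J y + q ^+ (J + m) * (1 - disc_tail J y)
    <= disc_laplace (J + m) y.
  have := H (n - J)%N; rewrite subnKC// => /(le_trans _); apply.
  rewrite lerDl mulr_ge0 ?exprn_ge0 ?(ltW q_gt0)// subr_ge0; by case/andP: tJ.
elim: m => [|m IH].
  rewrite addn0 /disc_laplace (_ : _ + _ = q ^+ J) ?lerDr//; ring.
rewrite addnS /disc_laplace big_ord_recr /=.
have := disc_tail_nd y (leq_addr m J) => tt.
move: IH; rewrite /disc_laplace exprS.
have qJm : 0 <= (1 - q) * q ^+ (J + m) by rewrite mulr_ge0 ?exprn_ge0 ?subr_ge0 ?(ltW q_gt0) ?(ltW q_lt1).
set S := \sum_(j < J + m) _; set Q := q ^+ (J + m) in qJm *.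
have := ler_wpM2l qJm tt => k1 k2.
by move: k1 k2; lra.
Qed.

(** Discrete maximum principle. Below y0 both functions lie in [1 - eta, 1]; above, a step contracts
    by q up to the error e, and C = eta + q^n + e / (1 - q) satisfies q C + e <= eta + q^(n + 1) + e
    / (1 - q). At n = 0 two functions with values in [0, 1] differ by at most q^0. *)
Lemma disc_laplace_compare (fhat : R -> R) (y0 eta e : R) : 0 < y0 -> 0 <= eta ->
  0 <= e -> measurable_fun setT fhat -> (forall y, 0 <= fhat y <= 1) ->
  (forall y, y < y0 -> 1 - eta <= fhat y) ->
  (forall n y, y < y0 -> 1 - eta <= disc_laplace n y) ->
  (forall y, y0 <= y -> `|q * gauss_mean h (fun x => fhat (Y y x)) - fhat y| <= e) ->
  forall n y, `|disc_laplace n y - fhat y| <= eta + q ^+ n + e / (1 - q).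
Proof.
move=> y00 eta0 e0 mf f01 fnear Unear step.
have q1 : 0 < 1 - q by rewrite subr_gt0.
have eq0 : 0 <= e / (1 - q) by rewrite divr_ge0// ltW.
elim=> [|n IH] y.
  rewrite /disc_laplace big_ord0 add0r expr0; have := f01 y => f01y.
  by rewrite ger0_norm; lra.
have qn0 : 0 <= q ^+ n.+1 by rewrite exprn_ge0// ltW.
have [yy0|yy0] := ltP y y0.
  have := fnear _ yy0; have := Unear n.+1 _ yy0.
  have := f01 y; have := disc_laplace01 n.+1 y; rewrite ler_norml; lra.
rewrite disc_laplaceS disc_tail0 ?mulr0 ?add0r; last exact: ltW (lt_le_trans y00 yy0).
set U := gauss_mean h _; set F := gauss_mean h (fun x => fhat (Y y x)) in step *.
have C0 := IH.
set C := eta + q ^+ n + e / (1 - q) in C0.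
have iU := integrable_step y (measurable_disc_laplace n) (disc_laplace01 n).
have iF := integrable_step y mf f01.
have UF : `|U - F| <= C.
  rewrite /U /F /gauss_mean -RintegralB//.
  have iB : N.-integrable setT (EFin \o (fun x => disc_laplace n (Y y x) - fhat (Y y x))).
    by have := integrableB measurableT iU iF.
  apply: le_trans (le_normr_Rintegral _ iB) _ => //.
  rewrite -[leRHS]gauss_mean_cst /gauss_mean; apply: le_Rintegral => //.
  - exact: (integrable_norm iB).
  - exact: (@gauss_integrable_bounded _ _ _ `|C|).
have st := step _ yy0; rewrite -/F in st.
have -> : q * U - fhat y = q * (U - F) + (q * F - fhat y) by ring.
apply: le_trans (ler_normD _ _) _; rewrite normrM (gtr0_norm q_gt0).
apply: le_trans (lerD (ler_wpM2l (ltW q_gt0) UF) st) _.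
have -> : q * C + e = q * eta + q ^+ n.+1 + e / (1 - q).
  by rewrite /C exprS; field; rewrite gt_eqF.
by rewrite !lerD2r ler_piMl// ltW.
Qed.

End comparison.

(** * Convergence of the Riemann sums *)

Section uniform_continuity.
Variable R : realType.

Lemma unif_continuous_segment (g : R -> R) (a b : R) : continuous g ->
  forall e, 0 < e -> exists2 del, 0 < del &
    forall s t, a <= s <= b -> `|s - t| < del -> `|g s - g t| < e.
Proof.
move=> cg e e0.
have /compact_near_coveringP := @segment_compact R a b.
move=> /(_ R (nbhs (0 : R)^'+) (fun del s => forall t, `|s - t| < del -> `|g s - g t| < e)).
have FF : Filter (nbhs (0 : R)^'+) by exact: at_right_proper_filter.
move=> /(_ FF) H.
have Hn : \forall i \near 0^'+, `[a, b]%classic `<=` (fun s => forall t, `|s - t| < i -> `|g s - g t| < e).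
  apply: H => x _.
  have e2 : 0 < e / 2 by rewrite divr_gt0.
  have /cvgrPdist_lt/(_ _ e2)/nbhs_ballP[r /= r0 rP] := cg x.
  have r2 : 0 < r / 2 by rewrite divr_gt0.
  exists (ball x (r / 2), [set del | 0 < del < r / 2]) => /=.
    split; first exact: nbhsx_ballx.
    near=> del; rewrite /=; apply/andP; split; near: del.
      exact: nbhs_right_gt.
    exact: nbhs_right_lt.
  move=> [x' del] /= [xx' /andP[d0 dr]] t x't.
  have h1 : `|g x - g x'| < e / 2.
    by apply: rP; apply: le_ball xx'; rewrite ler_pdivrMr// ler_peMr ?ler1n// ltW.
  have h2 : `|g x - g t| < e / 2.
    apply: rP; rewrite /ball /= in xx' *.
    have -> : x - t = (x - x') + (x' - t) by ring.
    by rewrite (le_lt_trans (ler_normD _ _))//; move: xx' x't dr; lra.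
  have -> : g x' - g t = (g x - g t) - (g x - g x') by ring.
  by rewrite (le_lt_trans (ler_normB _ _))//; lra.
near (0 : R)^'+ => del.
exists del; first by near: del; exact: nbhs_right_gt.
have delP : `[a, b]%classic `<=` (fun s => forall t, `|s - t| < del -> `|g s - g t| < e).
  by near: del.
by move=> s t sab st; apply: delP => //=; rewrite in_itv.
Unshelve. all: by end_near. Qed.

(** Brownian paths are continuous within [0, +oo[ and arbitrary at negative times; freezing them at
    time 0 yields the globally continuous functions on which the Riemann sums are studied. *)
Lemma continuous_max0 (f : R -> R) : {within `[0, +oo[, continuous f} ->
  continuous (fun s : R => f (Num.max 0 s)).
Proof.
move=> /continuous_within_itvcyP[cf cf0] x.
have [x0|x0|x0] := ltgtP 0 x.
- have fx : f (Num.max 0 s) @[s --> x] --> f x.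
    apply: cvg_trans (cf x _); last by rewrite in_itv /= andbT.
    apply: near_eq_cvg; near=> s; rewrite max_r//.
    by apply: ltW; near: s; exact: lt_nbhsr.
  by rewrite /continuous_at (max_r (ltW x0)).
- rewrite /continuous_at (max_l (ltW x0)); apply: cvg_near_cst; near=> s; rewrite max_l//.
  by apply: ltW; near: s; exact: lt_nbhsl.
- rewrite /continuous_at -x0 maxxx; apply/cvgrPdist_lt => e e0.
  move/cvgrPdist_lt : cf0 => /(_ _ e0); rewrite near_withinE => cf0.
  near=> s; have [s0|s0] := leP s 0; first by rewrite subrr normr0.
  by move: s0; near: s.
Unshelve. all: by end_near. Qed.

End uniform_continuity.

Section riemann_integral.
Variables (R : realType) (g : R -> R).
Hypothesis cg : continuous g.
Local Notation mu := (@lebesgue_measure R).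

Lemma integrable_continuous_itv (i : interval R) (a b : R) :
  [set` i] `<=` `[a, b]%classic -> mu.-integrable [set` i] (EFin \o g).
Proof.
move=> sub; apply: (@integrableS _ _ _ mu `[a, b]%classic) => //.
apply: continuous_compact_integrable; first exact: segment_compact.
by apply: continuous_subspaceT => x; exact: cg.
Qed.

Definition prim (t : R) : R := \int[mu]_(s in `[0, t]) g s.

Lemma primD (a b : R) : 0 <= a <= b -> prim b - prim a = \int[mu]_(s in `]a, b]) g s.
Proof.
move=> /andP[a0 ab]; rewrite /prim Rintegral_itvB//.
exact: (@integrable_continuous_itv _ 0 b).
Qed.

Lemma Rintegral_itv_bounds (a b m M : R) : a <= b ->
  (forall s, a <= s <= b -> m <= g s <= M) ->
  m * (b - a) <= \int[mu]_(s in `]a, b]) g s <= M * (b - a).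
Proof.
move=> ab mM.
have ig : mu.-integrable `]a, b]%classic (EFin \o g).
  apply: (@integrable_continuous_itv _ a b) => s /=; rewrite !in_itv /=.
  by move=> /andP[/ltW -> ->].
have ic (c : R) : mu.-integrable `]a, b]%classic (EFin \o cst c).
  apply: measurable_bounded_integrable => //.
    by rewrite /= lebesgue_measure_itv /=; case: ifP => _; rewrite ?ltry// -EFinB ltry.
  by exists `|c|; split; [rewrite num_real|move=> D cD x _ /=; exact: ltW].
have ec (c : R) : \int[mu]_(s in `]a, b]) c = c * (b - a).
  rewrite Rintegral_cst//; congr (_ * _); rewrite /= lebesgue_measure_itv /=.
  by move: ab; rewrite le_eqVlt lte_fin => /orP[/eqP ->|->//]; rewrite ltxx subrr.
have mMi s : `]a, b]%classic s -> m <= g s <= M.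
  by rewrite /= in_itv /= => /andP[/ltW as1 sb]; apply: mM; rewrite as1.
apply/andP; split; rewrite -ec.
  by apply: le_Rintegral; [|exact: ic|exact: ig|move=> s /mMi/andP[]].
by apply: le_Rintegral; [|exact: ig|exact: ic|move=> s /mMi/andP[]].
Qed.

(** Uniform continuity controls the sum cell by cell up to j h; boundedness of [g] controls the gap
    between j h and t. *)
Lemma riemann_sum_cvg (t : R) : 0 <= t -> forall e, 0 < e ->
  exists2 del, 0 < del & forall h j, 0 < h < del -> `|j%:R * h - t| <= h ->
    `|\sum_(0 <= i < j) h * g (i%:R * h) - prim t| <= e.
Proof.
move=> t0 e e0.
(* For h <= 1 all nodes lie in [0, B], since j h <= t + h. One half of e pays for e' (j h), the
   other for M h. *)
pose B := t + 1.
pose e' := e / (2 * (B + 1)).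
have B0 : 0 < B by rewrite /B ltr_wpDl.
have e'0 : 0 < e' by rewrite divr_gt0// mulr_gt0// ltr_wpDl// ltW.
have [d1 d10 d1P] := @unif_continuous_segment R g 0 B cg e' e'0.
have [M M0 MP] : exists2 M, 0 < M & forall s, 0 <= s <= B -> `|g s| <= M.
  have [M [_ MP]] : bounded_set (g @` `[0, B]%classic).
    apply: compact_bounded; apply: continuous_compact; last exact: segment_compact.
    by apply: continuous_subspaceT => x; exact: cg.
  exists (`|M| + 1) => [|s sB]; first by rewrite ltr_wpDl.
  apply: (MP (`|M| + 1)); first by rewrite (le_lt_trans (ler_norm _))// ltrDl.
  by exists s => //=; rewrite in_itv.
pose d2 := e / (2 * (M + 1)).
have d20 : 0 < d2 by rewrite divr_gt0// mulr_gt0// ltr_wpDl// ltW.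
exists (Num.min d1 (Num.min d2 1)) => [|h j /andP[h0]].
  by rewrite !lt_min d10 d20 ltr01.
rewrite !lt_min => /andP[hd1 /andP[hd2 h1]] jht.
have jB : j%:R * h <= B by move: jht; rewrite ler_norml /B; lra.
have part1 k : k%:R * h <= B ->
    `|\sum_(0 <= i < k) h * g (i%:R * h) - prim (k%:R * h)| <= e' * (k%:R * h).
  elim: k => [_|k IH kB].
    rewrite big_geq// mul0r mulr0 sub0r normrN /prim.
    by rewrite set_itv1 Rintegral_set1 normr0.
  have kh0 : 0 <= k%:R * h by rewrite mulr_ge0// ltW.
  have kk : k.+1%:R * h = k%:R * h + h by rewrite -natr1; ring.
  have kB' : k%:R * h <= B by move: kB; rewrite kk; lra.
  have := IH kB'; rewrite big_nat_recr//=.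
  have P1 := @primD (k%:R * h) (k.+1%:R * h).
  have : prim (k.+1%:R * h) - prim (k%:R * h) = \int[mu]_(s in `]k%:R * h, k.+1%:R * h]) g s.
    by apply: P1; rewrite kh0 kk lerDl ltW.
  have := @Rintegral_itv_bounds (k%:R * h) (k.+1%:R * h) (g (k%:R * h) - e') (g (k%:R * h) + e').
  set J := Rintegral _ _ _; rewrite kk => /(_ _ _)/wrap[].
  - by rewrite lerDl ltW.
  - move=> s /andP[s1 s2].
    have : `|g (k%:R * h) - g s| < e'.
      apply: d1P; first by rewrite kh0.
      by rewrite distrC ger0_norm; lra.
    by rewrite ltr_norml; lra.
  move=> /andP[J1 J2] PJ; rewrite !ler_norml => /andP[i1 i2].
  by nra.
have jh0 : 0 <= j%:R * h by rewrite mulr_ge0// ltW.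
have part2 : `|prim (j%:R * h) - prim t| <= M * h.
  have aux a b : 0 <= a <= b -> b <= B -> b - a <= h -> `|prim b - prim a| <= M * h.
    move=> /andP[a0 ab] bB bah; rewrite primD ?a0//.
    have /andP[J1 J2] : - M * (b - a) <= \int[mu]_(s in `]a, b]) g s <= M * (b - a).
      apply: Rintegral_itv_bounds => // s /andP[s1 s2].
      have : `|g s| <= M by apply: MP; rewrite (le_trans a0)//= (le_trans s2).
      by rewrite ler_norml.
    have : M * (b - a) <= M * h by rewrite ler_wpM2l// ltW.
    by rewrite ler_norml; lra.
  have := jht; rewrite ler_norml => /andP[jt1 jt2].
  have [jt|jt] := leP (j%:R * h) t.
    by rewrite distrC; apply: aux; rewrite ?jh0//; rewrite /B; lra.
  by apply: aux; rewrite ?t0 ?(ltW jt)//; lra.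
have := part1 _ jB => p1.
have -> : \sum_(0 <= i < j) h * g (i%:R * h) - prim t =
  (\sum_(0 <= i < j) h * g (i%:R * h) - prim (j%:R * h)) + (prim (j%:R * h) - prim t) by ring.
apply: le_trans (ler_normD _ _) _; apply: le_trans (lerD p1 part2) _.
have q1 : e' * (j%:R * h) <= e / 2.
  apply: (@le_trans _ _ (e' * (B + 1))).
    by rewrite ler_wpM2l ?(ltW e'0)//; lra.
  by rewrite /e' invfM mulrA mulfVK// gt_eqF// ltr_wpDl// ltW.
have q2 : M * h <= e / 2.
  apply: (@le_trans _ _ ((M + 1) * d2)).
    by apply: ler_pM; rewrite ?(ltW M0) ?(ltW h0) ?(ltW hd2)//; lra.
  have M1 : M + 1 != 0 by rewrite gt_eqF// ltr_wpDl// ltW.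
  by rewrite le_eqVlt /d2; apply/orP; left; apply/eqP; field.
lra.
Qed.

End riemann_integral.

(** * Lower semicontinuity of tail probabilities *)

Section prob_limits.
Context d (T : measurableType d) (R : realType) (P : probability T R).

Lemma measurable_gt (X : T -> R) y : measurable_fun setT X -> measurable [set w | y < X w].
Proof.
move=> mX; have := mX measurableT _ (measurable_itv `]y, +oo[).
rewrite setTI; congr measurable; apply/seteqP; split => w /=; by rewrite in_itv /= andbT.
Qed.

(** As ]y, +oo[ is open, {X > y} is the increasing union over m of the events where, in addition,
    X_n > y for all n >= m; continuity from below concludes. *)
Lemma prob_gt_liminf (X_ : nat -> T -> R) (X : T -> R) (y : R) :
  (forall n, measurable_fun setT (X_ n)) -> measurable_fun setT X ->
  (forall w, X_ n w @[n --> \oo] --> X w) ->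
  forall e, 0 < e -> \forall n \near \oo,
    fine (P [set w | y < X w]) - e <= fine (P [set w | y < X_ n w]).
Proof.
move=> mX_ mX cX e e0.
pose E := [set w | y < X w].
pose A (m : nat) := E `&` \bigcap_(n in [set n | (m <= n)%N]) [set w | y < X_ n w].
have mE : measurable E by exact: measurable_gt.
have mA m : measurable (A m).
  apply: measurableI => //; apply: bigcap_measurableType => // n _.
  exact: measurable_gt.
have UA : \bigcup_m A m = E.
  apply/seteqP; split => w; first by move=> [m _ []].
  move=> Ew; have /= yX : y < X w := Ew.
  have /cvgrPdist_lt := cX w; move=> /(_ (X w - y)); rewrite subr_gt0 => /(_ yX)[m _ mP].
  exists m => //; split => // n /= mn; have := mP n mn.
  by rewrite /= ltr_norml => /andP[_]; lra.
have ndA : nondecreasing_seq A.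
  move=> m n mn; apply/subsetPset => w [Ew Aw]; split => // i /= ni.
  by apply: Aw => /=; exact: leq_trans ni.
have : P (A m) @[m --> \oo] --> P E.
  by rewrite -UA; apply: nondecreasing_cvg_mu => //; exact: bigcup_measurable.
have PEfin : P E \is a fin_num by exact: fin_num_measure.
rewrite -(fineK PEfin) => /fine_cvg /= /cvgrPdist_lt/(_ _ e0)[m _ mP].
exists m => // n /= mn.
have := mP m (leqnn m); rewrite /= ltr_norml => /andP[_ H].
have AX : fine (P (A m)) <= fine (P [set w | y < X_ n w]).
  apply: fine_le; rewrite ?fin_num_measure//; first exact: measurable_gt.
  apply: le_measure; rewrite ?inE//; first exact: measurable_gt.
  by move=> w [_ Aw]; exact: Aw.
lra.
Qed.

End prob_limits.

(** * The exponential functional and its tails *)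

Section functional.
Context d (T : measurableType d) (R : realType) (P : probability T R).
Variables (W : R -> T -> R) (mu sigma : R).
Hypothesis BM : standard_brownian_motion P W.
Local Notation leb := (@lebesgue_measure R).
Local Notation I := (expo_functional W mu sigma).

Definition expo_path (w : T) (s : R) : R := expR (- (mu * s + sigma * W (Num.max 0 s) w)).

Lemma continuous_exponent w : continuous (fun s : R => mu * s + sigma * W (Num.max 0 s) w).
Proof.
case: BM => _ cW _ _ _ s; apply: cvgD; apply: cvgMl_tmp; first exact: cvg_id.
exact: (@continuous_max0 R (fun t => W t w) (cW w)).
Qed.

Lemma continuous_path w : continuous (expo_path w).
Proof.
move=> s; apply: continuous_comp; last exact: continuous_expR.
by apply: cvgN; exact: continuous_exponent.
Qed.

Lemma expo_functionalE t w : I t w = prim (expo_path w) t.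
Proof.
rewrite /expo_functional /prim /Rintegral; congr fine; apply: eq_integral => s.
by rewrite inE /= in_itv /= => /andP[s0 _]; rewrite /expo_path max_r.
Qed.

Lemma expo_functional_nd w : {homo I ^~ w : s t / s <= t}.
Proof.
move=> s t st; rewrite !expo_functionalE; have [s0|s0] := leP 0 s.
  rewrite -subr_ge0 primD; last by rewrite s0.
    by apply: Rintegral_ge0 => r _; exact: expR_ge0.
  exact: continuous_path.
rewrite {1}/prim set_itv_ge ?Rintegral_set0; last by rewrite bnd_simp -ltNge.
by apply: Rintegral_ge0 => r _; exact: expR_ge0.
Qed.

(** The exponent is bounded on the compact [0, t], so the integrand stays above a positive constant
    there. *)
Lemma expo_functional_gt0 t w : 0 < t -> 0 < I t w.
Proof.
move=> t0; rewrite expo_functionalE.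
pose X s := mu * s + sigma * W (Num.max 0 s) w.
have [M [_ MP]] : bounded_set (X @` `[0, t]%classic).
  apply: compact_bounded; apply: continuous_compact; last exact: segment_compact.
  by apply: continuous_subspaceT => x; exact: continuous_exponent.
pose M' := `|M| + 1.
have XM s : 0 <= s <= t -> X s <= M'.
  move=> st; apply: le_trans (ler_norm _) _.
  apply: (MP M'); first by rewrite /M' (le_lt_trans (ler_norm _))// ltrDl.
  by exists s => //=; rewrite in_itv.
have [N [_ NP]] : bounded_set (expo_path w @` `[0, t]%classic).
  apply: compact_bounded; apply: continuous_compact; last exact: segment_compact.
  by apply: continuous_subspaceT => x; exact: continuous_path.
have /andP[] : expR (- M') * (t - 0) <= \int[leb]_(s in `]0, t]) expo_path w s <= (`|N| + 1) * (t - 0).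
  apply: Rintegral_itv_bounds; [exact: continuous_path|exact: ltW|].
  move=> s st; apply/andP; split; first by rewrite ler_expR lerN2; exact: XM.
  apply: le_trans (ler_norm _) _.
  apply: (NP (`|N| + 1)); first by rewrite (le_lt_trans (ler_norm _))// ltrDl.
  by exists s => //=; rewrite in_itv.
have := @primD R (expo_path w) (@continuous_path w) 0 t.
rewrite lexx (ltW t0) => /(_ isT) <-.
rewrite {2}/prim set_itv1 Rintegral_set1 !subr0 => H _.
by apply: lt_le_trans H; rewrite mulr_gt0 ?expR_gt0.
Qed.

Lemma disc_sum_cvg w t : 0 <= t -> forall e, 0 < e ->
  exists2 del, 0 < del & forall h j, 0 < h < del -> `|j%:R * h - t| <= h ->
    `|disc_sum W mu sigma h 0 j w - I t w| <= e.
Proof.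
move=> t0 e e0.
have [del del0 delP] := riemann_sum_cvg (@continuous_path w) t0 e0.
exists del => // h j hh jht; have /andP[h0 _] := hh.
have := delP h j hh jht; congr (`|_ - _| <= _); last by rewrite expo_functionalE.
have := @disc_sumE _ T R W mu sigma h 0 j w.
case: BM => W0 _ _ _ _; rewrite mul0r W0 !mulr0 addr0 oppr0 expR0 mul1r add0n => ->.
by apply: eq_bigr => i _; rewrite /expo_path max_r// mulr_ge0// ltW.
Qed.

(** For t > 0, a pointwise limit of Riemann sums, each a function of finitely many increments. *)
Lemma measurable_expo_functional t : measurable_fun setT (I t).
Proof.
have [t0|t0] := leP t 0.
  rewrite (_ : I t = cst 0)//; apply/funext => w; rewrite expo_functionalE /prim.
  move: t0; rewrite le_eqVlt => /orP[/eqP ->|t0]; first by rewrite set_itv1 Rintegral_set1.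
  by rewrite set_itv_ge ?Rintegral_set0// bnd_simp -ltNge.
pose hn (n : nat) : R := t / n.+1%:R.
have hn0 n : 0 < hn n by rewrite divr_gt0.
apply: (@measurable_fun_cvg _ _ _ setT (fun n => disc_sum W mu sigma (hn n) 0 n.+1)).
  by move=> n; exact: (measurable_disc_sum mu sigma BM (hn0 n)).
move=> w _; apply/cvgrPdist_le => e e0.
have [del del0 delP] := disc_sum_cvg w (ltW t0) e0.
near=> n; rewrite distrC; apply: delP.
  rewrite hn0 /= /hn ltr_pdivrMr// mulrC -ltr_pdivrMr//.
  near: n; exists (Num.truncn (t / del)) => // m /= tm.
  by rewrite (lt_le_trans (truncnS_gt _))// ler_nat ltnS.
by rewrite /hn mulrC divfK ?pnatr_eq0// subrr normr0 ltW// divr_gt0.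
Unshelve. all: by end_near. Qed.

Definition tail (t y : R) : R := fine (P [set w | y < I t w]).

Lemma tail_IE t y : tail_I P W mu sigma t y = tail t y.
Proof.
rewrite /tail_I /cdf_I /tail.
have mE : measurable [set w | y < I t w] by apply/measurable_gt/measurable_expo_functional.
have -> : [set w | I t w <= y] = ~` [set w | y < I t w].
  by apply/seteqP; split => w /=; rewrite leNgt => /negP.
rewrite probability_setC// fineB ?fin_num_measure//=; ring.
Qed.

Lemma tailE t y : (tail t y)%:E = P [set w | y < I t w].
Proof.
by rewrite fineK// fin_num_measure//; apply/measurable_gt/measurable_expo_functional.
Qed.

Lemma tail01 t y : 0 <= tail t y <= 1.
Proof.
rewrite -!lee_fin tailE measure_ge0 probability_le1//.
exact/measurable_gt/measurable_expo_functional.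
Qed.

Lemma tail_nd y : {homo tail ^~ y : s t / s <= t}.
Proof.
move=> s t st; rewrite -lee_fin !tailE; apply: le_measure; rewrite ?inE;
  [exact/measurable_gt/measurable_expo_functional..|].
by move=> w /= /lt_le_trans; apply; exact: expo_functional_nd.
Qed.

Lemma measurable_tail y : measurable_fun setT (tail ^~ y).
Proof. by apply: nondecreasing_measurable => // s t; exact: tail_nd. Qed.

Lemma tail_y0 t : 0 < t -> tail t 0 = 1.
Proof.
move=> t0; rewrite /tail (_ : [set _ | _] = setT) ?probability_setT//.
by apply/seteqP; split => w //= _; exact: expo_functional_gt0.
Qed.

(** The events {I_t > 1 / (n + 1)} increase to the whole space because I_t is positive. *)
Lemma tail_near0 t e : 0 < t -> 0 < e -> exists2 y, 0 < y & 1 - e <= tail t y.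
Proof.
move=> t0 e0.
pose A (n : nat) := [set w | (n.+1%:R^-1 : R) < I t w].
have mA n : measurable (A n) by apply/measurable_gt/measurable_expo_functional.
have UA : \bigcup_n A n = setT.
  apply/seteqP; split => w //= _; have I0 := expo_functional_gt0 w t0.
  exists (Num.truncn (I t w)^-1) => //; rewrite /A /=.
  by rewrite -[ltRHS]invrK ltf_pV2 ?posrE ?invr_gt0// truncnS_gt.
have ndA : nondecreasing_seq A.
  move=> m n mn; apply/subsetPset => w /=; apply: le_lt_trans.
  by rewrite lef_pV2 ?posrE// ler_nat.
have : P (A m) @[m --> \oo] --> P setT.
  by rewrite -UA; apply: nondecreasing_cvg_mu => //; exact: bigcup_measurable.
rewrite probability_setT => /fine_cvg /= /cvgrPdist_lt/(_ _ e0)[m _ mP].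
exists m.+1%:R^-1 => //; have := mP m (leqnn m); rewrite /= ltr_norml => /andP[_].
by rewrite /tail -/(A m); lra.
Qed.

Lemma cell_index (h t : R) : 0 < h -> 0 < t -> exists j : nat, j%:R * h < t <= j.+1%:R * h.
Proof.
move=> h0 t0.
have ex : exists n : nat, t <= n.+1%:R * h.
  exists (Num.truncn (t / h)); rewrite -ler_pdivrMr//; exact/ltW/truncnS_gt.
have := ex_minnP ex; case=> j tj jmin; exists j; rewrite tj andbT.
case: j jmin {tj} => [|j] jmin; first by rewrite mul0r.
by rewrite ltNge; apply/negP => /jmin; rewrite ltnn.
Qed.

(** The law of I_t might charge y, hence the upper bound at y' > y only. It is the lower
    semicontinuity for the negated variables at - y', since {I_t <= y} is contained in {I_t <
    y'}. *)
Lemma disc_tail_liminf (y t : R) (hn : nat -> R) (jn : nat -> nat) : 0 < t ->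
  (forall n, 0 < hn n) -> hn n @[n --> \oo] --> (0 : R) ->
  (forall n, (jn n)%:R * hn n < t <= (jn n).+1%:R * hn n) ->
  forall e, 0 < e ->
  (\forall n \near \oo, tail t y - e <= disc_tail P W mu sigma (hn n) (jn n) y) /\
  (forall y', y < y' -> \forall n \near \oo,
     disc_tail P W mu sigma (hn n) (jn n) y' <= tail t y + e).
Proof.
move=> t0 hn0 hnc jnP e e0.
have mX n : measurable_fun setT (disc_sum W mu sigma (hn n) 0 (jn n)).
  exact: (measurable_disc_sum mu sigma BM (hn0 n)).
have mI : measurable_fun setT (I t) by exact: measurable_expo_functional.
have cX w : disc_sum W mu sigma (hn n) 0 (jn n) w @[n --> \oo] --> I t w.
  apply/cvgrPdist_le => e' e'0.
  have [del del0 delP] := disc_sum_cvg w (ltW t0) e'0.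
  near=> n; rewrite distrC; apply: delP.
    by rewrite hn0 /=; near: n; apply: (cvgr_lt 0 hnc).
  have /andP[j1 j2] := jnP n.
  have : (jn n).+1%:R * hn n = (jn n)%:R * hn n + hn n by rewrite -natr1; ring.
  by rewrite ler_norml; move: j1 j2; lra.
split; first exact: (@prob_gt_liminf _ _ _ P _ _ y mX mI cX e e0).
move=> y' yy'.
have := @prob_gt_liminf _ _ _ P (fun n w => - disc_sum W mu sigma (hn n) 0 (jn n) w)
  (fun w => - I t w) (- y') _ _ _ e e0.
move=> /(_ _ _ _)/wrap[].
- by move=> n; exact: measurableT_comp.
- exact: measurableT_comp.
- by move=> w; apply: cvgN; exact: cX.
apply: filterS => n.
have mP : measurable [set w | y < I t w] by exact: measurable_gt.
have mQ : measurable [set w | - y' < - I t w].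
  by apply: (@measurable_gt _ _ _ (fun w => - I t w)); exact: measurableT_comp.
have mPn : measurable [set w | y' < disc_sum W mu sigma (hn n) 0 (jn n) w] by exact: measurable_gt.
have mQn : measurable [set w | - y' < - disc_sum W mu sigma (hn n) 0 (jn n) w].
  apply: (@measurable_gt _ _ _ (fun w => - disc_sum W mu sigma (hn n) 0 (jn n) w)).
  exact: measurableT_comp.
have h1 : 1 - tail t y <= fine (P [set w | - y' < - I t w]).
  have -> : 1 - tail t y = fine (P (~` [set w | y < I t w])).
    by rewrite probability_setC// fineB ?fin_num_measure.
  apply: fine_le; rewrite ?fin_num_measure//; first exact: measurableC.
  apply: le_measure; rewrite ?inE//; first exact: measurableC.
  by move=> w /= /negP; rewrite -leNgt ltrN2 => /le_lt_trans; apply.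
have h2 : fine (P [set w | - y' < - disc_sum W mu sigma (hn n) 0 (jn n) w])
    <= 1 - disc_tail P W mu sigma (hn n) (jn n) y'.
  have -> : 1 - disc_tail P W mu sigma (hn n) (jn n) y' =
      fine (P (~` [set w | y' < disc_sum W mu sigma (hn n) 0 (jn n) w])).
    by rewrite probability_setC// fineB ?fin_num_measure.
  apply: fine_le; rewrite ?fin_num_measure//; first exact: measurableC.
  apply: le_measure; rewrite ?inE//; first exact: measurableC.
  by move=> w /=; rewrite ltrN2 => h; apply/negP; rewrite -leNgt ltW.
lra.
Unshelve. all: by end_near. Qed.

End functional.

(** * Identification of the Laplace transform *)

Section laplace_transform.
Context d (T : measurableType d) (R : realType) (P : probability T R).
Variables (W : R -> T -> R) (mu sigma lambda : R).
Hypotheses (BM : standard_brownian_motion P W).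
Hypotheses (sigma_gt0 : 0 < sigma) (lambda_gt0 : 0 < lambda).
Local Notation leb := (@lebesgue_measure R).
Local Notation sol := (kummer_sol mu sigma lambda).
Local Notation tail := (tail P W mu sigma).
Local Notation dtail h := (disc_tail P W mu sigma h).
Local Notation dlap h := (disc_laplace P W mu sigma lambda h).

(** The value 1, which is the limit at 0+, keeps the extension nonincreasing and hence
    measurable. *)
Definition sol_ext (y : R) : R := if 0 < y then sol y else 1.

Lemma sol_extE (y : R) : 0 < y -> sol_ext y = sol y.
Proof. by rewrite /sol_ext => ->. Qed.

Lemma sol_ext01 y : 0 <= sol_ext y <= 1.
Proof. by rewrite /sol_ext; case: ifP => [/(sol01 mu sigma_gt0 lambda_gt0)//|_]; rewrite ler01 lexx. Qed.

Lemma measurable_sol_ext : measurable_fun setT sol_ext.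
Proof.
apply: nonincreasing_measurable => // x y xy.
have [x0|x0] := ltP 0 x; last first.
  by rewrite {2}/sol_ext ltNge x0 /=; have /andP[] := sol_ext01 y.
by rewrite /sol_ext x0 (lt_le_trans x0 xy) sol_anti.
Qed.

Definition mesh (n : nat) : R := n.+1%:R^-1.
(** With mesh 1 / (n + 1) the horizon is n + 1: it tends to infinity while the mesh tends to 0. *)
Definition cells (n : nat) : nat := n.+1 * n.+1.

Lemma mesh_gt0 n : 0 < mesh n. Proof. by rewrite invr_gt0. Qed.

Lemma mesh_le1 n : mesh n <= 1. Proof. by rewrite invf_le1// ler1n. Qed.

Lemma cvg_mesh : mesh n @[n --> \oo] --> (0 : R).
Proof. exact: cvg_harmonic. Qed.

Lemma tail_anti t : {homo tail t : x y / x <= y >-> y <= x}.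
Proof.
move=> x y xy; rewrite -lee_fin !tailE//; apply: le_measure; rewrite ?inE;
  [exact/measurable_gt/(measurable_expo_functional _ _ BM)..|].
by move=> w /=; exact: le_lt_trans.
Qed.

Lemma discount_cvg0 : expR (- lambda * mesh n) ^+ cells n @[n --> \oo] --> (0 : R).
Proof.
apply/cvgrPdist_le => e e0; near=> n.
rewrite sub0r normrN ger0_norm ?exprn_ge0 ?expR_ge0// -expRM_natl.
have -> : (cells n)%:R * (- lambda * mesh n) = - (lambda * n.+1%:R).
  by rewrite /cells /mesh natrM; field; rewrite addrC natr1 pnatr_eq0.
rewrite expRN -[leRHS]invrK lef_pV2 ?posrE ?expR_gt0 ?invr_gt0//.
apply: le_trans (expR_ge1Dx _); rewrite (le_trans (y := lambda * n.+1%:R))//; last by rewrite lerDr.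
rewrite mulrC -ler_pdivrMr//.
near: n; exists (Num.truncn (e^-1 / lambda)) => // m /= hm.
by rewrite ltW// (lt_le_trans (truncnS_gt _))// ler_nat ltnS.
Unshelve. all: by end_near. Qed.

(** The three summands of the bound in [disc_laplace_compare] are each brought below e / 3. *)
Lemma disc_laplace_cvg (y : R) : 0 < y ->
  dlap (mesh n) (cells n) y @[n --> \oo] --> sol y.
Proof.
move=> y_gt0; apply/cvgrPdist_le => e e0.
pose eta := e / 3.
have eta0 : 0 < eta by rewrite divr_gt0.
have eta3 : 0 < eta / 3 by rewrite divr_gt0.
(* Up to time t0 discounting costs at most lambda t0 = eta / 3. With 2 eta / 3 lost on the discrete
   tail at t0, the averages stay above 1 - eta below y0. *)
pose t0 := eta / 3 / lambda.
have t00 : 0 < t0 by rewrite divr_gt0.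
have [y2 y20 tl2] := tail_near0 mu sigma BM t00 eta3.
have [y1 y10 sl1] := sol_near0 mu sigma_gt0 lambda_gt0 eta0.
pose y0 := Num.min y1 y2.
have y00 : 0 < y0 by rewrite lt_min y10.
have tl0 : 1 - eta / 3 <= tail t0 y0.
  by rewrite (le_trans tl2)// tail_anti// ge_min lexx orbT.
have /choice[jn jnP] n := cell_index (mesh_gt0 n) t00.
have [ev1 _] := @disc_tail_liminf _ _ _ P W mu sigma BM y0 t0 mesh jn t00 mesh_gt0 cvg_mesh jnP _ eta3.
have [K K0 [pqK tay]] := sol_taylor mu sigma_gt0 lambda_gt0 y00.
(* Chosen so that e' h / (1 - q) <= eta: indeed 1 - q >= lambda h q >= lambda h e^(- lambda) for h
   <= 1. *)
pose e' := eta * lambda * expR (- lambda).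
have e'0 : 0 < e' by rewrite !mulr_gt0 ?expR_gt0.
have [h0 h00 os] := @one_step_consistency R mu sigma lambda sigma_gt0 lambda_gt0 sol sol_ext
  (sol_p mu sigma lambda) (sol_q mu sigma lambda) y0 K y00 K0
  sol_extE sol_ext01 measurable_sol_ext pqK tay
  (fun y yy0 => sol_ode mu sigma_gt0 lambda_gt0 (lt_le_trans y00 yy0)) e' e'0.
near=> n; rewrite distrC.
have hp := mesh_gt0 n.
set h := mesh n in hp *; set q := expR (- lambda * h).
have q0 : 0 < q by exact: expR_gt0.
have q1 : q < 1 by rewrite -expR0 ltr_expR mulNr oppr_lt0 mulr_gt0.
have dt : 1 - eta / 3 - eta / 3 <= dtail h (jn n) y0.
  apply: le_trans (_ : tail t0 y0 - eta / 3 <= _); first by rewrite lerD2r.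
  by rewrite /h; near: n.
have near0 m y' : y' < y0 -> 1 - eta <= dlap h m y'.
  move=> yy0; apply: le_trans (@disc_laplace_ge _ _ _ P W mu sigma lambda h BM lambda_gt0 hp (jn n) m y').
  rewrite -/q.
  have dd := disc_tail_anti mu sigma BM hp (jn n) (ltW yy0).
  have /andP[d0 d1] := disc_tail01 mu sigma BM hp (jn n) y'.
  have Q1 : 1 - eta / 3 <= q ^+ jn n.
    rewrite -expRM_natl; apply: le_trans (expR_ge1Dx _); rewrite lerD2l.
    have /andP[j1 _] := jnP n; rewrite -/h in j1.
    have -> : (jn n)%:R * (- lambda * h) = - (lambda * ((jn n)%:R * h)) by ring.
    rewrite lerN2 mulrC -ler_pdivlMr//; exact: ltW.
  have Q2 : q ^+ jn n <= 1 by rewrite exprn_ile1// ltW.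
  by nra.
have := @disc_laplace_compare _ _ _ P W mu sigma lambda h BM lambda_gt0 hp sol_ext y0 eta (e' * h)
  y00 (ltW eta0) (ltW (mulr_gt0 e'0 hp)) measurable_sol_ext sol_ext01 _ near0 _ (cells n) y.
rewrite (sol_extE y_gt0) -/q => /(_ _ _)/wrap[].
- move=> y' yy0; rewrite /sol_ext; case: ifPn => [y'0|_]; last by rewrite lerBlDr lerDl ltW.
  by apply: sl1; rewrite y'0 (le_trans (ltW yy0))// ge_min lexx.
- move=> y' yy0; rewrite (sol_extE (lt_le_trans y00 yy0)).
  by apply: os => //; rewrite hp /= /h; near: n; apply: (cvgr_lt 0 cvg_mesh).
move=> /le_trans; apply.
have eh : e' * h / (1 - q) <= eta.
  rewrite ler_pdivrMr ?subr_gt0//.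
  have ql : expR (- lambda) <= q.
    by rewrite ler_expR mulNr lerN2 ler_piMr ?(ltW lambda_gt0)// mesh_le1.
  have qq : lambda * h * q <= 1 - q.
    have : q * (1 + lambda * h) <= q * expR (lambda * h) by rewrite ler_wpM2l ?expR_ge1Dx// ltW.
    by rewrite -expRD mulNr addNr expR0; lra.
  have g : lambda * h * expR (- lambda) <= 1 - q.
    by apply: le_trans qq; rewrite ler_wpM2l// mulr_ge0// ltW.
  have -> : e' * h = eta * (lambda * h * expR (- lambda)) by rewrite /e'; ring.
  by rewrite ler_wpM2l// ltW.
have qn : q ^+ cells n <= eta.
  have : `|0 - expR (- lambda * mesh n) ^+ cells n| <= eta.
    by near: n; move/cvgrPdist_le : discount_cvg0; apply.
  by rewrite sub0r normrN -/h -/q ger0_norm// exprn_ge0// ltW.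
have e3 : e = eta + eta + eta by rewrite /eta; field.
rewrite e3; lra.
Unshelve. all: by end_near. Qed.

(** A step function in time, equal to 0 beyond the horizon n h; it turns geometric sums into Laplace
    integrals that can be compared with the tail under the integral sign. *)
Definition cell_fun (h : R) (n : nat) (G : nat -> R) (t : R) : R :=
  \sum_(j < n) G j * \1_[set` `]j%:R * h, j.+1%:R * h] ] t.

Lemma cell_funE h n G t j : 0 < h -> j%:R * h < t <= j.+1%:R * h ->
  cell_fun h n G t = if (j < n)%N then G j else 0.
Proof.
move=> h0 /andP[jt tj].
have other i : i != j -> G i * \1_[set` `]i%:R * h, i.+1%:R * h] ] t = 0.
  move=> ij; rewrite indicE memNset ?mulr0//= in_itv /=; apply/negP; rewrite negb_and -leNgt -ltNge.
  move: ij; rewrite neq_ltn => /orP[ij|ij]; apply/orP; [right|left].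
    by apply: le_lt_trans jt; rewrite ler_pM2r// ler_nat.
  by apply: le_trans tj _; rewrite ler_pM2r// ler_nat.
case: ifPn => [jn|]; last first.
  rewrite -leqNgt => nj; rewrite /cell_fun big1// => i _; apply: other.
  by rewrite neq_ltn (leq_trans (ltn_ord i) nj).
rewrite /cell_fun (bigD1 (Ordinal jn))//= big1 ?addr0; last first.
  by move=> i ij; apply: other; apply: contra ij => /eqP ij; apply/eqP/val_inj.
by rewrite indicE mem_set ?mulr1//= in_itv /= jt.
Qed.

Lemma measurable_cell_fun h n G : measurable_fun setT (cell_fun h n G).
Proof.
by apply: measurable_sum => j; apply: measurable_funM => //; exact: measurable_indic.
Qed.

Let wgt (t : R) : R := expR (- (lambda * t)).

Let measurable_wgt : measurable_fun setT wgt.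
Proof.
by apply: measurableT_comp => //; apply: measurableT_comp => //; exact: measurable_funM.
Qed.

Lemma integral_wgt_itv (a b : R) : a < b ->
  (\int[leb]_(t in `]a, b]) (wgt t)%:E = (lambda^-1 * (wgt a - wgt b))%:E)%E.
Proof.
move=> ab.
have dF t : is_derive t (1 : R) (fun t => - lambda^-1 * wgt t) (wgt t).
  have dl : is_derive t (1 : R) (fun t => - (lambda * t)) (- lambda).
    by have := is_derive1Z (is_derive1_idE t) (- lambda); rewrite mulr1; under eq_fun do rewrite mulNr.
  have de := @is_derive1_comp R expR (fun t : R => - (lambda * t)) t _ _
    (is_derive_expR (- (lambda * t))) dl.
  have := is_derive1Z de (- lambda^-1).
  congr is_derive; rewrite /wgt; field; exact: lt0r_neq0.
have cF t : {for t, continuous (fun t => - lambda^-1 * wgt t)}.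
  by apply/differentiable_continuous/derivable1_diffP; exact: ex_derive.
rewrite integral_itv_obnd_cbnd; last by apply: measurable_funTS; apply/measurable_EFinP.
rewrite (@continuous_FTC2 _ _ (fun t => - lambda^-1 * wgt t))//.
- by rewrite -EFinB; congr EFin; ring.
- apply: continuous_subspaceT => t; apply: continuous_comp; last exact: continuous_expR.
  by apply: cvgN; apply: cvgMl_tmp; exact: cvg_id.
- split.
  + by move=> t _; exact: ex_derive.
  + by apply: cvg_at_right_filter; exact: cF.
  + by apply: cvg_at_left_filter; exact: cF.
- by move=> t _; rewrite derive1E; exact: derive_val.
Qed.

Local Notation D := (`]0%R, +oo[%classic : set R).

(** The weight e^(- lambda t) has integral lambda^-1 (1 - q) q^j over cell j: these are the
    geometric weights of [disc_laplace]. *)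
Lemma integral_cell_fun h n (G : nat -> R) : 0 < h -> (forall j, 0 <= G j) ->
  (\int[leb]_(t in D) (wgt t * cell_fun h n G t)%:E =
   (lambda^-1 * \sum_(j < n) (1 - expR (- lambda * h)) * expR (- lambda * h) ^+ j * G j)%:E)%E.
Proof.
move=> h0 G0.
have mt j : measurable_fun D (fun t : R => (wgt t * (G j * \1_[set` `]j%:R * h, j.+1%:R * h] ] t))%:E).
  apply: measurable_funTS; apply/measurable_EFinP; apply: measurable_funM => //.
  by apply: measurable_funM => //; exact: measurable_indic.
under eq_integral do rewrite /cell_fun mulr_sumr -sumEFin.
rewrite ge0_integral_sum//; last 2 first.
- by move=> j; exact: mt.
- by move=> j t _; rewrite lee_fin mulr_ge0 ?expR_ge0// mulr_ge0// indicE.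
rewrite mulr_sumr -sumEFin; apply: eq_bigr => j _.
have -> : (\int[leb]_(t in D) (wgt t * (G j * \1_[set` `]j%:R * h, j.+1%:R * h] ] t))%:E =
    \int[leb]_(t in `](j%:R * h)%R, (j.+1%:R * h)%R]) ((G j)%:E * (wgt t)%:E))%E.
  rewrite integral_mkcond [RHS]integral_mkcond; apply: eq_integral => t _.
  rewrite !patchE indicE; have [tj|tj] := boolP (t \in [set` `]j%:R * h, j.+1%:R * h] ]).
    rewrite ifT; first by rewrite mulr1 mulrC EFinM.
    move: tj; rewrite !inE /= !in_itv /= andbT => /andP[jt _].
    by apply: le_lt_trans jt; rewrite mulr_ge0// ltW.
  by rewrite mulr0 mulr0; case: ifP.
rewrite ge0_integralZl_EFin//; last 2 first.
- by move=> t _; rewrite lee_fin expR_ge0.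
- by apply: measurable_funTS; apply/measurable_EFinP.
rewrite integral_wgt_itv ?ltr_pM2r ?ltr_nat// -EFinM; congr EFin.
have w i : wgt (i%:R * h) = expR (- lambda * h) ^+ i.
  by rewrite /wgt -expRM_natl; congr expR; ring.
by rewrite !w exprS; ring.
Qed.

Lemma integrable_wgt : leb.-integrable D (EFin \o wgt).
Proof.
apply/integrableP; split; first by apply: measurable_funTS; apply/measurable_EFinP.
under eq_integral do rewrite /= ger0_norm ?expR_ge0//.
by rewrite integral_expRN// ltry.
Qed.

Let V (y : R) : R := fine (\int[leb]_(t in D) (wgt t * tail t y)%:E)%E.

Lemma laplace_tailE y : laplace_tail P W mu sigma lambda y = V y.
Proof.
rewrite /laplace_tail /V; congr fine; apply: eq_integral => t _.
by rewrite tail_IE.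
Qed.

Lemma integrable_wgtM (a : R -> R) : measurable_fun setT a -> (forall t, D t -> 0 <= a t <= 1) ->
  leb.-integrable D (fun t => (wgt t * a t)%:E).
Proof.
move=> ma a01; apply: (le_integrable _ _ _ integrable_wgt) => //.
  by apply: measurable_funTS; apply/measurable_EFinP; exact: measurable_funM.
move=> t Dt; have /andP[a0 a1] := a01 t Dt.
rewrite lee_fin /= normrM !ger0_norm ?expR_ge0//.
by rewrite ler_piMr ?expR_ge0.
Qed.

Let cellf n y := cell_fun (mesh n) (cells n) (fun j => dtail (mesh n) j y).

Lemma cellf01 n y t : D t -> 0 <= cellf n y t <= 1.
Proof.
rewrite /= in_itv /= andbT => t0.
have [j jP] := cell_index (mesh_gt0 n) t0.
rewrite /cellf (cell_funE _ _ (mesh_gt0 n) jP); case: ifP => _; last by rewrite lexx ler01.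
exact: (disc_tail01 mu sigma BM (mesh_gt0 n)).
Qed.

Lemma integral_cellf_cvg y : 0 < y ->
  fine (\int[leb]_(t in D) (wgt t * cellf n y t)%:E)%E @[n --> \oo] --> lambda^-1 * sol y.
Proof.
move=> y0.
have E n : fine (\int[leb]_(t in D) (wgt t * cellf n y t)%:E)%E =
   lambda^-1 * (dlap (mesh n) (cells n) y - expR (- lambda * mesh n) ^+ cells n).
  rewrite /cellf integral_cell_fun ?mesh_gt0//; last first.
    by move=> j; have /andP[] := disc_tail01 mu sigma BM (mesh_gt0 n) j y.
  by rewrite /disc_laplace addrK.
under eq_fun do rewrite E.
apply: cvgMl_tmp; rewrite -[X in _ --> X]subr0; apply: cvgB; last exact: discount_cvg0.
exact: disc_laplace_cvg.
Qed.

Lemma cellf_liminf y t e : 0 < t -> 0 < e ->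
  (\forall n \near \oo, tail t y - e <= cellf n y t) /\
  (forall y', y < y' -> \forall n \near \oo, cellf n y' t <= tail t y + e).
Proof.
move=> t0 e0; have /choice[jn jnP] n := cell_index (mesh_gt0 n) t0.
have [l1 l2] := @disc_tail_liminf _ _ _ P W mu sigma BM y t mesh jn t0 mesh_gt0 cvg_mesh jnP _ e0.
(* For n large t lies before the horizon n + 1, so its cell is among the [cells n] first ones and
   the default value 0 is avoided. *)
have cE y' : \forall n \near \oo, cellf n y' t = dtail (mesh n) (jn n) y'.
  near=> n; rewrite /cellf (cell_funE _ _ (mesh_gt0 n) (jnP n)) ifT//.
  have /andP[j1 _] := jnP n.
  rewrite -(ltr_nat R) /cells natrM; move: j1; rewrite /mesh ltr_pdivrMr// => j1.
  apply: lt_le_trans j1 _; rewrite ler_pM2r//.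
  near: n; exists (Num.truncn t) => // m /= hm.
  by rewrite ltW// (lt_le_trans (truncnS_gt _))// ler_nat ltnS.
split=> [|y' yy'].
  by near=> n; rewrite (near (cE y) n)//; near: n.
by have l3 := l2 _ yy'; near=> n; rewrite (near (cE y') n)//; near: n.
Unshelve. all: by end_near. Qed.

Lemma wgt_dct (a : nat -> R -> R) (b : R -> R) :
  (forall n, measurable_fun setT (a n)) -> measurable_fun setT b ->
  (forall n t, D t -> 0 <= a n t <= 1) -> (forall t, D t -> a n t @[n --> \oo] --> b t) ->
  fine (\int[leb]_(t in D) (wgt t * a n t)%:E)%E @[n --> \oo] -->
  fine (\int[leb]_(t in D) (wgt t * b t)%:E)%E.
Proof.
move=> ma mb a01 ab.
have mD : measurable D by exact: measurable_itv.
have mm (c : R -> R) : measurable_fun setT c -> measurable_fun D (fun t => (wgt t * c t)%:E).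
  by move=> mc; apply: measurable_funTS; apply/measurable_EFinP; exact: measurable_funM.
have := @dominated_convergence _ _ _ leb D mD (fun n t => (wgt t * a n t)%:E)
  (fun t => (wgt t * b t)%:E) (EFin \o wgt) (fun n => mm _ (ma n)) (mm _ mb).
move=> /(_ _ integrable_wgt _)/wrap[].
- apply: aeW => t Dt; apply: cvg_EFin; first exact: nearW.
  by apply: cvgMl_tmp; exact: ab.
- apply: aeW => t n Dt; have /andP[a0 a1] := a01 n t Dt.
  by rewrite lee_fin ger0_norm ?mulr_ge0 ?expR_ge0// ler_piMr ?expR_ge0.
move=> [/= ib _ lim]; apply: fine_cvg; rewrite fineK; first exact: lim.
exact: integrable_fin_num.
Qed.

Lemma le_wgt (a b : R -> R) : measurable_fun setT a -> measurable_fun setT b ->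
  (forall t, D t -> 0 <= a t <= 1) -> (forall t, D t -> 0 <= b t <= 1) ->
  (forall t, D t -> a t <= b t) ->
  fine (\int[leb]_(t in D) (wgt t * a t)%:E)%E <=
  fine (\int[leb]_(t in D) (wgt t * b t)%:E)%E.
Proof.
move=> ma mb a01 b01 ab.
have mD : measurable D by exact: measurable_itv.
apply: fine_le; try (apply: integrable_fin_num => //; exact: integrable_wgtM).
apply: le_integral => //; try exact: integrable_wgtM.
by move=> t /[!inE] Dt; rewrite lee_fin ler_wpM2l ?expR_ge0// ab.
Qed.

(** [cellf] is controlled only from below at y, but its minimum with the tail converges to the tail:
    dominated convergence applies to the minimum, whose integral is at most that of [cellf]. *)
Lemma laplace_le_sol y : 0 < y -> V y <= lambda^-1 * sol y.
Proof.
move=> y0; have mc n : measurable_fun setT (cellf n y) by exact: measurable_cell_fun.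
have mt : measurable_fun setT (tail ^~ y) by exact: measurable_tail.
pose a n t := Num.min (cellf n y t) (tail t y).
have ma n : measurable_fun setT (a n) by exact: measurable_minr.
have a01 n t : D t -> 0 <= a n t <= 1.
  move=> Dt; have /andP[c0 c1] := cellf01 n y Dt; have /andP[p0 p1] := tail01 mu sigma BM t y.
  by rewrite /a le_min c0 p0 ge_min c1.
have ab t : D t -> a n t @[n --> \oo] --> tail t y.
  rewrite /= in_itv /= andbT => t0; apply/cvgrPdist_le => e e0.
  have [l1 _] := cellf_liminf y t0 e0.
  near=> n; rewrite ger0_norm; last by rewrite subr_ge0 ge_min lexx orbT.
  rewrite lerBlDr addrC -lerBlDr /a le_min; apply/andP; split; first by near: n.
  by rewrite lerBlDr lerDl ltW.
have c1 := wgt_dct ma mt a01 ab.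
apply: ler_cvg_to c1 (integral_cellf_cvg y0) _.
apply: nearW => n; apply: le_wgt => //.
- by move=> t; exact: a01.
- by move=> t; exact: cellf01.
- by move=> t _; rewrite /a ge_min lexx.
Unshelve. all: by end_near. Qed.

(** The dual argument, with the maximum of the tail at y and of [cellf] at y' > y, where the upper
    control is available. *)
Lemma sol_le_laplace y y' : 0 < y -> y < y' -> lambda^-1 * sol y' <= V y.
Proof.
move=> y0 yy'; have y'0 := lt_trans y0 yy'.
have mc n : measurable_fun setT (cellf n y') by exact: measurable_cell_fun.
have mt : measurable_fun setT (tail ^~ y) by exact: measurable_tail.
pose a n t := Num.max (cellf n y' t) (tail t y).
have ma n : measurable_fun setT (a n) by exact: measurable_maxr.
have a01 n t : D t -> 0 <= a n t <= 1.
  move=> Dt; have /andP[c0 c1] := cellf01 n y' Dt; have /andP[p0 p1] := tail01 mu sigma BM t y.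
  by rewrite /a le_max c0 ge_max c1 p1.
have ab t : D t -> a n t @[n --> \oo] --> tail t y.
  rewrite /= in_itv /= andbT => t0; apply/cvgrPdist_le => e e0.
  have [_ /(_ _ yy') l1] := cellf_liminf y t0 e0.
  near=> n; rewrite distrC ger0_norm; last by rewrite subr_ge0 le_max lexx orbT.
  rewrite lerBlDr addrC /a ge_max; apply/andP; split; first by near: n.
  by rewrite lerDl ltW.
have c1 := wgt_dct ma mt a01 ab.
apply: ler_cvg_to (integral_cellf_cvg y'0) c1 _.
apply: nearW => n; apply: le_wgt => //.
- by move=> t; exact: cellf01.
- by move=> t; exact: a01.
- by move=> t _; rewrite /a le_max lexx.
Unshelve. all: by end_near. Qed.

(** Continuity of [sol] removes the strict inequality, along y' = y + 1 / (n + 1). *)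
Lemma laplace_tail_sol y : 0 < y ->
  laplace_tail P W mu sigma lambda y = lambda^-1 * sol y.
Proof.
move=> y0; rewrite laplace_tailE; apply/eqP; rewrite eq_le laplace_le_sol//=.
have cs : {for y, continuous sol}.
  apply/differentiable_continuous/derivable1_diffP.
  by have := is_derive_sol mu sigma_gt0 lambda_gt0 y0 => ?; exact: ex_derive.
have yn : y + n.+1%:R^-1 @[n --> \oo] --> y.
  rewrite -[X in _ --> X]addr0; apply: cvgD; [exact: cvg_cst|exact: cvg_harmonic].
have c1 : lambda^-1 * sol (y + n.+1%:R^-1) @[n --> \oo] --> lambda^-1 * sol y.
  by apply: cvgMl_tmp; exact: (continuous_cvg _ cs yn).
apply: ler_cvg_to c1 (cvg_cst _) _.
by apply: nearW => n; apply: sol_le_laplace => //; rewrite ltrDl invr_gt0.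
Qed.

Lemma laplace_tail_0 : laplace_tail P W mu sigma lambda 0 = lambda^-1.
Proof.
rewrite laplace_tailE /V -[RHS]/(fine (lambda^-1)%:E) -integral_expRN//; congr fine.
apply: eq_integral => t; rewrite inE /= in_itv /= andbT => t0.
by rewrite tail_y0// mulr1.
Qed.

Lemma sol_cvg0 : sol y @[y --> +oo] --> (0 : R).
Proof.
apply/cvgrPdist_le => e e0.
(* For z <= 1 the Kummer factor is at most [expR 1], so the solution is O(z^k); [z0] is chosen to
   have z^k <= e / C. The summand 1 keeps [C] positive. *)
pose C := `|sol_const mu sigma lambda| * expR 1 + 1.
have C0 : 0 < C by rewrite ltr_wpDl// mulr_ge0 ?expR_ge0.
pose k := kexp mu sigma lambda.
have k0 : 0 < k by exact: kexp_gt0.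
pose e' := e / C.
have e'0 : 0 < e' by rewrite divr_gt0.
pose z0 := Num.min 1 (e' `^ k^-1).
have z00 : 0 < z0 by rewrite lt_min ltr01 powR_gt0.
have s2 : 0 < sigma ^+ 2 by exact: exprn_gt0.
near=> y.
have y0 : 0 < y by near: y; apply: nbhs_pinfty_gt; exact: num_real.
have yz : 2 / (z0 * sigma ^+ 2) <= y by near: y; apply: nbhs_pinfty_ge; exact: num_real.
have zp := zarg_gt0 sigma_gt0 y0.
have zz : zarg sigma y <= z0.
  move: yz; rewrite /zarg !ler_pdivrMr ?mulr_gt0//.
  by rewrite mulrCA.
have zk : zarg sigma y `^ k <= e'.
  have -> : e' = (e' `^ k^-1) `^ k by rewrite -powRrM mulVf ?gt_eqF// powRr1// ltW.
  apply: ge0_ler_powR; rewrite ?nnegrE ?powR_ge0 ?(ltW zp) ?(ltW k0)//.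
  by rewrite (le_trans zz)// ge_min lexx orbT.
have zm : `|kummer_diff k (cpar mu sigma + 2 * k) 0 (- zarg sigma y)| <= expR 1.
  apply: le_trans (kummer_diff_le k0 (kexp_leB mu sigma_gt0 lambda_gt0) _ _) _.
  by rewrite normrN (gtr0_norm zp) ler_expR (le_trans zz)// ge_min lexx.
rewrite sub0r normrN /kummer_sol /kterm addr0 normrM [X in _ * X <= _]normrM (ger0_norm (powR_ge0 _ _)).
apply: (@le_trans _ _ (`|sol_const mu sigma lambda| * (e' * expR 1))).
  by apply: ler_wpM2l => //; apply: ler_pM; rewrite ?powR_ge0.
have -> : e = e' * C by rewrite /e' divfK// gt_eqF.
by rewrite mulrCA ler_wpM2l ?(ltW e'0)// lerDl.
Unshelve. all: by end_near. Qed.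

End laplace_transform.

Theorem theorem1 (R : realType) (d : measure_display) (T : measurableType d)
    (P : probability T R) (W : R -> T -> R) (mu sigma : R) :
  standard_brownian_motion P W -> 0 < sigma ->
  let b := mu + sigma ^+ 2 / 2 in
  forall lambda : R, 0 < lambda ->
  let Pf := laplace_tail P W mu sigma lambda in
  let k := (mu + Num.sqrt (mu ^+ 2 + 2 * lambda * sigma ^+ 2)) / sigma ^+ 2 in
  let c := 1 - 2 * mu / sigma ^+ 2 in
  [/\ (forall y, 0 < y ->
         [/\ derivable Pf y 1, derivable (derive1 Pf) y 1 &
             1 / 2 * sigma ^+ 2 * y ^+ 2 * derive1 (derive1 Pf) y
             + (b * y - 1) * derive1 Pf y - lambda * Pf y = 0]),
      Pf 0 = lambda^-1,
      Pf y @[y --> +oo] --> 0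
    & (forall y, 0 < y ->
         Pf y = lambda^-1 * powR (2 / (y * sigma ^+ 2)) k
                * (Gamma (c + k) / Gamma (c + 2 * k))
                * kummerM k (c + 2 * k) (- (2 / (y * sigma ^+ 2))))].
Proof.
move=> BM sigma0 b lambda lambda0 Pf k c.
pose p := sol_p mu sigma lambda; pose q := sol_q mu sigma lambda.
have PfE y : 0 < y -> Pf y = lambda^-1 * kummer_sol mu sigma lambda y.
  by move=> y0; exact: laplace_tail_sol.
(* The identity with the explicit solution holds on the open half-line, which suffices since
   derivatives are local; both derivatives of [Pf] are obtained in this way. *)
have near_pos (y : R) : 0 < y -> \forall t \near y, 0 < t by exact: lt_nbhsr.
have d1 (y : R) : 0 < y -> is_derive y (1 : R) Pf (lambda^-1 * (p y / y)).
  move=> y0; have dy := is_derive1Z (is_derive_sol mu sigma0 lambda0 y0) lambda^-1.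
  apply: (near_eq_is_derive _ dy) => //; near=> t; apply/esym/PfE.
  by near: t; exact: near_pos.
have d1E (y : R) : 0 < y -> derive1 Pf y = lambda^-1 * (p y / y).
  by move=> /d1 dy; rewrite derive1E derive_val.
have d2 (y : R) : 0 < y -> is_derive y (1 : R) (derive1 Pf) (lambda^-1 * (q y / y ^+ 2)).
  move=> y0; have dy := is_derive1Z (is_derive_sol_p mu sigma0 lambda0 y0) lambda^-1.
  apply: (near_eq_is_derive _ dy) => //; near=> t; apply/esym/d1E.
  by near: t; exact: near_pos.
split.
- move=> y y0; have dy := d1 _ y0; have ddy := d2 _ y0; split; [exact: ex_derive..|].
  rewrite derive1E derive_val d1E// PfE//.
  have := sol_ode mu sigma0 lambda0 y0; rewrite -/p -/q -/b => ode.
  have yn0 := lt0r_neq0 y0; have ln0 := lt0r_neq0 lambda0.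
  rewrite -[RHS](mulr0 lambda^-1) -ode /b; field.
  by rewrite yn0.
- exact: laplace_tail_0.
- have c0 : lambda^-1 * kummer_sol mu sigma lambda y @[y --> +oo] --> (0 : R).
    by rewrite -[X in _ --> X](mulr0 lambda^-1); apply: cvgMl_tmp; exact: sol_cvg0.
  apply: cvg_trans c0; apply: near_eq_cvg; near=> y; apply/esym/PfE.
  by near: y; apply: nbhs_pinfty_gt; exact: num_real.
- move=> y y0; rewrite PfE// kummerME /kummer_sol /kterm /sol_const addr0.
  rewrite /zarg -/k -/c; ring.
Unshelve. all: by end_near. Qed.
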